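(* Let $\Phi: X\times\mathbb{R}\to X$ be a continuous flow on a compact, locally path connected metric space $X$ and let $\xi\in\check H^1(X;\mathbb{R})$. Let $R=R(\Phi)$ be the chain recurrent set of $\Phi$, let $R_\xi=R_\xi(\Phi)$ be the subset associated with $\xi$, and let $C_\xi=R-R_\xi$. Consider the two conditions (A) $\xi|_{R_\xi}=0$ in $\check H^1(R_\xi;\mathbb{R})$; (B) there exist constants $\delta>0$, $T>1$ such that every homology class $z\in H_1(X;\mathbb{Z})$ associated to an arbitrary $(\delta,T)$-cycle $(x,t)$ with $x\in C_\xi$ satisfies $\langle\xi,z\rangle\le -1$. If (A) and (B) hold, then there exists a Lyapunov one-form $\omega$ for $(\Phi,R_\xi)$ representing the cohomology class $\xi$; moreover, the subset $C_\xi$ is closed. Conversely, if there exists a Lyapunov one-form for the pair $(\Phi,R_\xi)$ in the class $\xi$ and if the set $C_\xi$ is closed, then (A) and (B) hold.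
   Context: Write $x\cdot t=\Phi(x,t)$ and let $d$ be the metric of $X$. Closed one-forms. A continuous closed one-form $\omega$ on $X$ is given by an open cover $\mathcal U$ of $X$ and continuous functions $\varphi_U:U\to\mathbb{R}$, $U\in\mathcal U$, such that for all $U,V\in\mathcal U$ the difference $\varphi_U|_{U\cap V}-\varphi_V|_{U\cap V}$ is locally constant (constant on each connected component of $U\cap V$); two such families are identified if their union again satisfies this condition. A continuous function $f$ defines the one-form $df$ (the family consisting of $f$ alone). Forms are restricted to subsets by restricting the functions. For a path $\gamma:[0,1]\to X$, $\int_\gamma\omega=\sum_{i=1}^N\left(\varphi_{U_i}(\gamma(t_i))-\varphi_{U_i}(\gamma(t_{i-1}))\right)$ for any subdivision $0=t_0<\dots<t_N=1$ with $\gamma([t_{i-1},t_i])\subset U_i\in\mathcal U$. The integral $\int_x^{x\cdot t}\omega$ is taken along the trajectory $\tau\mapsto x\cdot\tau$, $\tau\in[0,t]$. Closed one-forms are the global sections of the quotient sheaf $B_X=C_X/\mathbb{R}_X$ (continuous real functions modulo locally constant ones), and $[\omega]\in\check H^1(X;\mathbb{R})=H^1(X;\mathbb{R}_X)$ is the image of $\omega$ under the connecting homomorphism of $0\to\mathbb{R}_X\to C_X\to B_X\to0$. One says $\omega$ represents (lies in) $\xi$ if $[\omega]=\xi$. The pairing $\langle\xi,z\rangle\in\mathbb{R}$ for $z\in H_1(X;\mathbb{Z})$ is $\int_\gamma\omega$, where $[\omega]=\xi$ and $\gamma$ is a loop (or singular cycle) representing $z$. Lyapunov one-form. Let $Y\subset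 X$ be closed and invariant under $\Phi$. A continuous closed one-form $\omega$ on $X$ is a Lyapunov one-form for $(\Phi,Y)$ if (L1) $\int_x^{x\cdot t}\omega<0$ for every $x\in X-Y$ and $t>0$; and (L2) there is a continuous function $f:U\to\mathbb{R}$ on an open neighborhood $U$ of $Y$ such that $\omega|_U=df$ and $f$ is constant on every connected component of $Y$. Chains. A $(\delta,T)$-chain from $x$ to $y$ is a sequence $x_0=x,x_1,\dots,x_N=y$ in $X$ with $t_1,\dots,t_N\in\mathbb{R}$ such that $t_i\ge T$ and $d(x_{i-1}\cdot t_i,x_i)<\delta$ for $1\le i\le N$. It is closed if $x=y$. A $(\delta,T)$-cycle is a pair $(x,t)\in X\times\mathbb{R}$ with $t\ge T$ and $d(x,x\cdot t)<\delta$, i.e. a closed chain with $N=1$. $R(\Phi)$ is the set of $x\in X$ such that for all $\delta>0$, $T\ge1$ there is a $(\delta,T)$-chain from $x$ to $x$. Scale and associated classes. A scale of $\xi$ is a pair $(\varepsilon,\delta_0)$ of positive numbers such that $\xi|_B=0$ for every ball $B\subset X$ of radius $2\varepsilon$, and any $x,y\in X$ with $d(x,y)<\delta_0$ can be joined by a path contained in a ball of radius $\varepsilon$. Fix a scale. A homology class $z\in H_1(X;\mathbb{Z})$ is associated with a closed $(\delta,T)$-chain if it is represented by the singular cycle obtained by concatenating the trajectory pieces from $x_{i-1}$ to $x_{i-1}\cdot t_i$ with paths $\sigma_i$ from $x_{i-1}\cdot t_i$ to $x_i$, each lying in some ball of radius $\varepsilon$. The number $\langle\xi,z\rangle$ does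 not depend on the choice of the $\sigma_i$. The set $R_\xi$. $R_\xi(\Phi)$ is the set of $x\in X$ such that for any $0<\delta'<\delta_0$ and $T>1$ there is a $(\delta',T)$-chain from $x$ to $x$ with $\langle\xi,z\rangle=0$ for any homology class $z$ associated with this chain. It is a closed flow-invariant subset of $R(\Phi)$. *)

(* Defs.v *)
From HB Require Import structures.
From mathcomp Require Import all_boot all_order all_algebra.
From mathcomp Require Import generic_quotient freeg.
From mathcomp Require Import all_classical all_reals topology normedtype.

Set Implicit Arguments.
Unset Strict Implicit.
Unset Printing Implicit Defensive.

Import Order.TTheory GRing.Theory Num.Theory numFieldNormedType.Exports.

Local Open Scope classical_set_scope.
Local Open Scope ring_scope.
Local Open Scope quotient_scope.

(* Sections over [A] of the constant sheaf. When [A] is an open subset of a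
   locally connected space, this amounts to being constant on each connected
   component of [A]. *)
Definition locally_constant {T : topologicalType} {M : Type}
    (A : set T) (f : T -> M) : Prop :=
  forall x, A x -> \forall y \near x, A y -> f y = f x.

Definition open_cover {T : topologicalType} (W : set (set T)) : Prop :=
  W `<=` open /\ \bigcup_(U in W) U = setT.

Section LocallyConstantTheory.
Context {T : topologicalType} {M : zmodType}.
Implicit Types (A B : set T) (f g : T -> M).

Lemma locally_constantS A B f :
  A `<=` B -> locally_constant B f -> locally_constant A f.
Proof.
move=> AB Bf x Ax; have := Bf x (AB _ Ax).
by apply: filterS => y fy /AB /fy.
Qed.

Lemma locally_constantD A f g : locally_constant A f -> locally_constant A g ->
  locally_constant A (fun x => f x + g x).
Proof.
by move=> Af Ag x Ax; near=> y => Ay; congr (_ + _); move: Ay; near: y;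
  [exact: Af|exact: Ag].
Unshelve. all: by end_near. Qed.

Lemma locally_constantN A f : locally_constant A f ->
  locally_constant A (fun x => - f x).
Proof.
by move=> Af x Ax; have := Af x Ax; apply: filterS => y fy /fy ->.
Qed.

Lemma locally_constant_cst A (m : M) : locally_constant A (fun=> m).
Proof. by move=> x _; exact: nearW. Qed.

Lemma eq_locally_constant A f g : {in A, f =1 g} ->
  locally_constant A f -> locally_constant A g.
Proof.
move=> fg Af x Ax; have := Af x Ax; apply: filterS => y fy Ay.
by rewrite -!fg ?inE// fy.
Qed.

End LocallyConstantTheory.

(* A Cech 1-cocycle with coefficients in the locally constant [M]-valued
   functions, on an open cover indexed by its own members. The values of
   [cocycle_fun U V] outside [U `&` V] are irrelevant. *)
Record cech_cocycle (T : topologicalType) (M : zmodType) := CechCocycle {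
  cocycle_cover : set (set T);
  cocycle_fun : set T -> set T -> T -> M;
  cocycle_open_cover : open_cover cocycle_cover;
  cocycle_locally_constant : forall U V, cocycle_cover U -> cocycle_cover V ->
    locally_constant (U `&` V) (cocycle_fun U V);
  cocycle_cond : forall U V W, cocycle_cover U -> cocycle_cover V ->
    cocycle_cover W -> forall x, U x -> V x -> W x ->
    cocycle_fun U V x + cocycle_fun V W x = cocycle_fun U W x
}.

HB.instance Definition _ (T : topologicalType) (M : zmodType) :=
  gen_eqMixin (cech_cocycle T M).
HB.instance Definition _ (T : topologicalType) (M : zmodType) :=
  gen_choiceMixin (cech_cocycle T M).

(* Equality in the direct limit over open covers: on some common refinement
   [W], with refinement maps [r] and [s], the difference of the two cocycles
   is a coboundary. *)
Definition cohomologous {T : topologicalType} {M : zmodType}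
    (c d : cech_cocycle T M) : Prop :=
  exists (W : set (set T)) (r s : set T -> set T) (b : set T -> T -> M),
  [/\ open_cover W,
      forall U, W U -> cocycle_cover c (r U) /\ U `<=` r U,
      forall U, W U -> cocycle_cover d (s U) /\ U `<=` s U,
      forall U, W U -> locally_constant U (b U) &
      forall U V, W U -> W V -> forall x, U x -> V x ->
        cocycle_fun d (s U) (s V) x - cocycle_fun c (r U) (r V) x =
        b V x - b U x].

Section CechH1.
Context (T : topologicalType) (M : zmodType).
Implicit Types c d e : cech_cocycle T M.

Lemma cohomologous_refl c : cohomologous c c.
Proof.
exists (cocycle_cover c), id, id, (fun _ _ => 0); split => //.
- exact: cocycle_open_cover.
- by move=> U cU; split.
- by move=> U cU; split.
- by move=> U _; exact: locally_constant_cst.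
- by move=> U V _ _ x _ _; rewrite !subrr.
Qed.

Lemma cohomologous_sym c d : cohomologous c d -> cohomologous d c.
Proof.
move=> [W [r [s [b [Wc Wr Ws Wb WE]]]]].
exists W, s, r, (fun U x => - b U x); split => //.
  by move=> U WU; apply: locally_constantN; exact: Wb.
by move=> U V WU WV x Ux Vx; rewrite -opprB WE// opprB opprK addrC.
Qed.

Lemma cohomologous_trans c d e :
  cohomologous c d -> cohomologous d e -> cohomologous c e.
Proof.
move=> [W [r [s [b [[Wo Wc] Wr Ws Wb WE]]]]].
move=> [V [r' [s' [b' [[Vo Vc] Vr Vs Vb VE]]]]].
pose Z := [set U | exists w v, [/\ W w, V v & U = w `&` v]].
have /choice[w /choice[v wvP]] : forall U, exists w, exists v,
    Z U -> [/\ W w, V v & U = w `&` v].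
  move=> U; have [[w [v H]]|nZ] := pselect (Z U); first by exists w, v.
  by exists setT, setT.
exists Z, (fun U => r (w U)), (fun U => s' (v U)),
  (fun U x => b (w U) x + cocycle_fun d (s (w U)) (r' (v U)) x + b' (v U) x).
split.
- split=> [_ [w' [v' [Ww Vv ->]]]|]; first by apply: openI; [exact: Wo|exact: Vo].
  apply/seteqP; split => // x _.
  have : setT x by []. rewrite -{1}Wc => -[w' Ww' w'x].
  have : setT x by []. rewrite -{1}Vc => -[v' Vv' v'x].
  by exists (w' `&` v') => //; exists w', v'.
- move=> U ZU; have [Ww Vv UE] := wvP U ZU; split; first by have [] := Wr _ Ww.
  by rewrite {1}UE => x [wx vx]; have [_] := Wr _ Ww; exact.
- move=> U ZU; have [Ww Vv UE] := wvP U ZU; split; first by have [] := Vs _ Vv.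
  by rewrite {1}UE => x [wx vx]; have [_] := Vs _ Vv; exact.
- move=> U ZU; have [Ww Vv UE] := wvP U ZU.
  have Uw : U `<=` w U by rewrite {1}UE => x [].
  have Uv : U `<=` v U by rewrite {1}UE => x [].
  apply: locally_constantD; last exact: locally_constantS Uv (Vb _ Vv).
  apply: locally_constantD; first exact: locally_constantS Uw (Wb _ Ww).
  have [d1 s1] := Ws _ Ww; have [d2 s2] := Vr _ Vv.
  apply: locally_constantS (cocycle_locally_constant d1 d2).
  by move=> x Ux; split; [exact/s1/Uw|exact/s2/Uv].
- move=> U U' ZU ZU' x Ux U'x.
  have [Ww Vv UE] := wvP U ZU; have [Ww' Vv' UE'] := wvP U' ZU'.
  have [wx vx] : w U x /\ v U x by move: (Ux); rewrite {1}UE => -[].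
  have [wx' vx'] : w U' x /\ v U' x by move: (U'x); rewrite {1}UE' => -[].
  have EW := WE _ _ Ww Ww' x wx wx'; have EV := VE _ _ Vv Vv' x vx vx'.
  have [d1 s1] := Ws _ Ww; have [d1' s1'] := Ws _ Ww'.
  have [d2 s2] := Vr _ Vv; have [d2' s2'] := Vr _ Vv'.
  have E1 := cocycle_cond d1 d2 d2' (s1 _ wx) (s2 _ vx) (s2' _ vx').
  have E2 := cocycle_cond d1 d1' d2' (s1 _ wx) (s1' _ wx') (s2' _ vx').
  have {EV}-> : cocycle_fun e (s' (v U)) (s' (v U')) x =
      b' (v U') x - b' (v U) x + cocycle_fun d (r' (v U)) (r' (v U')) x.
    by rewrite -EV subrK.
  have {EW}-> : cocycle_fun c (r (w U)) (r (w U')) x =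
      cocycle_fun d (s (w U)) (s (w U')) x - (b (w U') x - b (w U) x).
    by rewrite -EW opprB addrC subrK.
  have {E1 E2}-> : cocycle_fun d (r' (v U)) (r' (v U')) x =
      cocycle_fun d (s (w U)) (s (w U')) x
      + cocycle_fun d (s (w U')) (r' (v U')) x
      - cocycle_fun d (s (w U)) (r' (v U)) x.
    by rewrite E2 -E1 addrC addKr.
  set a1 := b' _ _; set a2 := b' _ _; set a3 := cocycle_fun _ _ _ _.
  set a4 := cocycle_fun _ _ _ _; set a5 := cocycle_fun _ _ _ _.
  set a6 := b _ _; set a7 := b _ _.
  rewrite -(addrA a3) opprB -addrA.
  have -> : a3 + (a4 - a5) + (a6 - a7 - a3) = a4 - a5 + (a6 - a7).
    by rewrite addrC addrA subrK addrC.
  by rewrite !opprD !addrA [LHS](ACl (5*3*1*6*4*2)).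
Qed.

Definition cohomologousb c d : bool := `[< cohomologous c d >].

Lemma cohomologousb_refl : reflexive cohomologousb.
Proof. by move=> c; apply/asboolP; exact: cohomologous_refl. Qed.

Lemma cohomologousb_sym : symmetric cohomologousb.
Proof.
by move=> c d; apply/asboolP/asboolP; exact: cohomologous_sym.
Qed.

Lemma cohomologousb_trans : transitive cohomologousb.
Proof.
move=> d c e /asboolP cd /asboolP de; apply/asboolP.
exact: cohomologous_trans cd de.
Qed.

Canonical cohomologous_equiv := EquivRel cohomologousb
  cohomologousb_refl cohomologousb_sym cohomologousb_trans.

Definition cech_H1 : Type := {eq_quot cohomologous_equiv}.
HB.instance Definition _ := Choice.on cech_H1.
HB.instance Definition _ := Quotient.on cech_H1.
HB.instance Definition _ : EqQuotient _ cohomologous_equiv cech_H1 :=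
  EqQuotient.on cech_H1.

Lemma setT_open_cover : open_cover [set [set: T]].
Proof.
split=> [_ ->|]; first exact: openT.
by rewrite bigcup_set1.
Qed.

Definition cocycle0 : cech_cocycle T M :=
  @CechCocycle T M [set setT] (fun _ _ _ => 0) setT_open_cover
    (fun _ _ _ _ => @locally_constant_cst T M _ 0)
    (fun _ _ _ _ _ _ _ _ _ _ => addr0 0).

Definition cech_zero : cech_H1 := \pi_cech_H1 cocycle0.

End CechH1.
Arguments cech_zero {T M}.

Section Restriction.
Context {T : topologicalType} {M : zmodType} (A : set T).
Variable c : cech_cocycle T M.

Definition restr_cover : set (set A) :=
  [set (@set_val T A @^-1` U : set A) | U in cocycle_cover c].

(* A member of the cover of [T] whose trace on [A] is [U']. *)
Definition restr_index (U' : set A) : set T :=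
  xget set0 [set U | cocycle_cover c U /\ @set_val T A @^-1` U = U'].

Definition restr_fun (U' V' : set A) (x : A) : M :=
  cocycle_fun c (restr_index U') (restr_index V') (set_val x).

Lemma restr_indexP U' : restr_cover U' ->
  cocycle_cover c (restr_index U') /\ @set_val T A @^-1` restr_index U' = U'.
Proof. by move=> [U cU UE]; rewrite /restr_index; case: xgetP => [V -> //|/(_ U)]; case. Qed.

Lemma restr_open_cover : open_cover restr_cover.
Proof.
have [co cc] := cocycle_open_cover c; split=> [_ [U cU <-]|].
  by exists U => //; exact: co.
apply/seteqP; split => // x _.
have : setT (set_val x) by []. rewrite -{1}cc => -[U cU Ux].
by exists (@set_val T A @^-1` U) => //; exists U.
Qed.

Lemma restr_locally_constant U' V' : restr_cover U' -> restr_cover V' ->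
  locally_constant (U' `&` V') (restr_fun U' V').
Proof.
move=> /restr_indexP[cU UE] /restr_indexP[cV VE] x [Ux Vx].
have xU : restr_index U' (set_val x) by move: Ux; rewrite -{1}UE.
have xV : restr_index V' (set_val x) by move: Vx; rewrite -{1}VE.
have near_x := cocycle_locally_constant cU cV (conj xU xV).
have := @initial_continuous A T set_val x _ near_x.
rewrite /nbhs/= => -[B [oB Bx Bsub]]; exists B; split => //.
move=> y /Bsub /= fy [Uy Vy]; apply: fy; split.
- by move: Uy; rewrite -{1}UE.
- by move: Vy; rewrite -{1}VE.
Qed.

Lemma restr_cocycle_cond U V W : restr_cover U -> restr_cover V ->
  restr_cover W -> forall x, U x -> V x -> W x ->
  restr_fun U V x + restr_fun V W x = restr_fun U W x.
Proof.
move=> /restr_indexP[cU UE] /restr_indexP[cV VE] /restr_indexP[cW WE].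
move=> x Ux Vx Wx; apply: cocycle_cond => //.
- by move: Ux; rewrite -{1}UE.
- by move: Vx; rewrite -{1}VE.
- by move: Wx; rewrite -{1}WE.
Qed.

Definition restr_cocycle : cech_cocycle A M :=
  CechCocycle restr_open_cover restr_locally_constant restr_cocycle_cond.

End Restriction.

(* [xi|_A], in the Cech cohomology of [A] with the induced topology. *)
Definition cech_restrict {T : topologicalType} {M : zmodType} (A : set T)
    (xi : cech_H1 T M) : cech_H1 A M :=
  \pi_(cech_H1 A M) (restr_cocycle A (repr xi)).

(* Families of local primitives; two families define the same one-form when
   their differences are locally constant on overlaps. That identification is
   left implicit: everything below depends only on the one-form. *)
Record closed_one_form (R : realType) (T : topologicalType) := ClosedOneForm {
  form_cover : set (set T);
  form_fun : set T -> T -> R;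
  form_open_cover : open_cover form_cover;
  form_continuous : forall U, form_cover U ->
    {within U, continuous (form_fun U)};
  form_compat : forall U V, form_cover U -> form_cover V ->
    locally_constant (U `&` V) (fun x => form_fun U x - form_fun V x)
}.

Section FormClass.
Context {R : realType} {T : topologicalType} (w : closed_one_form R T).

Definition connecting_fun (U V : set T) (x : T) : R :=
  form_fun w V x - form_fun w U x.

Lemma connecting_locally_constant U V : form_cover w U -> form_cover w V ->
  locally_constant (U `&` V) (connecting_fun U V).
Proof. by move=> wU wV; rewrite setIC; exact: form_compat. Qed.

Lemma connecting_cond U V W : form_cover w U -> form_cover w V ->
  form_cover w W -> forall x, U x -> V x -> W x ->
  connecting_fun U V x + connecting_fun V W x = connecting_fun U W x.
Proof. by move=> *; rewrite /connecting_fun addrC addrA subrK. Qed.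

(* The image [[w]] of [w] under the connecting homomorphism of
   0 -> R_T -> C_T -> B_T -> 0: the Cech coboundary of the local primitives. *)
Definition form_class : cech_H1 T R :=
  \pi_(cech_H1 T R) (CechCocycle (form_open_cover w)
    connecting_locally_constant connecting_cond).

End FormClass.

Definition unit_interval (R : realType) : set R := `[0, 1]%classic.
Arguments unit_interval R : clear implicits.

Lemma unit_interval0 (R : realType) : (0 : R) \in unit_interval R.
Proof. by rewrite inE /unit_interval/= in_itv/= lexx ler01. Qed.

Lemma unit_interval1 (R : realType) : (1 : R) \in unit_interval R.
Proof. by rewrite inE /unit_interval/= in_itv/= lexx ler01. Qed.

Definition I0 {R : realType} : unit_interval R :=
  exist _ (0 : R) (unit_interval0 R).
Definition I1 {R : realType} : unit_interval R :=
  exist _ (1 : R) (unit_interval1 R).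

(* Paths in [X]; these are also the singular 1-simplices of [X]. *)
Notation cpath R X := (continuousType (unit_interval R) X).

(* [v] is the sum defining the integral of [w] along [gamma], for some
   subdivision 0 = t 0 < ... < t N = 1 adapted to the cover of [w]. *)
Definition is_path_integral {R : realType} {X : topologicalType}
    (w : closed_one_form R X) (gamma : cpath R X) (v : R) : Prop :=
  exists (N : nat) (t : nat -> unit_interval R) (U : nat -> set X),
  [/\ t 0%N = I0, t N = I1,
      forall i, (i < N)%N -> set_val (t i) < set_val (t i.+1),
      forall i, (i < N)%N -> form_cover w (U i) /\
        forall s : unit_interval R,
          set_val (t i) <= set_val s <= set_val (t i.+1) -> U i (gamma s) &
      v = \sum_(i < N) (form_fun w (U i) (gamma (t i.+1))
                        - form_fun w (U i) (gamma (t i)))].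

Definition path_integral {R : realType} {X : topologicalType}
    (w : closed_one_form R X) (gamma : cpath R X) : R :=
  xget 0 [set v | is_path_integral w gamma v].

(* The 2-simplex with vertices (0, 0), (1, 0), (0, 1). *)
Definition triangle (R : realType) : set (R * R) :=
  [set p | [/\ 0 <= p.1, 0 <= p.2 & p.1 + p.2 <= 1]].
Arguments triangle R : clear implicits.

Lemma continuous_pair {S A B : topologicalType} (f : S -> A) (g : S -> B) :
  continuous f -> continuous g -> continuous (fun s => (f s, g s)).
Proof. by move=> cf cg s; apply: cvg_pair; [exact: cf|exact: cg]. Qed.

Section Faces.
Context {R : realType}.
Implicit Types s : unit_interval R.

Lemma unit_intervalP s : 0 <= set_val s <= 1.
Proof. by have := set_valP s; rewrite /unit_interval/= in_itv. Qed.

Lemma triangle_face0 s : (1 - set_val s, set_val s) \in triangle R.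
Proof.
have /andP[s0 s1] := unit_intervalP s.
by rewrite inE; split => //=; rewrite ?subr_ge0// subrK.
Qed.

Lemma triangle_face1 s : (0, set_val s) \in triangle R.
Proof.
have /andP[s0 s1] := unit_intervalP s.
by rewrite inE; split => //=; rewrite add0r.
Qed.

Lemma triangle_face2 s : (set_val s, 0) \in triangle R.
Proof.
have /andP[s0 s1] := unit_intervalP s.
by rewrite inE; split => //=; rewrite addr0.
Qed.

Definition face0_fun s : triangle R :=
  exist (fun p => p \in triangle R) _ (triangle_face0 s).
Definition face1_fun s : triangle R :=
  exist (fun p => p \in triangle R) _ (triangle_face1 s).
Definition face2_fun s : triangle R :=
  exist (fun p => p \in triangle R) _ (triangle_face2 s).

Lemma set_val_continuous : continuous (@set_val R (unit_interval R)).
Proof. exact: initial_continuous. Qed.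

Lemma face0_continuous : continuous face0_fun.
Proof.
apply: continuous_comp_initial; apply: continuous_pair.
  move=> s; apply: (@continuousB R R^o _ (cst 1) set_val s).
    exact: cst_continuous.
  exact: set_val_continuous.
exact: set_val_continuous.
Qed.

Lemma face1_continuous : continuous face1_fun.
Proof.
apply: continuous_comp_initial; apply: continuous_pair.
  exact: cst_continuous.
exact: set_val_continuous.
Qed.

Lemma face2_continuous : continuous face2_fun.
Proof.
apply: continuous_comp_initial; apply: continuous_pair.
  exact: set_val_continuous.
exact: cst_continuous.
Qed.

Definition face0 : continuousType (unit_interval R) (triangle R) :=
  mkcts face0_continuous.
Definition face1 : continuousType (unit_interval R) (triangle R) :=
  mkcts face1_continuous.
Definition face2 : continuousType (unit_interval R) (triangle R) :=
  mkcts face2_continuous.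

End Faces.

Section SingularH1.
Context (R : realType) (X : topologicalType).

Definition chain1 : Type := {freeg (cpath R X) / int}.
HB.instance Definition _ := GRing.Zmodule.on chain1.
Definition chain2 : Type := {freeg (continuousType (triangle R) X) / int}.
HB.instance Definition _ := GRing.Zmodule.on chain2.

Definition boundary1 (c : chain1) : {freeg X / int} :=
  fglift (fun gamma : cpath R X => << gamma I1 >> - << gamma I0 >>) c.

Definition boundary2 (c : chain2) : chain1 :=
  fglift (fun sigma : continuousType (triangle R) X =>
    << (sigma \o face0 : cpath R X) >> - << (sigma \o face1 : cpath R X) >>
    + << (sigma \o face2 : cpath R X) >>) c.

Definition cycle1 : Type := {c : chain1 | boundary1 c == 0}.
HB.instance Definition _ := Choice.on cycle1.

Definition homologous (c d : cycle1) : bool :=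
  `[< exists b : chain2, boundary2 b = sval d - sval c >].

Lemma boundary2B b1 b2 : boundary2 (b1 - b2) = boundary2 b1 - boundary2 b2.
Proof. exact: lift_is_additive. Qed.

Lemma boundary20 : boundary2 0 = 0.
Proof. by rewrite -(subrr 0) boundary2B subrr. Qed.

Lemma homologous_refl : reflexive homologous.
Proof. by move=> c; apply/asboolP; exists 0; rewrite subrr boundary20. Qed.

Lemma homologous_symW c d : homologous c d -> homologous d c.
Proof.
move=> /asboolP[b bE]; apply/asboolP; exists (0 - b).
by rewrite boundary2B boundary20 bE sub0r opprB.
Qed.

Lemma homologous_sym : symmetric homologous.
Proof. by move=> c d; apply/idP/idP; exact: homologous_symW. Qed.

Lemma homologous_trans : transitive homologous.
Proof.
move=> d c e /homologous_symW/asboolP[b bE] /asboolP[b' bE'].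
by apply/asboolP; exists (b' - b); rewrite boundary2B bE bE' opprB addrA subrK.
Qed.

Canonical homologous_equiv :=
  EquivRel homologous homologous_refl homologous_sym homologous_trans.

Definition singular_H1 : Type := {eq_quot homologous_equiv}.
HB.instance Definition _ := Choice.on singular_H1.
HB.instance Definition _ := Quotient.on singular_H1.
HB.instance Definition _ : EqQuotient _ homologous_equiv singular_H1 :=
  EqQuotient.on singular_H1.

Definition chain_integral (w : closed_one_form R X) (c : chain1) : R :=
  \sum_(gamma <- dom c) path_integral w gamma *~ coeff gamma c.

(* <xi, z>: the integral of any form in the class [xi] along any cycle
   representing [z]. *)
Definition pairing (xi : cech_H1 X R) (z : singular_H1) : R :=
  xget 0 [set v | exists (w : closed_one_form R X) (c : cycle1),
    [/\ form_class w = xi, \pi_singular_H1 c = z &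
        v = chain_integral w (sval c)]].

End SingularH1.

Record flow (R : realType) (X : topologicalType) := Flow {
  flow_fun :> X * R -> X;
  flow_continuous : continuous flow_fun;
  flow0 : forall x, flow_fun (x, 0) = x;
  flowD : forall x s t, flow_fun (flow_fun (x, s), t) = flow_fun (x, s + t)
}.

Definition locally_path_connected (R : realType) (X : topologicalType) : Prop :=
  forall (x : X) (U : set X), nbhs x U ->
  exists V : set X, [/\ open V, V x, V `<=` U &
    forall y z, V y -> V z -> exists gamma : cpath R X,
      [/\ gamma I0 = y, gamma I1 = z & range gamma `<=` V]].

Section Trajectory.
Context {R : realType} {X : topologicalType} (Phi : flow R X) (x : X) (t : R).

Definition trajectory_fun (s : unit_interval R) : X := Phi (x, t * set_val s).

Lemma trajectory_continuous : continuous trajectory_fun.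
Proof.
move=> s; apply: (@continuous_comp _ _ _
  (fun s : unit_interval R => (x, t * set_val s)) Phi); last first.
  exact: flow_continuous.
apply: continuous_pair => {}s; first exact: cst_continuous.
apply: (@continuousM R _ (cst t) set_val s); first exact: cst_continuous.
exact: set_val_continuous.
Qed.

Definition trajectory : cpath R X := mkcts trajectory_continuous.

End Trajectory.

Section Lyapunov.
Context {R : realType} {X : topologicalType}.

(* The trajectory of [x] over [[0, t]] is integrated after rescaling to
   [[0, 1]]. In the second clause, the restriction of [w] to [U] is [df]. *)
Definition lyapunov_form (Phi : flow R X) (Y : set X)
    (w : closed_one_form R X) : Prop :=
  (forall x t, ~ Y x -> 0 < t -> path_integral w (trajectory Phi x t) < 0) /\
  (exists (U : set X) (f : X -> R),
    [/\ open U, Y `<=` U, {within U, continuous f},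
        forall V, form_cover w V ->
          locally_constant (V `&` U) (fun x => form_fun w V x - f x) &
        forall x y, Y x -> connected_component Y x y -> f x = f y]).

End Lyapunov.

Section Chains.
Context {R : realType} {X : metricType R} (Phi : flow R X).

(* A (delta, T)-chain x 0, ..., x N, where [t i] is the time spent between
   [x i] and [x i.+1]; the values [x i], i > N, and [t i], i >= N, are
   irrelevant. Chains have at least one step, so that being chain recurrent is
   a genuine condition. *)
Definition is_chain (delta T : R) (N : nat) (x : nat -> X) (t : nat -> R) :=
  (0 < N)%N /\ forall i, (i < N)%N ->
    T <= t i /\ mdist (Phi (x i, t i)) (x i.+1) < delta.

Definition chain_recurrent : set X :=
  [set p | forall delta T, 0 < delta -> 1 <= T ->
    exists N x t, [/\ is_chain delta T N x t, x 0%N = p & x N = p]].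

Definition is_cycle (delta T : R) (x : X) (t : R) : Prop :=
  T <= t /\ mdist x (Phi (x, t)) < delta.

Definition is_scale (xi : cech_H1 X R) (eps delta0 : R) : Prop :=
  [/\ 0 < eps, 0 < delta0,
      forall p : X, cech_restrict (ball p (2 * eps)) xi = cech_zero &
      forall x y : X, mdist x y < delta0 -> exists gamma : cpath R X,
        [/\ gamma I0 = x, gamma I1 = y &
            exists p : X, range gamma `<=` ball p eps]].

(* The class [z] is represented by the singular cycle made of the trajectory
   pieces and of short paths [sigma i] closing the gaps; the concatenation is
   taken as a sum of singular 1-simplices. *)
Definition associated (eps : R) (N : nat) (x : nat -> X) (t : nat -> R)
    (z : singular_H1 R X) : Prop :=
  exists sigma : nat -> cpath R X,
  (forall i, (i < N)%N ->
    [/\ sigma i I0 = Phi (x i, t i), sigma i I1 = x i.+1 &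
        exists p : X, range (sigma i) `<=` ball p eps]) /\
  exists c : cycle1 R X, \pi_(singular_H1 R X) c = z /\
    sval c = \sum_(i < N) (<< trajectory Phi (x i) (t i) >> + << sigma i >>).

Definition cycle_associated (eps : R) (x : X) (t : R) :=
  associated eps 1 (fun=> x) (fun=> t).

Definition R_xi (xi : cech_H1 X R) (eps delta0 : R) : set X :=
  [set p | forall delta T, 0 < delta < delta0 -> 1 < T ->
    exists N x t, [/\ is_chain delta T N x t, x 0%N = p, x N = p &
      forall z, associated eps N x t z -> pairing xi z = 0]].

Definition C_xi (xi : cech_H1 X R) (eps delta0 : R) : set X :=
  chain_recurrent `\` R_xi xi eps delta0.

End Chains.

(* Main.v *)
From HB Require Import structures.
Require Import Defs.
From mathcomp Require Import all_boot all_order all_algebra.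
From mathcomp Require Import generic_quotient freeg.
From mathcomp Require Import all_classical all_reals topology normedtype.
From mathcomp Require Import derive realfun measure lebesgue_measure.
From mathcomp Require Import lebesgue_integral ftc.
From mathcomp Require Import ring lra.

(** The integral of a closed one-form along a map into [X] is computed by
    primitives along that map. Primitives lift along homotopies, which makes the
    integral over a trajectory a continuous additive cocycle [tau x t] and makes
    the integral over a cycle depend only on its homology class.

    Sufficiency. Sampling a trajectory of [C_xi] at multiples of [T] and applying
    (B) to the almost-returns given by the pigeonhole principle shows that
    [tau x T <= -1] on [C_xi] for a large [T]; since [tau] is bounded along
    trajectories of [R_xi] by (A), [C_xi] is closed. By (A) and local path
    connectedness, [xi] has a representative [w1] that vanishes near [R_xi].
    Let [L] be a Conley function of the flow, that is, strictly decreasing off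
    [R] and constant on connected subsets of [R]. Then for large [k] the form
    [w1 + k dL] has negative integral over the trajectory piece of duration [T] of
    every point off [R_xi], and averaging over time [T] makes it decrease for
    every positive time. Conversely, (L2) gives (A), and a Lyapunov form decreases
    uniformly on [C_xi] once this set is compact, which gives (B).

    The Conley function is a countable sum of functions [x |-> S a x], where
    [S a x] is the least size of the largest gap of a chain from [a] to [x].
    Since gaps are not added up but maximized, [S x y = 0] whenever [x] and [y]
    lie in a connected subset of [R]. *)

Set Implicit Arguments.
Unset Strict Implicit.
Unset Printing Implicit Defensive.

Import Order.TTheory GRing.Theory Num.Theory numFieldNormedType.Exports.

Local Open Scope classical_set_scope.
Local Open Scope ring_scope.
Local Open Scope quotient_scope.

(** * Primitives of a closed one-form along a map *)

(** Condition (B) and the definition of [R_xi] speak of homology classes, which are awkward when a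
    chain is cut or moved. Each gap therefore gets a number, the integral [jump] of the form across
    it. A chain then has a real value, [R_xi] consists of the points with closed chains of value 0
    for all gap bounds and step lengths, and its closedness and invariance follow by perturbing the
    ends of chains.

    The decrease of a Conley function degenerates towards [R_xi], so a fixed multiple of it might
    not outweigh even a small positive integral there. This is why the representative has to vanish
    near [R_xi] and not only on it: next to [R_xi] its integral over time [T] is 0, every positive
    [k] works, and compactness bounds [k] elsewhere. It is also why a primitive near [R_xi] is
    available for (L2).

    The time [T] comes from the decay on [C_xi]. The Conley function must decrease over steps of
    exactly this length, whereas the closed chain that fails to exist at a point off [R] may be one
    with much longer steps. *)

Section Primitive.
Context {R : realType} {X : topologicalType} (w : closed_one_form R X).

(** Near [s], [dg] is the pullback of [w] by [p]. Allowing any source space [S] treats paths,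
    trajectories and homotopies alike. *)
Definition primitive_at {S : topologicalType} (p : S -> X) (g : S -> R) (s : S) :=
  forall U, form_cover w U -> U (p s) ->
  \forall s' \near s, g s' - form_fun w U (p s') = g s - form_fun w U (p s).

Lemma form_cover_mem (x : X) : exists2 U, form_cover w U & U x.
Proof.
have [_ cw] := form_open_cover w; have : setT x by [].
by rewrite -cw => -[U wU Ux]; exists U.
Qed.

Lemma form_cover_nbhs U x : form_cover w U -> U x -> nbhs x U.
Proof.
by move=> wU Ux; apply: open_nbhs_nbhs; split => //; exact: (form_open_cover w).1.
Qed.

Lemma form_fun_cvg U x : form_cover w U -> U x ->
  form_fun w U y @[y --> x] --> form_fun w U x.
Proof.
move=> wU Ux; have oU := (form_open_cover w).1 _ wU.
have := form_continuous wU; rewrite continuous_open_subspace//.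
by apply; rewrite inE.
Qed.

Lemma form_compat_near U V x : form_cover w U -> form_cover w V -> U x -> V x ->
  \forall y \near x, form_fun w U y - form_fun w V y =
    form_fun w U x - form_fun w V x.
Proof.
move=> wU wV Ux Vx; have H := form_compat wU wV (conj Ux Vx).
near=> y; have : (U `&` V) y -> form_fun w U y - form_fun w V y =
    form_fun w U x - form_fun w V x by near: y.
apply; split; near: y; exact: form_cover_nbhs.
Unshelve. all: by end_near. Qed.

Lemma primitive_atP {S : topologicalType} (p : S -> X) g s U :
  {for s, continuous p} -> form_cover w U -> U (p s) ->
  (\forall s' \near s, g s' - form_fun w U (p s') = g s - form_fun w U (p s)) ->
  primitive_at p g s.
Proof.
move=> cp wU Us gU V wV Vs.
have H := cp _ (form_compat_near wU wV Us Vs).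
near=> s'.
have E1 : g s' - form_fun w U (p s') = g s - form_fun w U (p s) by near: s'.
have E2 : form_fun w U (p s') - form_fun w V (p s') =
    form_fun w U (p s) - form_fun w V (p s) by near: s'.
lra.
Unshelve. all: by end_near. Qed.

Lemma primitive_at_continuous {S : topologicalType} (p : S -> X) g s :
  {for s, continuous p} -> primitive_at p g s -> {for s, continuous g}.
Proof.
move=> cp pg; have [U wU Us] := form_cover_mem (p s).
have H := pg _ wU Us; rewrite /prop_for /continuous_at.
have c1 : form_fun w U (p s') @[s' --> s] --> form_fun w U (p s).
  by apply: (@cvg_comp _ _ _ p (form_fun w U)); [exact: cp|exact: form_fun_cvg].
rewrite -[X in _ --> X](subrK (form_fun w U (p s))).
apply: (@cvg_trans _ ((g s - form_fun w U (p s) + form_fun w U (p s')) @[s' --> s])).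
  apply: near_eq_cvg; near=> s'.
  have : g s' - form_fun w U (p s') = g s - form_fun w U (p s) by near: s'.
  by move=> <-; rewrite subrK.
by apply: cvgD => //; exact: cvg_cst.
Unshelve. all: by end_near. Qed.

Lemma primitive_at_comp {S S' : topologicalType} (p : S -> X) g (h : S' -> S) s' :
  {for s', continuous h} -> primitive_at p g (h s') ->
  primitive_at (p \o h) (g \o h) s'.
Proof. by move=> ch pg U wU Us; exact: ch _ (pg _ wU Us). Qed.

Lemma near_eq_primitive_at {S : topologicalType} (p : S -> X) g g' s :
  (\forall s' \near s, g s' = g' s') -> primitive_at p g s -> primitive_at p g' s.
Proof.
move=> gg' pg U wU Us; have gs := nbhs_singleton gg'.
near=> s'; rewrite -gs -(near gg' s')//; near: s'; exact: pg.
Unshelve. all: by end_near. Qed.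

Lemma near_eq_primitive_at_map {S : topologicalType} (p p' : S -> X) g s :
  (\forall s' \near s, p s' = p' s') -> primitive_at p g s -> primitive_at p' g s.
Proof.
move=> pp' pg U wU; have ps := nbhs_singleton pp'.
rewrite -ps => Us.
near=> s'; rewrite -(near pp' s')//; near: s'; exact: pg.
Unshelve. all: by end_near. Qed.

Lemma primitive_at_addr {S : topologicalType} (p : S -> X) g (c : R) s :
  primitive_at p g s -> primitive_at p (fun s => g s + c) s.
Proof.
move=> pg U wU Us; have := pg U wU Us; apply: filterS => s' E; lra.
Qed.

(** The level set of [f x] in [A] is open and closed in [A]. The codomain is any type because values
    in [Prop] occur too: a property is then propagated along a connected set. *)
Lemma connected_locally_constant {S : topologicalType} {M : Type} (A : set S)
    (f : S -> M) : connected A -> locally_constant A f ->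
  forall x y, A x -> A y -> f x = f y.
Proof.
move=> cA fA x y Ax Ay.
have op (P : M -> Prop) : exists2 C, open C & A `&` [set z | P (f z)] = A `&` C.
  exists ([set z | A z -> P (f z)]°); first exact: open_interior.
  apply/seteqP; split => z [Az /= Pz]; split => //.
    by rewrite /interior /=; have := fA z Az; apply: filterS => t E /E ->.
  exact: (interior_subset Pz).
have clo : exists2 C, closed C & A `&` [set z | f z = f x] = A `&` C.
  have [C oC E] := op (fun m => m <> f x).
  exists (~` C); first exact: open_closedC.
  apply/seteqP; split => z [Az /= Pz]; split => //.
    by move=> Cz; have : (A `&` C) z by []; rewrite -E => -[_]; apply.
  apply: contrapT => ne; have : (A `&` [set z | f z <> f x]) z by [].
  by rewrite E => -[].
have := cA (A `&` [set z | f z = f x]) _ (op (fun m => m = f x)) clo.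
move=> E; have : (A `&` [set z | f z = f x]) y.
  by rewrite E //; exists x.
by case.
Qed.

Lemma primitive_at_unique {S : topologicalType} (A : set S) (p : S -> X) g g' :
  connected A -> (forall s, A s -> primitive_at p g s) ->
  (forall s, A s -> primitive_at p g' s) ->
  forall s s', A s -> A s' -> g s - g' s = g s' - g' s'.
Proof.
move=> cA pg pg' s s' As As'.
apply: (connected_locally_constant (f := fun s => g s - g' s) cA _ As As').
move=> {As As'}{}s As; have [U wU Us] := form_cover_mem (p s).
have h1 := pg _ As _ wU Us; have h2 := pg' _ As _ wU Us.
near=> t => _.
have : g t - form_fun w U (p t) = g s - form_fun w U (p s) by near: t.
have : g' t - form_fun w U (p t) = g' s - form_fun w U (p s) by near: t.
lra.
Unshelve. all: by end_near. Qed.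

End Primitive.

(** Induction along a segment, in place of a subdivision adapted to local data. The supremum of the
    points reachable from [a] is itself reachable and can be passed unless it is [b]. *)
Lemma segment_ind {R : realType} (P : R -> R -> Prop) :
  (forall a b c, a <= b -> b <= c -> P a b -> P b c -> P a c) ->
  (forall x, exists2 e, 0 < e & forall a b, x - e < a -> a <= x -> x <= b ->
    b < x + e -> P a b) ->
  forall a b, a <= b -> P a b.
Proof.
move=> trP locP a b ab.
have Pxx x : P x x.
  have [e e0 H] := locP x; apply: H => //; lra.
pose S := [set t | a <= t <= b /\ P a t].
have Sa : S a by split; [rewrite lexx|].
have ubS : ubound S b by move=> t [/andP[]].
have hs : has_sup S by split; [exists a|exists b].
set s := sup S.
have as_ : a <= s by apply: ub_le_sup => //; exists b.
have sb : s <= b by apply: ge_sup => //; exists a.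
have [e e0 He] := locP s.
have [t [/andP[at_ tb] Pat] st] : exists2 t, S t & s - e < t.
  by have [t St st] := sup_adherent e0 hs; exists t.
have ts : t <= s by apply: ub_le_sup => //; [exists b|split => //; apply/andP].
have Pas : P a s by apply: (trP a t s) => //; apply: He => //; lra.
have [bs|sb'] := leP b s; first by have -> : b = s by lra.
pose u := Num.min b (s + e / 2).
have su : s < u by rewrite lt_min sb' /=; lra.
have ub : u <= b by rewrite ge_min lexx.
have ue : u < s + e by rewrite gt_min; apply/orP; right; lra.
suff : u <= s by rewrite leNgt su.
apply: ub_le_sup; first by exists b.
split; first by apply/andP; split => //; lra.
by apply: (trP a s u) => //; [exact: ltW|apply: He => //; lra].
Qed.

Section PrimitiveLine.
Context {R : realType} {X : topologicalType} (w : closed_one_form R X).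

Lemma exists_primitive_segment (p : R -> X) (a b : R) : continuous p -> a <= b ->
  exists g : R -> R, forall s, a <= s <= b -> primitive_at w p g s.
Proof.
move=> cp; move: a b; apply: segment_ind.
- move=> a b c ab bc [g1 G1] [g2 G2].
  exists (fun s => if s <= b then g1 s else g2 s + (g1 b - g2 b)).
  move=> s /andP[as_ sc]; have [sb|bs|sb] := ltgtP s b.
  + apply: near_eq_primitive_at (G1 s _); last by apply/andP; split => //; lra.
    near=> t; rewrite ifT//; apply: ltW; near: t; exact: lt_nbhsl.
  + apply: near_eq_primitive_at (primitive_at_addr (g1 b - g2 b) (G2 s _)); last first.
      by apply/andP; split => //; lra.
    near=> t; rewrite ifF//; apply/negbTE; rewrite -ltNge; near: t; exact: lt_nbhsr.
  + subst s; have p1 : primitive_at w p g1 b by apply: G1; rewrite as_ lexx.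
    have p2 : primitive_at w p g2 b by apply: G2; rewrite bc lexx.
    apply: near_eq_primitive_at (p1).
    have [U wU Ub] := form_cover_mem w (p b).
    have q1 := p1 _ wU Ub; have q2 := p2 _ wU Ub.
    near=> t; case: ifP => // _.
    have : g1 t - form_fun w U (p t) = g1 b - form_fun w U (p b) by near: t.
    have : g2 t - form_fun w U (p t) = g2 b - form_fun w U (p b) by near: t.
    move: (form_fun _ _ _) (form_fun _ _ _) => u v; lra.
- move=> x; have [U wU Ux] := form_cover_mem w (p x).
  have /(@nbhs_ballP R R)[e /= e0 He] : \forall t \near x, U (p t).
    exact: (cp x _ (form_cover_nbhs wU Ux)).
  have {}He t : `|x - t| < e -> U (p t) := He t.
  exists e => //.
  move=> a b xa ax xb bx; exists (form_fun w U \o p) => s /andP[as_ sb].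
  apply: (primitive_atP (U := U)) => //; first exact: cp.
    by apply: He; rewrite ltr_norml; apply/andP; split; lra.
  by near=> t; rewrite /= !subrr.
Unshelve. all: by end_near. Qed.

Lemma exists_primitive (p : R -> X) : continuous p ->
  exists2 g : R -> R, g 0 = 0 & forall s, primitive_at w p g s.
Proof.
move=> cp.
have /choice[G HG] : forall n : nat, exists g : R -> R, g 0 = 0 /\
    forall s : R, - (n%:R : R) <= s <= n%:R -> primitive_at w p g s.
  move=> n; have n0 : - n%:R <= n%:R :> R by rewrite (@le_trans _ _ 0)// oppr_le0.
  have [g gP] := exists_primitive_segment cp n0.
  exists (fun s => g s + - g 0); split; first by rewrite subrr.
  by move=> s sn; apply: primitive_at_addr; exact: gP.
(* Primitives on the segments from [-N] to [N], all zero at 0, agree on common points; [n t] indexes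
   a segment that contains [t]. *)
pose n (t : R) := (Num.truncn `|t|).+1.
have nP (t : R) : - ((n t)%:R : R) <= t <= (n t)%:R.
  rewrite -ler_norml; apply: ltW; exact: truncnS_gt.
have GE t N : (n t <= N)%N -> G (n t) t = G N t.
  move=> nN; have nNR : (n t)%:R <= N%:R :> R by rewrite ler_nat.
  have [z1 p1] := HG (n t); have [z2 p2] := HG N.
  have := @primitive_at_unique _ _ w R `[- ((n t)%:R : R), (n t)%:R]%classic p (G (n t)) (G N)
    (@segment_connected R _ _) _ _ t 0.
  rewrite z1 z2 subrr => H; apply/eqP; rewrite -subr_eq0; apply/eqP; apply: H.
  - by move=> s /=; rewrite in_itv/=; exact: p1.
  - move=> s /=; rewrite in_itv/= => /andP[s1 s2]; apply: p2; apply/andP; split; lra.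
  - by rewrite /= in_itv/=.
  - by rewrite /= in_itv/= oppr_le0 ler0n.
exists (fun t => G (n t) t); first by rewrite (HG _).1.
(* Points within 1 of [s] may have an index one larger than [n s]. *)
move=> s; have [_ ps] := HG (n s).+1.
apply: near_eq_primitive_at (ps s _).
  apply: filterS (nbhsx_ballx s 1 ltr01) => t st; rewrite (GE t (n s).+1)//.
  rewrite /n ltnS truncn_le_nat -natr1.
  have := truncnS_gt `|s|; have := ler_distD s t 0.
  by move: st; rewrite /ball/= (distrC s t) !subr0; lra.
have E : (n s).+1%:R = (n s)%:R + 1 :> R by rewrite -natr1.
by rewrite E; have := nP s; move: (n s)%:R => N /andP[? ?]; apply/andP; split; lra.
Qed.

End PrimitiveLine.

Lemma continuous_pairr {S T : topologicalType} (t : T) :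
  continuous (fun s : S => (s, t)).
Proof. by apply: continuous_pair => s; [exact: cvg_id|exact: cvg_cst]. Qed.

Lemma continuous_pairl {S T : topologicalType} (t : T) :
  continuous (fun s : S => (t, s)).
Proof. by apply: continuous_pair => s; [exact: cvg_cst|exact: cvg_id]. Qed.

(** * Lifting primitives along homotopies *)

Section HomotopyLifting.
Context {R : realType} {X Y : topologicalType} (w : closed_one_form R X).
Variables (H : Y * R -> X) (h : Y -> R -> R) (g0 : Y -> R) (y0 : Y).
Hypothesis cH : continuous H.
Hypothesis hP : forall y t, primitive_at w (fun t => H (y, t)) (h y) t.
Hypothesis h0 : forall y, h y 0 = 0.
Hypothesis g0P : primitive_at w (fun y => H (y, 0)) g0 y0.

Let G (q : Y * R) : R := g0 q.1 + h q.1 q.2.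
Let slice t := primitive_at w (fun y => H (y, t)) (fun y => G (y, t)) y0.

(** A box around [(y0, t0)] is mapped into a single [U]. In it the primitives [h y] carry the
    constancy of [G - form_fun w U \o H] from the slice at [t1] to all other times; no connectedness
    of [Y] is involved. *)
Let slice_full t0 : exists2 e, 0 < e & forall t1 t2,
  `|t0 - t1| < e -> `|t0 - t2| < e -> slice t1 -> primitive_at w H G (y0, t2).
Proof.
have [U wU U0] := form_cover_mem w (H (y0, t0)).
have [[N J] /= [N0 /(@nbhs_ballP R R)[e /= e0 Je]] NJ] :=
  cH (form_cover_nbhs wU U0).
have {}NJ y t : N y -> `|t0 - t| < e -> U (H (y, t)).
  by move=> Ny te; apply: (NJ (y, t)); split => //=; exact: Je.
exists e => // t1 t2 t1e t2e s1.
have key y t : N y -> `|t0 - t| < e ->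
    G (y, t) - form_fun w U (H (y, t)) = G (y, t1) - form_fun w U (H (y, t1)).
  move=> Ny te.
  apply: (@connected_locally_constant R _ `]t0 - e, t0 + e[%classic
      (fun t => G (y, t) - form_fun w U (H (y, t)))).
  - exact/connected_intervalP/interval_is_interval.
  - move=> s /=; rewrite in_itv/= => se.
    have sU : U (H (y, s)) by apply: NJ => //; rewrite ltr_distlC.
    have := hP wU sU; apply: filterS => s' E _.
    by rewrite /G/= -!addrA E.
  - by rewrite /= in_itv/= -ltr_distlC.
  - by rewrite /= in_itv/= -ltr_distlC.
apply: (primitive_atP (U := U)) => //; [exact: cH|by apply: NJ t2e; exact: nbhs_singleton|].
have N1 : \forall y \near y0, N y /\ G (y, t1) - form_fun w U (H (y, t1)) =
    G (y0, t1) - form_fun w U (H (y0, t1)).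
  apply: filterI => //; apply: s1 => //; apply: NJ t1e.
  exact: nbhs_singleton.
exists ([set y | N y /\ G (y, t1) - form_fun w U (H (y, t1)) =
    G (y0, t1) - form_fun w U (H (y0, t1))], ball t2 (e - `|t0 - t2|)).
  by split => //=; apply: nbhsx_ballx; rewrite subr_gt0.
move=> [y t] /= [[Ny E]]; rewrite /ball/= => tt2.
have t0t : `|t0 - t| < e by have := ler_distD t2 t0 t; lra.
by rewrite (key y t)// E (key y0 t2)//; exact: nbhs_singleton.
Qed.

Lemma homotopy_lifting t : primitive_at w H G (y0, t).
Proof.
have slice_of t' : primitive_at w H G (y0, t') -> slice t'.
  move=> p; apply: (@primitive_at_comp _ _ w _ _ H G (fun y => (y, t'))) p.
  exact: continuous_pairr.
suff st : slice t.
  by have [e e0 E] := slice_full t; apply: (E t t) => //; rewrite subrr normr0.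
(* By [slice_full], the truth value of [slice] is locally constant on the connected line. *)
have -> : slice t = slice 0.
  apply: (@connected_locally_constant R Prop setT slice) => //.
    exact/connected_intervalP.
  move=> s _; have [e e0 E] := slice_full s.
  apply: filterS (nbhsx_ballx s e e0) => s' /= ss' _; apply/propext.
  by split => sl; apply: slice_of; apply: E sl => //; rewrite subrr normr0.
rewrite /slice /G /=; apply: near_eq_primitive_at g0P.
by near=> y; rewrite h0 addr0.
Unshelve. all: by end_near. Qed.

End HomotopyLifting.

(** * Path integrals as differences of primitives *)

Section PathIntegral.
Context {R : realType} {X : topologicalType} (w : closed_one_form R X).

Lemma clamp_subproof (t : R) : Num.max 0 (Num.min 1 t) \in unit_interval R.
Proof.
by rewrite inE /unit_interval/= in_itv/= le_max lexx /= ge_max ler01 ge_min lexx.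
Qed.

Definition clamp (t : R) : unit_interval R :=
  exist (fun x => x \in unit_interval R) _ (clamp_subproof t).

Lemma clamp_continuous : continuous clamp.
Proof.
apply: continuous_comp_initial => t.
apply: (@continuous_max R R (cst 0) (fun t => Num.min 1 t)); first exact: cvg_cst.
by apply: (@continuous_min R R (cst 1) id); [exact: cvg_cst|exact: cvg_id].
Qed.

Lemma set_val_clamp (t : R) : 0 <= t <= 1 -> set_val (clamp t) = t.
Proof.
by move=> /andP[t0 t1]; change (Num.max 0 (Num.min 1 t) = t);
  rewrite (min_idPr t1) (max_idPr t0).
Qed.

Lemma unit_interval_inj (s s' : unit_interval R) : set_val s = set_val s' -> s = s'.
Proof. exact: val_inj. Qed.

Lemma clampK (s : unit_interval R) : clamp (set_val s) = s.
Proof. by apply: unit_interval_inj; rewrite set_val_clamp// unit_intervalP. Qed.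

Lemma exists_primitive_path (p : cpath R X) :
  exists g : unit_interval R -> R, forall s, primitive_at w p g s.
Proof.
have cp : continuous (p \o clamp).
  move=> t; apply: continuous_comp; first exact: clamp_continuous.
  exact: cts_fun.
have [g _ gP] := exists_primitive w cp.
exists (g \o set_val) => s.
have -> : p = (p \o clamp) \o set_val :> (unit_interval R -> X).
  by apply/funext => t /=; rewrite clampK.
by apply: primitive_at_comp; [exact: set_val_continuous|exact: gP].
Qed.

Lemma lebesgue_path (p : R -> X) : continuous p -> exists2 e : R, 0 < e &
  forall s : R, 0 <= s <= 1 -> exists2 U, form_cover w U &
    forall s', `|s - s'| < e -> U (p s').
Proof.
move=> cp.
have /compact_near_coveringP cov := @segment_compact R 0 1.
pose P (e : R) s := exists2 U, form_cover w U & forall s', `|s - s'| < e -> U (p s').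
have : \forall e \near 0^'+, `[0, 1]%classic `<=` P e.
  apply: cov => x _; have [U wU Ux] := form_cover_mem w (p x).
  have /(@nbhs_ballP R R)[e /= e0 He] := cp _ _ (form_cover_nbhs wU Ux).
  have e20 : 0 < e / 2 by rewrite divr_gt0.
  exists (ball x (e / 2), [set e' | e' < e / 2]).
    by split => /=; [exact: nbhsx_ballx|exact: nbhs_right_lt].
  move=> [x' e'] /= [xx' e'e]; exists U => // s' ss'.
  apply: (He s'); rewrite /ball/=; move: xx'; rewrite /ball/= => xx'.
  by have := ler_distD x' x s'; lra.
move=> H; near (0 : R)^'+ => e; exists e => // s s01.
have : `[0, 1]%classic `<=` P e by near: e.
by apply; rewrite /= in_itv.
Unshelve. all: by end_near. Qed.

Lemma exists_path_integral (p : cpath R X) : exists v, is_path_integral w p v.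
Proof.
have cp : continuous (p \o clamp).
  move=> t; apply: continuous_comp; first exact: clamp_continuous.
  exact: cts_fun.
have [e e0 He] := lebesgue_path cp.
pose N := (Num.truncn e^-1).+1.
have N0 : 0 < N%:R :> R by rewrite ltr0n.
have Ne : N%:R^-1 < e.
  rewrite -[ltRHS]invrK ltf_pV2 ?posrE ?invr_gt0//; exact: truncnS_gt.
have tN i : (i <= N)%N -> 0 <= (i%:R / N%:R : R) <= 1.
  by move=> iN; rewrite divr_ge0//= ler_pdivrMr// mul1r ler_nat.
pose t i := clamp (i%:R / N%:R).
have tE i : (i <= N)%N -> set_val (t i) = i%:R / N%:R.
  by move=> iN; rewrite set_val_clamp// tN.
have /choice[U HU] : forall i : nat, exists U, (i < N)%N -> form_cover w U /\
    forall s', `|i%:R / N%:R - s'| < e -> U (p (clamp s')).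
  move=> i; have [iN|] := boolP (i < N)%N; last by exists set0.
  by have [U wU UP] := He _ (tN _ (ltnW iN)); exists U.
eexists; exists N, t, U; split; last by reflexivity.
- by apply: unit_interval_inj; rewrite tE// mul0r.
- by apply: unit_interval_inj; rewrite tE// divff// gt_eqF.
- by move=> i iN; rewrite !tE ?(ltnW iN)// ltr_pM2r ?invr_gt0// ltr_nat.
- move=> i iN; have [wU UP] := HU i iN; split => // s; rewrite !tE ?(ltnW iN)//.
  move=> /andP[s1 s2]; rewrite -(clampK s); apply: UP.
  rewrite distrC ger0_norm ?subr_ge0//; apply: le_lt_trans Ne.
  rewrite lerBlDl; apply: (le_trans s2).
  by rewrite -natr1 mulrDl mul1r.
Qed.

(** On each piece the primitive differs from the local [form_fun] by a constant, so the sum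
    telescopes and is the same for every adapted subdivision. *)
Lemma is_path_integralE (p : cpath R X) g v :
  (forall s, primitive_at w p g s) -> is_path_integral w p v -> v = g I1 - g I0.
Proof.
move=> gP [N [t [U [t0 tN tlt tU ->]]]]; rewrite -tN -t0 -(telescope_sumr (fun i => g (t i)))//.
rewrite -(big_mkord xpredT (fun i => form_fun w (U i) (p (t i.+1)) - form_fun w (U i) (p (t i)))).
apply: eq_big_nat => i /andP[_ iN]; have [wU Us] := tU i iN.
have titi := tlt i iN.
have := @connected_locally_constant R _ `[set_val (t i), set_val (t i.+1)]%classic
  (fun s => g (clamp s) - form_fun w (U i) (p (clamp s))) (@segment_connected R _ _) _
  (set_val (t i)) (set_val (t i.+1)).
rewrite !clampK => E.
have {}E : g (t i) - form_fun w (U i) (p (t i)) =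
  g (t i.+1) - form_fun w (U i) (p (t i.+1)).
  apply: E; last 2 first.
  - by rewrite /= in_itv/= lexx ltW.
  - by rewrite /= in_itv/= lexx ltW.
  move=> s /=; rewrite in_itv/= => /andP[s1 s2].
  have sU : U i (p (clamp s)).
    apply: Us; rewrite set_val_clamp ?s1//.
    have /andP[? _] := unit_intervalP (t i); have /andP[_ ?] := unit_intervalP (t i.+1).
    by apply/andP; split; lra.
  near=> s' => _; near: s'.
  exact: (clamp_continuous (gP (clamp s) _ wU sU)).
lra.
Unshelve. all: by end_near. Qed.

Lemma path_integralE (p : cpath R X) g :
  (forall s, primitive_at w p g s) -> path_integral w p = g I1 - g I0.
Proof.
move=> gP; rewrite /path_integral; have [v vP] := exists_path_integral p.
case: xgetP => [u _ /= uP|/(_ v)//]; exact: is_path_integralE gP uP.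
Qed.

(** [V] need not be open: it will be a ball, a member of the cover or a closed invariant set. *)
Lemma path_integral_in (p : cpath R X) (V : set X) (f : X -> R) :
  (forall U, form_cover w U -> locally_constant (U `&` V)
    (fun x => form_fun w U x - f x)) ->
  range p `<=` V -> path_integral w p = f (p I1) - f (p I0).
Proof.
move=> fP pV; apply: (path_integralE (g := f \o p)) => s U wU Us.
have ps : (U `&` V) (p s) by split => //; apply: pV; exists s.
have H1 : \forall s' \near s, (U `&` V) (p s') ->
   form_fun w U (p s') - f (p s') = form_fun w U (p s) - f (p s).
  exact: (@cts_fun _ _ p s _ (fP U wU _ ps)).
have H2 : \forall s' \near s, U (p s').
  exact: (@cts_fun _ _ p s _ (form_cover_nbhs wU Us)).
near=> s'; have : form_fun w U (p s') - f (p s') = form_fun w U (p s) - f (p s).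
  have : (U `&` V) (p s') -> form_fun w U (p s') - f (p s') = form_fun w U (p s) - f (p s).
    by near: s'.
  by apply; split; [near: s'|apply: pV; exists s'].
by move=> /= E; lra.
Unshelve. all: by end_near. Qed.

End PathIntegral.

(** * Integrals along trajectories *)

Section FlowIntegral.
Context {R : realType} {X : topologicalType} (w : closed_one_form R X)
  (Phi : flow R X).

Definition flow_integral (x : X) (t : R) : R := path_integral w (trajectory Phi x t).

Lemma continuous_orbit x : continuous (fun t : R => Phi (x, t)).
Proof.
move=> t; apply: (@continuous_comp _ _ _ (fun t : R => (x, t)) Phi).
  exact: continuous_pairl.
exact: flow_continuous.
Qed.

Lemma continuous_time t : continuous (fun x : X => Phi (x, t)).
Proof.
move=> x; apply: (@continuous_comp _ _ _ (fun x : X => (x, t)) Phi).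
  exact: continuous_pairr.
exact: flow_continuous.
Qed.

Lemma flow_integral_prim x (h : R -> R) :
  (forall t, primitive_at w (fun t => Phi (x, t)) h t) ->
  forall t, flow_integral x t = h t - h 0.
Proof.
move=> hP t; rewrite /flow_integral.
rewrite (path_integralE (g := fun s => h (t * set_val s))).
  by rewrite /I1 /I0 /= mulr1 mulr0.
move=> s; apply: (@primitive_at_comp _ _ w _ _ (fun t => Phi (x, t)) h
  (fun s : unit_interval R => t * set_val s)); last exact: hP.
apply: (@continuousM R _ (cst t) set_val s); first exact: cst_continuous.
exact: set_val_continuous.
Qed.

Lemma flow_integralP x t :
  primitive_at w (fun t => Phi (x, t)) (flow_integral x) t.
Proof.
have [h h0 hP] := exists_primitive w (@continuous_orbit x).
have -> // : flow_integral x = h.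
by apply/funext => s; rewrite (flow_integral_prim hP) h0 subr0.
Qed.

Lemma flow_integral0 x : flow_integral x 0 = 0.
Proof. by rewrite (flow_integral_prim (@flow_integralP x)) subrr. Qed.

Lemma flow_integralD x s t :
  flow_integral x (s + t) = flow_integral x s + flow_integral (Phi (x, s)) t.
Proof.
have -> : flow_integral (Phi (x, s)) t = flow_integral x (s + t) - flow_integral x (s + 0).
  apply: (@flow_integral_prim _ (fun t => flow_integral x (s + t))).
  move=> t'.
  have -> : (fun t => Phi (Phi (x, s), t)) = (fun t => Phi (x, t)) \o (fun t => s + t).
    by apply/funext => u /=; rewrite flowD.
  apply: (@primitive_at_comp _ _ w _ _ (fun t => Phi (x, t)) (flow_integral x)
    (fun t : R => s + t)); last exact: flow_integralP.
  by apply: (@continuousD R R^o _ (cst s) id t'); [exact: cvg_cst|exact: cvg_id].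
by rewrite addr0 [RHS]addrC subrK.
Qed.

(** The flow is a homotopy of [p], and the integrals along trajectories are its vertical primitives.
    This controls how the integral varies with the starting point. *)
Lemma flow_integral_lift {S : topologicalType} (p : S -> X) (g : S -> R) s0 t :
  continuous p -> primitive_at w p g s0 ->
  primitive_at w (fun q : S * R => Phi (p q.1, q.2))
    (fun q => g q.1 + flow_integral (p q.1) q.2) (s0, t).
Proof.
move=> cp pg; apply: (@homotopy_lifting _ _ _ w (fun q : S * R => Phi (p q.1, q.2))
   (fun y => flow_integral (p y))).
- move=> q; apply: (@continuous_comp _ _ _ (fun q : S * R => (p q.1, q.2)) Phi).
    apply: continuous_pair => {}q; last exact: cvg_snd.
    by apply: (@continuous_comp _ _ _ fst p); [exact: cvg_fst|exact: cp].
  exact: flow_continuous.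
- by move=> y t'; exact: flow_integralP.
- by move=> y; exact: flow_integral0.
- apply: near_eq_primitive_at_map pg.
  by near=> y; rewrite flow0.
Unshelve. all: by end_near. Qed.

Lemma flow_integral_lift_time {S : topologicalType} (p : S -> X) (g : S -> R) s0 t :
  continuous p -> primitive_at w p g s0 ->
  primitive_at w (fun s => Phi (p s, t)) (fun s => g s + flow_integral (p s) t) s0.
Proof.
move=> cp pg; apply: (primitive_at_comp (h := fun s => (s, t)) _
  (flow_integral_lift (s0 := s0) (t := t) cp pg)).
exact: continuous_pairr.
Qed.

Lemma primitive_at_form_fun U x : form_cover w U -> U x ->
  primitive_at w id (form_fun w U) x.
Proof.
move=> wU Ux; apply: (primitive_atP (U := U)) => //.
by near=> y; rewrite !subrr.
Unshelve. all: by end_near. Qed.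

(** Subtracting the local primitive [form_fun w U] at the start from the lifted primitive along the
    flow leaves the integral. *)
Lemma flow_integral_continuous :
  continuous (fun q : X * R => flow_integral q.1 q.2).
Proof.
move=> [x t]; have [U wU Ux] := form_cover_mem w x.
have p := flow_integral_lift (t := t) (fun x => cvg_id) (primitive_at_form_fun wU Ux).
have /= c1 := primitive_at_continuous _ p.
have {}c1 : {for (x, t), continuous (fun q : X * R =>
    form_fun w U q.1 + flow_integral q.1 q.2)}.
  apply: c1; have -> : (fun q : X * R => Phi (q.1, q.2)) = Phi.
    by apply/funext => -[].
  exact: flow_continuous.
have c2 : {for (x, t), continuous (fun q : X * R => form_fun w U q.1)}.
  apply: (@cvg_comp _ _ _ fst (form_fun w U)); first exact: cvg_fst.
  exact: form_fun_cvg.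
have -> : (fun q : X * R => flow_integral q.1 q.2) = (fun q : X * R =>
    form_fun w U q.1 + flow_integral q.1 q.2 - form_fun w U q.1).
  by apply/funext => q; rewrite addrAC subrr add0r.
exact: (@continuousB R R^o _ _ _ _ c1 c2).
Qed.

Lemma flow_integral_continuous_orbit x : continuous (flow_integral x).
Proof.
move=> t; apply: (@continuous_comp _ _ _ (fun t : R => (x, t))
  (fun q : X * R => flow_integral q.1 q.2)).
  exact: continuous_pairl.
exact: flow_integral_continuous.
Qed.

Lemma flow_integral_continuous_time t : continuous (fun x => flow_integral x t).
Proof.
move=> x; apply: (@continuous_comp _ _ _ (fun x : X => (x, t))
  (fun q : X * R => flow_integral q.1 q.2)).
  exact: continuous_pairr.
exact: flow_integral_continuous.
Qed.

(** Moving the start changes the integral only through the local primitives at the two ends of the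
    trajectory piece. *)
Lemma flow_integral_near U V x t : form_cover w U -> form_cover w V ->
  U x -> V (Phi (x, t)) ->
  \forall y \near x, flow_integral y t - flow_integral x t =
    form_fun w V (Phi (y, t)) - form_fun w V (Phi (x, t))
    - (form_fun w U y - form_fun w U x).
Proof.
move=> wU wV Ux Vx.
have := flow_integral_lift_time (t := t) (fun x => cvg_id) (primitive_at_form_fun wU Ux) wV Vx.
apply: filterS => y /= E; lra.
Qed.

End FlowIntegral.

Section Triangle.
Context {R : realType} {X : topologicalType} (w : closed_one_form R X).

Lemma cone_subproof (q : R * R) :
  (set_val (clamp q.1) * (1 - set_val (clamp q.2)),
   set_val (clamp q.1) * set_val (clamp q.2)) \in triangle R.
Proof.
have /andP[s0 s1] := unit_intervalP (clamp q.1).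
have /andP[t0 t1] := unit_intervalP (clamp q.2).
by rewrite inE; split => /=; nra.
Qed.

(* collapses the side [q.1 = 0] of the square to the vertex (0, 0) *)
Definition cone (q : R * R) : triangle R :=
  exist (fun p => p \in triangle R) _ (cone_subproof q).

Lemma cone_continuous : continuous cone.
Proof.
have c1 : continuous (fun q : R * R => set_val (clamp q.1) : R).
  move=> q; apply: (@continuous_comp _ _ _ fst (fun t => set_val (clamp t) : R)).
    exact: cvg_fst.
  apply: continuous_comp; [exact: clamp_continuous|exact: set_val_continuous].
have c2 : continuous (fun q : R * R => set_val (clamp q.2) : R).
  move=> q; apply: (@continuous_comp _ _ _ snd (fun t => set_val (clamp t) : R)).
    exact: cvg_snd.
  apply: continuous_comp; [exact: clamp_continuous|exact: set_val_continuous].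
apply: continuous_comp_initial; apply: continuous_pair => q.
  apply: (@continuousM R _ _ (fun q : R * R => 1 - set_val (clamp q.2) : R)); first exact: c1.
  apply: (@continuousB R R^o _ (cst 1)); [exact: cvg_cst|exact: c2].
by apply: (@continuousM R _ (fun q : R * R => set_val (clamp q.1) : R)); [exact: c1|exact: c2].
Qed.

(** Homotopy lifting gives a primitive [G] of [sigma \o cone] on the whole plane. The faces are
    three sides of the square, so their integrals are differences of corner values of [G]. *)
Lemma path_integral_triangle (sigma : continuousType (triangle R) X) :
  path_integral w (sigma \o face0 : cpath R X)
  - path_integral w (sigma \o face1 : cpath R X)
  + path_integral w (sigma \o face2 : cpath R X) = 0.
Proof.
pose H := sigma \o cone : R * R -> X.
have cH : continuous H.
  move=> q; apply: continuous_comp; [exact: cone_continuous|exact: cts_fun].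
have cHl t : continuous (fun s => H (s, t)).
  move=> s; apply: (@continuous_comp _ _ _ (fun s => (s, t)) H); last exact: cH.
  exact: continuous_pairr.
have cHr s : continuous (fun t => H (s, t)).
  move=> t; apply: (@continuous_comp _ _ _ (fun t => (s, t)) H); last exact: cH.
  exact: continuous_pairl.
have /choice[h hP] : forall s, exists h : R -> R, h 0 = 0 /\
    forall t, primitive_at w (fun t => H (s, t)) h t.
  by move=> s; have [h h0 hP] := exists_primitive w (cHr s); exists h.
have [g0 _ g0P] := exists_primitive w (cHl 0).
pose G (q : R * R) : R := g0 q.1 + h q.1 q.2.
have GP q : primitive_at w H G q.
  case: q => s t; apply: (homotopy_lifting cH) => //.
  - by move=> *; apply: (hP _).2.
  - by move=> y; exact: (hP _).1.
have pathG (p : cpath R X) (k : R -> R * R) : continuous k ->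
    (forall s, p s = H (k (set_val s))) -> path_integral w p = G (k 1) - G (k 0).
  move=> ck pE; rewrite (path_integralE (g := G \o (k \o set_val)))// => s.
  have -> : p = H \o (k \o set_val) :> (unit_interval R -> X) by exact/funext.
  apply: primitive_at_comp; last exact: GP.
  by apply: continuous_comp; [exact: set_val_continuous|exact: ck].
have tri_inj (a b : triangle R) : set_val a = set_val b -> a = b by exact: val_inj.
have coneE' s t : set_val (cone (s, t)) = (set_val (clamp s) * (1 - set_val (clamp t)),
    set_val (clamp s) * set_val (clamp t)) by [].
have coneE s t : 0 <= s <= 1 -> 0 <= t <= 1 ->
    set_val (cone (s, t)) = (s * (1 - t), s * t).
  by move=> s01 t01; rewrite coneE' !set_val_clamp.
have i0 : 0 <= (0 : R) <= 1 by rewrite lexx ler01.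
have i1 : 0 <= (1 : R) <= 1 by rewrite lexx ler01.
rewrite (pathG _ (fun t => (1, t))); last 2 first.
- exact: continuous_pairl.
- move=> s; congr (sigma _); apply: tri_inj; rewrite coneE// ?unit_intervalP//.
  by rewrite !mul1r.
rewrite (pathG _ (fun t => (t, 1))); last 2 first.
- exact: continuous_pairr.
- move=> s; congr (sigma _); apply: tri_inj; rewrite coneE// ?unit_intervalP//.
  by rewrite subrr mulr0 mulr1.
rewrite (pathG _ (fun t => (t, 0))); last 2 first.
- exact: continuous_pairr.
- move=> s; congr (sigma _); apply: tri_inj; rewrite coneE// ?unit_intervalP//.
  by rewrite subr0 mulr0 mulr1.
(* Only the collapsed side remains; the map is constant on it, hence so is [G]. *)
suff : G (0, 1) = G (0, 0) by lra.
have c0 t : H (0, t) = H (0, 0).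
  congr (sigma _); apply: tri_inj; rewrite !coneE'.
  have -> : set_val (clamp (0 : R)) = 0 by rewrite set_val_clamp.
  by rewrite !mul0r.
have := @primitive_at_unique _ _ w R setT (fun t => H (0, t))
  (fun t => G (0, t)) (cst 0) _ _ _ 1 0 I I.
rewrite /= !subr0; apply.
- exact/connected_intervalP.
- move=> s _; apply: (@primitive_at_comp _ _ w _ _ H G (fun t => (0, t))); last exact: GP.
  exact: continuous_pairl.
- move=> s _ U wU Us; near=> s' => /=; by rewrite (c0 s) (c0 s').
Unshelve. all: by end_near. Qed.

End Triangle.

(** * The pairing with homology *)

Section FreegSum.
Context {K : choiceType} {V : zmodType} (F : K -> V).

Definition freeg_sum (c : {freeg K / int}) : V := \sum_(x <- dom c) F x *~ coeff x c.

(** [c], [d] and [c - d] have different supports; a common list makes additivity a termwise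
    statement. *)
Lemma freeg_sum_dom (s : seq K) c : uniq s -> {subset dom c <= s} ->
  freeg_sum c = \sum_(x <- s) F x *~ coeff x c.
Proof.
move=> us sub; rewrite (bigID (mem (dom c)) _ (fun x => F x *~ coeff x c))/=.
rewrite [X in _ + X]big1 ?addr0; last first.
  by move=> x xc; rewrite coeff_outdom.
rewrite -big_filter; apply: perm_big; apply: uniq_perm.
- exact: uniq_dom.
- exact: filter_uniq.
- by move=> x; rewrite mem_filter /=; case: (boolP (x \in dom c)) => //= /sub ->.
Qed.

Lemma freeg_sum_is_additive : zmod_morphism freeg_sum.
Proof.
move=> c d; pose s := undup (dom c ++ dom d).
have us : uniq s by exact: undup_uniq.
rewrite !(freeg_sum_dom us); last first.
- by move=> x; rewrite mem_undup => /domB.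
- by move=> x xc; rewrite mem_undup mem_cat xc.
- by move=> x xc; rewrite mem_undup mem_cat xc orbT.
by rewrite -sumrB; apply: eq_bigr => x _; rewrite coeffB mulrzBr.
Qed.

HB.instance Definition _ := GRing.isZmodMorphism.Build {freeg K / int} V freeg_sum
  freeg_sum_is_additive.

Lemma freeg_sumU (x : K) : freeg_sum << x >> = F x.
Proof. by rewrite /freeg_sum domU1 big_seq1 coeffU eqxx mulr1. Qed.

End FreegSum.

Lemma freeg_additive_ext {K : choiceType} {V : zmodType}
    (f g : {additive {freeg K / int} -> V}) :
  (forall x, f << x >> = g << x >>) -> f =1 g.
Proof.
move=> fg c; rewrite -(freeg_sumE c) !raddf_sum; apply: eq_bigr => x _.
have -> : << coeff x c *g x >> = << x >> *~ coeff x c :> {freeg K / int}.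
  by rewrite freegU_mulz intz.
by rewrite !raddfMz fg.
Qed.

Section Pairing.
Context {R : realType} {X : topologicalType}.

Lemma chain_integralE (w : closed_one_form R X) (c : chain1 R X) :
  chain_integral w c = freeg_sum (path_integral w) c.
Proof. by []. Qed.

Lemma chain_integral_boundary (w : closed_one_form R X) (b : chain2 R X) :
  chain_integral w (boundary2 b) = 0.
Proof.
pose f : chain2 R X -> R := freeg_sum (path_integral w) \o @boundary2 R X.
have fB : zmod_morphism f by move=> b1 b2; rewrite /f /= boundary2B raddfB.
pose F := HB.pack_for {additive {freeg (continuousType (triangle R) X) / int} -> R} f
  (GRing.isZmodMorphism.Build {freeg (continuousType (triangle R) X) / int} R f fB).
have -> : chain_integral w (boundary2 b) = F b by [].
rewrite (freeg_additive_ext (g := \0)) // => sigma /=.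
rewrite /f /= /boundary2 liftU scale1r.
rewrite raddfD raddfB /= !freeg_sumU; exact: path_integral_triangle.
Qed.

(** The two chain integrals differ by [G] evaluated on the boundary, which is zero for a cycle. *)
Lemma chain_integral_exact (w w' : closed_one_form R X) (G : X -> R) (c : cycle1 R X) :
  (forall p : cpath R X, path_integral w' p = path_integral w p + (G (p I1) - G (p I0))) ->
  chain_integral w' (sval c) = chain_integral w (sval c).
Proof.
move=> wG.
pose f : chain1 R X -> R := freeg_sum G \o @boundary1 R X.
have fB : zmod_morphism f.
  by move=> b1 b2; rewrite /f /= /boundary1 (lift_is_additive _) raddfB.
pose F := HB.pack_for {additive {freeg (cpath R X) / int} -> R} f
  (GRing.isZmodMorphism.Build {freeg (cpath R X) / int} R f fB).
have H : freeg_sum (path_integral w') =1 (freeg_sum (path_integral w) \+ F).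
  apply: freeg_additive_ext => p /=.
  by rewrite !freeg_sumU wG /f/= /boundary1 liftU scale1r raddfB /= !freeg_sumU.
rewrite !chain_integralE H /= /f /= (eqP (svalP c)) raddf0 addr0.
by [].
Qed.

End Pairing.

(** * One-forms and Cech cohomology *)

Section CechTriviality.
Context {T : topologicalType} {R : realType}.
Implicit Types (A : set T) (c d : cech_cocycle T R).

(** Triviality of the class on [A], stated with functions on [T] so that the subspace type is
    avoided; [cech_restrict_eq0] is the bridge. *)
Definition trivial_on A c := exists h : set T -> T -> R,
  (forall U, cocycle_cover c U -> locally_constant (U `&` A) (h U)) /\
  (forall U V, cocycle_cover c U -> cocycle_cover c V ->
    forall x, A x -> U x -> V x -> cocycle_fun c U V x = h V x - h U x).

Lemma open_coverP (W : set (set T)) : open_cover W -> forall x, exists2 U, W U & U x.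
Proof.
move=> [_ Wc] x; have : setT x by [].
by rewrite -{1}Wc => -[U WU Ux]; exists U.
Qed.

Lemma open_cover_choice (W : set (set T)) : open_cover W ->
  exists u : T -> set T, (forall x, W (u x)) /\ (forall x, u x x).
Proof.
move=> oW; have /choice[u uP] x : exists U, W U /\ U x.
  by have [U WU Ux] := open_coverP oW x; exists U.
by exists u; split=> x; case: (uP x).
Qed.

Lemma open_cover_nbhs (W : set (set T)) U x : open_cover W -> W U -> U x -> nbhs x U.
Proof. by move=> [Wo _] WU Ux; apply: open_nbhs_nbhs; split => //; exact: Wo. Qed.

Lemma locally_constantB A (f g : T -> R) : locally_constant A f ->
  locally_constant A g -> locally_constant A (fun x => f x - g x).
Proof. by move=> fA gA; apply: locally_constantD => //; exact: locally_constantN. Qed.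

Lemma locally_constant_glue (W : set (set T)) A (k : set T -> T -> R)
    (g : T -> R) : open_cover W ->
  (forall U, W U -> locally_constant (U `&` A) (k U)) ->
  (forall U x, W U -> U x -> A x -> g x = k U x) -> locally_constant A g.
Proof.
move=> oW kW gk x Ax; have [U WU Ux] := open_coverP oW x.
have H := kW _ WU x (conj Ux Ax).
near=> y => Ay.
have Uy : U y by near: y; exact: open_cover_nbhs oW WU Ux.
rewrite (gk U)// (gk U x)//.
by have : (U `&` A) y -> k U y = k U x; [near: y|apply].
Unshelve. all: by end_near. Qed.

(** In degree one a coboundary on a refinement descends to the original cover: on a member [V] the
    candidates [k V U] agree for all [U] by the cocycle condition, hence glue. *)
Lemma trivial_on_cohomologous A c d : cohomologous c d ->
  trivial_on A c -> trivial_on A d.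
Proof.
move=> [W [r [s [b [oW Wr Ws Wb WE]]]]] [h [hlc hE]].
have [u [uW ux]] := open_cover_choice oW.
pose k (V U : set T) x := cocycle_fun d (s U) V x + h (r U) x + b U x.
have kE V U x : cocycle_cover d V -> W U -> V x -> U x -> A x -> k V (u x) x = k V U x.
  move=> dV WU Vx Ux Ax; rewrite /k.
  have [du su] := Ws _ (uW x); have [ds sU] := Ws _ WU.
  have [ru1 ru2] := Wr _ (uW x); have [rU1 rU2] := Wr _ WU.
  have := WE _ _ (uW x) WU x (ux x) Ux.
  rewrite (hE _ _ ru1 rU1 x Ax (ru2 _ (ux x)) (rU2 _ Ux)).
  have := cocycle_cond du ds dV (su _ (ux x)) (sU _ Ux) Vx.
  lra.
exists (fun V x => k V (u x) x); split.
  move=> V dV.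
  apply: (@locally_constant_glue W (V `&` A) (fun U => k V U)) => //.
    move=> U WU; have [ds sU] := Ws _ WU; have [rU1 rU2] := Wr _ WU.
    apply: locally_constantD; first apply: locally_constantD.
    - apply: locally_constantS (cocycle_locally_constant ds dV).
      by move=> x [Ux [Vx Ax]]; split => //; exact: sU.
    - apply: locally_constantS (hlc _ rU1).
      by move=> x [Ux [Vx Ax]]; split => //; exact: rU2.
    - by apply: locally_constantS (Wb _ WU) => x [].
  by move=> U x WU Ux [Vx Ax]; exact: kE.
move=> V V' dV dV' x Ax Vx V'x; rewrite /k.
have [du su] := Ws _ (uW x).
have := cocycle_cond du dV dV' (su _ (ux x)) Vx V'x.
lra.
Qed.

End CechTriviality.

Lemma continuous_at_sum {R : realType} {S : topologicalType} {I : Type} (r : seq I)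
    (f : I -> S -> R) (x : S) : (forall i, {for x, continuous (f i)}) ->
  {for x, continuous (fun y => \sum_(i <- r) f i y)}.
Proof.
move=> cf; rewrite /prop_for /continuous_at; elim: r => [|i r IH].
  rewrite big_nil (_ : (fun y => _) = cst 0); first exact: cvg_cst.
  by apply/funext => y; rewrite big_nil.
rewrite big_cons (_ : (fun y => _) = (fun y => f i y + \sum_(j <- r) f j y)).
  by apply: (@cvgD R R^o); [exact: cf|exact: IH].
by apply/funext => y; rewrite big_cons.
Qed.

(** * Uniformity in compact metric spaces *)

Section CompactMetric.
Context {R : realType} {X : metricType R}.
Hypothesis compactX : compact [set: X].

Lemma near_mdist (x : X) (P : set X) : (\forall y \near x, P y) ->
  exists2 e : R, 0 < e & forall y, mdist x y < e -> P y.
Proof.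
move=> /nbhs_ballP[e /= e0 He]; exists e => // y xy.
by apply: He; rewrite ballEmdist.
Qed.

Lemma nbhs_mdist (x : X) (e : R) : 0 < e -> \forall y \near x, mdist x y < e.
Proof. by move=> e0; have := nbhsx_ballx x e e0; rewrite ballEmdist. Qed.

(** [P] is any notion of smallness inherited by subsets. Refinement of covers, uniform continuity
    and uniform local path connectedness are all instances. *)
Lemma lebesgue_number (P : set X -> Prop) :
  (forall A B, A `<=` B -> P B -> P A) -> (forall x : X, exists2 N : set X, nbhs x N & P N) ->
  exists2 r : R, 0 < r & forall x, P [set y | mdist x y < r].
Proof.
move=> Psub Ploc; have /compact_near_coveringP cov := compactX.
have : \forall r \near 0^'+, [set: X] `<=` (fun x => P [set y | mdist x y < r]).
  apply: cov => x _; have [N xN PN] := Ploc x.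
  have [e e0 He] := near_mdist xN.
  have e20 : 0 < e / 2 by rewrite divr_gt0.
  exists ([set y | mdist x y < e / 2], [set r | r < e / 2]).
    by split => /=; [exact: nbhs_mdist|exact: nbhs_right_lt].
  move=> [y r] /= [xy re]; apply: Psub PN => z /= yz; apply: He.
  by have := metric_triangle x y z; lra.
move=> H; near (0 : R)^'+ => r; exists r => // x.
by have : [set: X] `<=` (fun x => P [set y | mdist x y < r]); [near: r|apply].
Unshelve. all: by end_near. Qed.

Lemma finite_net (r : R) : 0 < r ->
  exists s : seq X, forall x, exists2 y, y \in s & mdist y x < r.
Proof.
move=> r0.
(* The filter of ever larger finite sequences: for it, the near-covering form of compactness yields
   a finite net. *)
pose F := filter_from [set: seq X] (fun s0 => [set s : seq X | {subset s0 <= s}]).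
have FF : Filter F.
  apply: filter_from_filter; first by exists [::].
  move=> s1 s2 _ _; exists (s1 ++ s2) => // s /= s12.
  by split => x xs; apply: s12; rewrite mem_cat xs ?orbT.
have /compact_near_coveringP cov := compactX.
have [s0 _ Hs] : \forall s \near F, [set: X] `<=` (fun x => exists2 y, y \in s & mdist y x < r).
  apply: cov => x _; exists ([set y | mdist x y < r], [set s : seq X | {subset [:: x] <= s}]).
    by split => /=; [exact: nbhs_mdist|exists [:: x]].
  by move=> [y s] /= [xy xs]; exists x => //; apply: xs; rewrite mem_head.
by exists s0 => x; exact: (Hs s0).
Qed.

Lemma mdist_continuous (y : X) : continuous (fun x => mdist y x).
Proof.
move=> x; apply/(@cvgrPdist_lt R R^o) => e e0.
apply: filterS (nbhs_mdist x e0) => z xz.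
have := metric_triangle y x z; have := metric_triangle y z x.
rewrite (metric_sym z x) ltr_distlC => ? ?; apply/andP; split; lra.
Qed.

Lemma compact_bounded_above (f : X -> R) : continuous f -> exists M, forall x, f x <= M.
Proof.
move=> cf; have [x0|ne] := pselect (exists x : X, True); last first.
  by exists 0 => x; case: ne; exists x.
have ct : compact (f @` [set: X]).
  by apply: continuous_compact => //; exact: continuous_subspaceT.
have [M [_ HM]] := compact_bounded ct.
exists (M + 1) => x; apply: le_trans (ler_norm _) _.
by apply: (HM (M + 1)); [rewrite ltrDl|exists x].
Qed.

End CompactMetric.

Lemma pi_cech_eq {R : realType} {T : topologicalType} (c d : cech_cocycle T R) :
  \pi_(cech_H1 T R) c = \pi_(cech_H1 T R) d <-> cohomologous c d.
Proof.
split; first by move/eqmodP => /asboolP.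
by move=> H; apply/eqmodP/asboolP.
Qed.

Section CechForms.
Context {R : realType} {T : topologicalType}.

Definition form_cocycle (w : closed_one_form R T) : cech_cocycle T R :=
  CechCocycle (form_open_cover w) (@connecting_locally_constant R T w)
    (@connecting_cond R T w).

Lemma form_classE (w : closed_one_form R T) :
  form_class w = \pi_(cech_H1 T R) (form_cocycle w).
Proof. by []. Qed.

Lemma trivial_on_form (A : set T) (w : closed_one_form R T) :
  trivial_on A (form_cocycle w) <-> exists f : T -> R, forall U, form_cover w U ->
    locally_constant (U `&` A) (fun x => form_fun w U x - f x).
Proof.
split=> [[h [hlc hE]]|[f fP]]; last first.
  exists (fun U x => form_fun w U x - f x); split => //.
  by move=> U V wU wV x _ _ _ /=; rewrite /connecting_fun; lra.
have [u [uW ux]] := open_cover_choice (form_open_cover w).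
exists (fun x => form_fun w (u x) x - h (u x) x) => U wU.
apply: eq_locally_constant (hlc _ wU) => x; rewrite inE => -[Ux Ax].
have := hE _ _ (uW x) wU x Ax (ux x) Ux; rewrite /= /connecting_fun; lra.
Qed.

Lemma cech_restrict_eq0 (A : set T) (xi : cech_H1 T R) :
  cech_restrict A xi = cech_zero <-> trivial_on A (repr xi).
Proof.
rewrite /cech_restrict /cech_zero pi_cech_eq; set d := repr xi; split.
- move=> [W [r [s [b [oW Wr _ Wb WE]]]]].
  have [u [uW ux]] := open_cover_choice oW.
  pose i (U : set A) := restr_index d (r U).
  have iP U : W U -> cocycle_cover d (i U) /\ forall x : A, U x -> i U (set_val x).
    move=> WU; have [rU sub] := Wr _ WU; have [dU E] := restr_indexP rU.
    by split => // x /sub; rewrite -{1}E.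
  (* [b] lives on a refinement of the cover of the subspace; comparing [U] with [V] through the
     cocycle gives a cochain on the original cover. *)
  pose k (V : set T) (U : set A) (x : A) := cocycle_fun d (i U) V (set_val x) - b U x.
  have kE V U x : cocycle_cover d V -> W U -> U x -> V (set_val x) ->
      k V (u x) x = k V U x.
    move=> dV WU Ux Vx.
    have [dU sU] := iP _ WU; have [du su] := iP _ (uW x).
    have := cocycle_cond du dU dV (su _ (ux x)) (sU _ Ux) Vx.
    have := WE _ _ (uW x) WU x (ux x) Ux; rewrite /= /restr_fun /k /i; lra.
  (* Extension by 0: triviality on [A] ignores values outside [A]. *)
  pose h V x := if pselect (A x) is left Ax then
    k V (u (exist _ x (mem_set Ax))) (exist _ x (mem_set Ax)) else 0.
  have hE V (x : A) : h V (set_val x) = k V (u x) x.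
    rewrite /h; case: pselect => [Ax|nA]; last by case: nA; exact: set_valP.
    have -> // : exist _ (set_val x) (mem_set Ax) = x by exact: val_inj.
  have asA x : A x -> exists y : A, x = set_val y.
    by move=> Ax; exists (exist _ x (mem_set Ax)).
  exists h; split=> [V dV x [Vx /asA[y xE]]|U V dU dV x /asA[y ->] Ux Vx]; last first.
    rewrite !hE /k; have [du su] := iP _ (uW y).
    by have := cocycle_cond du dU dV (su _ (ux y)) Ux Vx; lra.
  rewrite xE in Vx *.
  have [du su] := iP _ (uW y).
  have n1 := cocycle_locally_constant du dV (conj (su _ (ux y)) Vx).
  have [B [oB By Bsub]] : nbhs y (u y `&` [set z | u y z -> b (u y) z = b (u y) y]).
    apply: filterI; first exact: open_cover_nbhs oW _ _.
    exact: Wb.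
  case: oB => C oC CE.
  have Cy : C (set_val y) by move: By; rewrite -CE.
  near=> z => -[Vz /asA[t zE]]; rewrite zE !hE.
  have Bt : B t by rewrite -CE /= -zE; near: z; exact: open_nbhs_nbhs.
  have [ut /(_ ut) bt] := Bsub _ Bt.
  rewrite (kE _ (u y))// -?zE// /k bt -zE; congr (_ - _).
  have : (i (u y) `&` V) z -> cocycle_fun d (i (u y)) V z =
    cocycle_fun d (i (u y)) V (set_val y) by near: z.
  by apply; split => //; rewrite zE; exact: su.
- move=> [h [hlc hE]]; exists (@restr_cover T R A d), id, (fun=> setT).
  exists (fun U x => - h (restr_index d U) (set_val x)); split.
  + exact: restr_open_cover.
  + by move=> U dU; split.
  + by move=> U dU; split.
  + move=> U dU; apply: locally_constantN => x Ux.
    have [dU' E] := restr_indexP dU.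
    have Ux' : (restr_index d U `&` A) (set_val x).
      by split; [move: Ux; rewrite -{1}E|exact: set_valP].
    have := @initial_continuous A T set_val x _ (hlc _ dU' _ Ux').
    rewrite /nbhs/= => -[B [oB Bx Bsub]]; exists B; split => //.
    move=> y /Bsub /= + Uy; apply.
    by split; [move: Uy; rewrite -{1}E|exact: set_valP].
  + move=> U V dU dV x Ux Vx; rewrite /= /restr_fun.
    have [dU' EU] := restr_indexP dU; have [dV' EV] := restr_indexP dV.
    rewrite (hE _ _ dU' dV'); first lra.
    * exact: set_valP.
    * by move: Ux; rewrite -{1}EU.
    * by move: Vx; rewrite -{1}EV.
Unshelve. all: by end_near. Qed.

Lemma cech_restrict_form (A : set T) (w : closed_one_form R T) :
  cech_restrict A (form_class w) = cech_zero <->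
  exists f : T -> R, forall U, form_cover w U ->
    locally_constant (U `&` A) (fun x => form_fun w U x - f x).
Proof.
rewrite cech_restrict_eq0 -trivial_on_form.
have H : cohomologous (repr (form_class w)) (form_cocycle w).
  by rewrite -pi_cech_eq reprK.
by split; apply: trivial_on_cohomologous => //; exact: cohomologous_sym.
Qed.

(** Exactness of the cohomology sequence at the one-forms. The differences of local primitives,
    corrected by the cochain [b], agree on overlaps and glue to [G]. *)
Lemma form_class_eq (w w' : closed_one_form R T) : form_class w = form_class w' ->
  exists2 G : T -> R, continuous G & forall U V, form_cover w U -> form_cover w' V ->
    locally_constant (U `&` V) (fun x => form_fun w' V x - form_fun w U x - G x).
Proof.
rewrite !form_classE pi_cech_eq => -[W [r [s [b [oW Wr Ws Wb WE]]]]].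
have [u [uW ux]] := open_cover_choice oW.
pose k U x := form_fun w' (s U) x - form_fun w (r U) x - b U x.
have kE U x : W U -> U x -> k (u x) x = k U x.
  move=> WU Ux; have := WE _ _ (uW x) WU x (ux x) Ux.
  by rewrite /= /connecting_fun /k; lra.
exists (fun x => k (u x) x).
  move=> x; have [wr rs] := Wr _ (uW x); have [ws ss] := Ws _ (uW x).
  have c1 := form_fun_cvg wr (rs _ (ux x)); have c2 := form_fun_cvg ws (ss _ (ux x)).
  have c3 : k (u x) y @[y --> x] --> k (u x) x.
    apply: cvgB; first by apply: cvgB.
    apply: (@cvg_trans _ (b (u x) x @[y --> x])); last exact: cvg_cst.
    apply: near_eq_cvg; near=> y; apply: esym.
    have : u x y -> b (u x) y = b (u x) x by near: y; exact: Wb.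
    by apply; near: y; exact: open_cover_nbhs oW _ _.
  apply: cvg_trans c3; apply: near_eq_cvg; near=> y; apply: esym.
  by apply: kE => //; near: y; exact: open_cover_nbhs oW _ _.
move=> U V wU wV.
apply: (@locally_constant_glue _ _ W (U `&` V)
  (fun W x => form_fun w' V x - form_fun w U x - k W x)) => //.
  move=> Z WZ; have [wr rs] := Wr _ WZ; have [ws ss] := Ws _ WZ.
  have l1 : locally_constant (Z `&` (U `&` V))
      (fun x => form_fun w' V x - form_fun w' (s Z) x).
    apply: locally_constantS (form_compat wV ws) => x [Zx [Ux Vx]].
    by split => //; exact: ss.
  have l2 : locally_constant (Z `&` (U `&` V))
      (fun x => form_fun w U x - form_fun w (r Z) x).
    apply: locally_constantS (form_compat wU wr) => x [Zx [Ux Vx]].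
    by split => //; exact: rs.
  have l3 : locally_constant (Z `&` (U `&` V)) (b Z).
    by apply: locally_constantS (Wb _ WZ) => x [].
  apply: eq_locally_constant (locally_constantD (locally_constantB l1 l2) l3).
  by move=> x _; rewrite /k; lra.
by move=> Z x WZ Zx _; rewrite (kE Z).
Unshelve. all: by end_near. Qed.

Section AddExact.
Variables (w : closed_one_form R T) (G : T -> R).
Hypothesis cG : continuous G.

Lemma add_exact_continuous U : form_cover w U ->
  {within U, continuous (fun x => form_fun w U x + G x)}.
Proof.
move=> wU; have oU := (form_open_cover w).1 _ wU.
rewrite continuous_open_subspace// => x; rewrite inE => Ux.
by apply: (@cvgD R R^o); [exact: form_fun_cvg|exact: cG].
Qed.

Lemma add_exact_compat U V : form_cover w U -> form_cover w V ->
  locally_constant (U `&` V) (fun x => (form_fun w U x + G x) - (form_fun w V x + G x)).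
Proof.
move=> wU wV; apply: eq_locally_constant (form_compat wU wV) => x _; lra.
Qed.

Definition add_exact : closed_one_form R T := @ClosedOneForm R T (form_cover w)
  (fun U x => form_fun w U x + G x) (form_open_cover w) add_exact_continuous
  add_exact_compat.

Lemma form_class_add_exact : form_class add_exact = form_class w.
Proof.
rewrite !form_classE pi_cech_eq.
exists (form_cover w), id, id, (fun _ _ => 0); split => //.
- exact: form_open_cover.
- by move=> U wU; split.
- by move=> U wU; split.
- by move=> U _; exact: locally_constant_cst.
- by move=> U V _ _ x _ _ /=; rewrite /connecting_fun /=; lra.
Qed.

End AddExact.

End CechForms.

Section Exact.
Context {R : realType} {X : topologicalType}.
Variables (w w' : closed_one_form R X) (G : X -> R).
Hypothesis wG : forall U V, form_cover w U -> form_cover w' V ->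
  locally_constant (U `&` V) (fun x => form_fun w' V x - form_fun w U x - G x).

Lemma primitive_at_exact {S : topologicalType} (p : S -> X) g s :
  {for s, continuous p} -> primitive_at w p g s ->
  primitive_at w' p (fun s => g s + G (p s)) s.
Proof.
move=> cp pg V wV Vs; have [U wU Us] := form_cover_mem w (p s).
have H := pg _ wU Us; have H' := cp _ (wG wU wV (conj Us Vs)).
have HU := cp _ (form_cover_nbhs wU Us); have HV := cp _ (form_cover_nbhs wV Vs).
near=> t.
have Ut : U (p t) by near: t.
have Vt : V (p t) by near: t.
have E1 : g t - form_fun w U (p t) = g s - form_fun w U (p s) by near: t.
have E2 : (U `&` V) (p t) -> form_fun w' V (p t) - form_fun w U (p t) - G (p t) =
  form_fun w' V (p s) - form_fun w U (p s) - G (p s) by near: t.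
by have := E2 (conj Ut Vt); lra.
Unshelve. all: by end_near. Qed.

Lemma path_integral_exact (p : cpath R X) :
  path_integral w' p = path_integral w p + (G (p I1) - G (p I0)).
Proof.
have [g gP] := exists_primitive_path w p.
rewrite (path_integralE gP) (path_integralE (g := fun s => g s + G (p s))).
  by lra.
by move=> s; apply: primitive_at_exact => //; exact: cts_fun.
Qed.

End Exact.

Section PairingWelldefined.
Context {R : realType} {X : topologicalType}.

(** The integral does not depend on the form because [dG] integrates to 0 over cycles, nor on the
    cycle because boundaries integrate to 0. *)
Lemma pairingE (w : closed_one_form R X) (xi : cech_H1 X R) (c : cycle1 R X)
    (z : singular_H1 R X) : form_class w = xi -> \pi_(singular_H1 R X) c = z ->
  pairing xi z = chain_integral w (sval c).
Proof.
move=> wxi cz; rewrite /pairing.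
case: xgetP => [v _ /= |/(_ (chain_integral w (sval c)))]; last first.
  by case; exists w, c.
move=> [w' [c' [w'xi c'z ->]]].
have [G cG GP] : exists2 G : X -> R, continuous G & forall U V, form_cover w U -> form_cover w' V ->
    locally_constant (U `&` V) (fun x => form_fun w' V x - form_fun w U x - G x).
  by apply: form_class_eq; rewrite wxi w'xi.
rewrite (chain_integral_exact c' (path_integral_exact GP)).
have /eqmodP/asboolP[b bE] : c' = c %[mod singular_H1 R X] by rewrite cz c'z.
apply: esym; apply/eqP; rewrite -subr_eq0 !chain_integralE.
rewrite -(freeg_sum_is_additive _ (sval c) (sval c')) -bE.
by apply/eqP; exact: chain_integral_boundary.
Qed.

End PairingWelldefined.

Section FormExists.
Context {R : realType} {X : metricType R}.
Hypothesis compactX : compact [set: X].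

(** Surjectivity of the connecting homomorphism: averaging the cocycle over its first index with a
    partition of unity writes it as a coboundary of continuous functions. *)
Lemma exists_form (xi : cech_H1 X R) : exists w : closed_one_form R X, form_class w = xi.
Proof.
set c := repr xi; have oc := cocycle_open_cover c.
have [r r0 rP] : exists2 r : R, 0 < r & forall x, exists2 U, cocycle_cover c U &
    [set y | mdist x y < r] `<=` U.
  apply: (lebesgue_number compactX
    (P := fun A => exists2 U, cocycle_cover c U & A `<=` U)).
    by move=> A B AB [U cU BU]; exists U => // x /AB/BU.
  move=> x; have [U cU Ux] := open_coverP oc x.
  by exists U; [exact: open_cover_nbhs oc cU Ux|exists U].
have /choice[u uP] x : exists U, cocycle_cover c U /\ [set y | mdist x y < r] `<=` U.
  by have [U ? ?] := rP x; exists U.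
have r20 : 0 < r / 2 by rewrite divr_gt0.
have [s sP] := finite_net compactX r20.
(* Radius [r / 2] against the radius [r] of the ball inside [u y]: for each [x] in [V], either [x]
   lies in [u y], and the cocycle is constant near [x] on the overlap, or the bump of [y] vanishes
   near [x]. *)
pose bump (y x : X) : R := Num.max 0 (r / 2 - mdist y x).
have bump0 y x : r / 2 <= mdist y x -> bump y x = 0.
  by move=> yx; rewrite /bump max_l// subr_le0.
have cbump y : continuous (bump y).
  move=> x; apply: (@continuous_max R X (cst 0) (fun x => r / 2 - mdist y x)).
    exact: cvg_cst.
  by apply: (@cvgB R R^o); [exact: cvg_cst|exact: mdist_continuous].
have bump_ge0 y x : 0 <= bump y x by rewrite /bump le_max lexx.
pose tot (x : X) : R := \sum_(y <- s) bump y x.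
have tot_gt0 x : 0 < tot x.
  have [y ys yx] := sP x; rewrite /tot (big_rem y)//=.
  apply: ltr_wpDr; first by apply: sumr_ge0.
  by rewrite /bump lt_max subr_gt0 yx orbT.
have ctot : continuous tot.
  by move=> x; apply: continuous_at_sum => y; exact: cbump.
pose f (V : set X) (x : X) : R := (\sum_(y <- s) bump y x * cocycle_fun c (u y) V x) / tot x.
have fE U V x : cocycle_cover c U -> cocycle_cover c V -> U x -> V x ->
    f V x - f U x = cocycle_fun c U V x.
  move=> cU cV Ux Vx; rewrite /f -mulrBl -sumrB.
  rewrite (eq_bigr (fun y => bump y x * cocycle_fun c U V x)).
    by rewrite -mulr_suml -/(tot x) mulrAC divff ?mul1r// gt_eqF.
  move=> y _; have [xy|xy] := leP (r / 2) (mdist y x); first by rewrite bump0// !mul0r subr0.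
  have [cy sy] := uP y; have yx : u y x by apply: sy => /=; lra.
  by rewrite -mulrBr -(cocycle_cond cy cU cV)// addrAC subrr add0r.
have fc V : cocycle_cover c V -> {within V, continuous (f V)}.
  move=> cV; rewrite continuous_open_subspace; last exact: oc.1.
  move=> x; rewrite inE => Vx.
  apply: (@cvgM R); last by apply: cvgV; [rewrite gt_eqF|exact: ctot].
  apply: continuous_at_sum => y; rewrite /prop_for /continuous_at.
  have [cy sy] := uP y.
  have [xy|xy] := leP r (mdist y x).
    rewrite bump0 ?mul0r; last lra.
    apply: (@cvg_trans _ (cst 0 z @[z --> x])); last exact: cvg_cst.
    apply: near_eq_cvg; apply: filterS (nbhs_mdist x r20) => z xz.
    rewrite bump0 ?mul0r//.
    by have := metric_triangle y z x; rewrite (metric_sym z x); lra.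
  apply: (@cvgM R); first exact: cbump.
  have yx : u y x by exact: sy.
  apply: (@cvg_trans _ (cst (cocycle_fun c (u y) V x) z @[z --> x])); last exact: cvg_cst.
  apply: near_eq_cvg; near=> z.
  have : (u y `&` V) z -> cocycle_fun c (u y) V z = cocycle_fun c (u y) V x.
    by near: z; exact: cocycle_locally_constant.
  move=> E; apply: esym; apply: E; split; near: z.
    exact: open_cover_nbhs oc cy yx.
  exact: open_cover_nbhs oc cV Vx.
have fcompat U V : cocycle_cover c U -> cocycle_cover c V ->
    locally_constant (U `&` V) (fun x => f U x - f V x).
  move=> cU cV; rewrite setIC; apply: eq_locally_constant (cocycle_locally_constant cV cU).
  by move=> x; rewrite inE => -[Vx Ux]; rewrite -fE.
exists (ClosedOneForm oc fc fcompat).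
rewrite -[RHS]reprK form_classE pi_cech_eq.
exists (cocycle_cover c), id, id, (fun _ _ => 0); split => //.
- by move=> U cU; split.
- by move=> U cU; split.
- by move=> U cU; exact: locally_constant_cst.
- by move=> U V cU cV x Ux Vx; by rewrite /= /connecting_fun /= fE// !subrr.
Unshelve. all: by end_near. Qed.

End FormExists.

(** * Jumps and chains *)

Section Uniform.
Context {R : realType} {X : metricType R}.
Hypothesis compactX : compact [set: X].

Lemma uniform_path (lpcX : locally_path_connected R X) (r : R) : 0 < r ->
  exists2 e : R, 0 < e & forall y z : X, mdist y z < e -> exists p : cpath R X,
    [/\ p I0 = y, p I1 = z & forall s, mdist y (p s) < r].
Proof.
move=> r0; pose P (A : set X) := forall y z, A y -> A z -> exists p : cpath R X,
    [/\ p I0 = y, p I1 = z & forall s, mdist y (p s) < r].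
have [e e0 eP] : exists2 e : R, 0 < e & forall x, P [set y | mdist x y < e].
  apply: (lebesgue_number compactX (P := P)).
    by move=> A B AB PB y z /AB Ay /AB Az; exact: PB.
  move=> x; have r20 : 0 < r / 2 by rewrite divr_gt0.
  have [V [oV Vx Vsub Vp]] := lpcX x _ (nbhs_mdist x r20).
  exists V; first exact: open_nbhs_nbhs.
  move=> y z Vy Vz; have [p [p0 p1 pV]] := Vp y z Vy Vz; exists p; split => // s.
  have Vs : V (p s) by apply: pV; exists s.
  have := metric_triangle y x (p s); rewrite (metric_sym y x).
  by have := Vsub _ Vy; have := Vsub _ Vs; rewrite /=; lra.
by exists e => // y z yz; apply: (eP y) => //=; rewrite mdistxx.
Qed.

Lemma uniform_continuous_map {Y : metricType R} (f : X -> Y) (r : R) :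
  continuous f -> 0 < r ->
  exists2 e : R, 0 < e & forall x y, mdist x y < e -> mdist (f x) (f y) < r.
Proof.
move=> cf r0; pose P (A : set X) := forall y z, A y -> A z -> mdist (f y) (f z) < r.
have [e e0 eP] : exists2 e : R, 0 < e & forall x, P [set y | mdist x y < e].
  apply: (lebesgue_number compactX (P := P)).
    by move=> A B AB PB y z /AB Ay /AB Az; exact: PB.
  move=> x; have r20 : 0 < r / 2 by rewrite divr_gt0.
  exists (f @^-1` [set u | mdist (f x) u < r / 2]).
    by apply: cf; exact: nbhs_mdist.
  move=> y z /= xy xz.
  by have := metric_triangle (f y) (f x) (f z); rewrite (metric_sym (f y) (f x)); lra.
by exists e => // x y xy; apply: (eP x) => //=; rewrite mdistxx.
Qed.

End Uniform.

Lemma trajectory0 {R : realType} {X : topologicalType} (Phi : flow R X) x t :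
  trajectory Phi x t I0 = x.
Proof. by rewrite -[LHS]/(Phi (x, t * 0)) mulr0 flow0. Qed.

Lemma trajectory1 {R : realType} {X : topologicalType} (Phi : flow R X) x t :
  trajectory Phi x t I1 = Phi (x, t).
Proof. by rewrite -[LHS]/(Phi (x, t * 1)) mulr1. Qed.

Section Jump.
Context {R : realType} {X : metricType R}.
Hypothesis compactX : compact [set: X].
Hypothesis lpcX : locally_path_connected R X.
Variables (Phi : flow R X) (xi : cech_H1 X R) (eps delta0 : R).
Hypothesis scale_xi : is_scale xi eps delta0.
Variable w : closed_one_form R X.
Hypothesis wxi : form_class w = xi.

(* The integral of [w] along any path from [y] to [z] that stays close to [y]. *)
Definition jump (y z : X) : R := xget 0 [set v | exists p : cpath R X,
  [/\ p I0 = y, p I1 = z, forall s, mdist y (p s) < 2 * eps &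
      v = path_integral w p]].

Lemma eps_gt0 : 0 < eps. Proof. by case: scale_xi. Qed.

(** The class vanishes on the ball of radius [2 * eps] about the start, so the form has a primitive
    there and the end points determine the integral. *)
Lemma jumpE (p : cpath R X) : (forall s, mdist (p I0) (p s) < 2 * eps) ->
  path_integral w p = jump (p I0) (p I1).
Proof.
have [_ _ + _] := scale_xi; move=> /(_ (p I0)); rewrite -wxi.
move=> /cech_restrict_form[f fP] pB.
have in_ball (q : cpath R X) : (forall s, mdist (p I0) (q s) < 2 * eps) ->
    path_integral w q = f (q I1) - f (q I0).
  move=> qB; apply: path_integral_in fP _ => _ [s _ <-].
  by rewrite ballEmdist; exact: qB.
rewrite /jump; case: xgetP => [v _ /= [q [q0 q1 qB ->]]|/(_ (path_integral w p))].
  by rewrite !in_ball// q0 q1.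
by case; exists p.
Qed.

(** A path in some ball of radius [eps] stays within [2 * eps] of its start; hence the radius in
    [jump]. *)
Lemma jump_in_ball (p : cpath R X) : (exists q : X, range p `<=` ball q eps) ->
  path_integral w p = jump (p I0) (p I1).
Proof.
move=> [q pq]; apply: jumpE => s.
have h t : mdist q (p t) < eps.
  have : ball q eps (p t) by apply: pq; exists t.
  by rewrite ballEmdist.
by have := metric_triangle (p I0) q (p s); rewrite (metric_sym (p I0) q);
  have := h I0; have := h s; lra.
Qed.

Lemma jump_local (m : R) : 0 < m -> exists2 e : R, 0 < e & forall x : X,
  exists2 U, form_cover w U & forall y, mdist x y < e ->
    [/\ U y, `|form_fun w U y - form_fun w U x| < m & forall z, mdist x z < e ->
    jump y z = form_fun w U z - form_fun w U y].
Proof.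
move=> m0; have [r r0 rP] : exists2 r : R, 0 < r & forall x, exists2 U, form_cover w U &
    [set y | mdist x y < r] `<=` U /\ forall y z, mdist x y < r -> mdist x z < r ->
      `|form_fun w U y - form_fun w U z| < m.
  pose P (A : set X) := exists2 U, form_cover w U & A `<=` U /\
    forall y z, A y -> A z -> `|form_fun w U y - form_fun w U z| < m.
  apply: (lebesgue_number compactX (P := P)).
    move=> A B AB [U wU [BU osc]]; exists U => //; split; first by move=> x /AB/BU.
    by move=> y z /AB By /AB Bz; exact: osc.
  move=> x; have [U wU Ux] := form_cover_mem w x.
  exists (U `&` [set y | `|form_fun w U x - form_fun w U y| < m / 2]).
    apply: filterI; first exact: form_cover_nbhs wU Ux.
    have := form_fun_cvg wU Ux; move/(@cvgrPdist_lt R R^o); apply.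
    by rewrite divr_gt0.
  exists U => //; split; first by move=> y [].
  move=> y z [_ /= xy] [_ /= xz].
  have := ler_distD (form_fun w U x) (form_fun w U y) (form_fun w U z).
  by rewrite (distrC (form_fun w U y) (form_fun w U x)); lra.
(* A path within [r / 2] of a point [y] that is itself within [r / 2] of [x] stays in [U]; the bound
   [2 * eps] makes its integral equal to [jump]. *)
pose r' := Num.min (r / 2) (2 * eps).
have e0 := eps_gt0.
have r'0 : 0 < r' by rewrite lt_min; apply/andP; split; lra.
have [e1 e10 e1P] := uniform_path compactX lpcX r'0.
have r'r : r' <= r / 2 by rewrite ge_min lexx.
have r'e : r' <= 2 * eps by rewrite ge_min lexx orbT.
exists (Num.min (r / 2) (e1 / 2)); first by rewrite lt_min; apply/andP; split; lra.
move=> x; have [U wU [sub osc]] := rP x; exists U => // y.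
rewrite lt_min => /andP[xy xy1]; split.
- by apply: sub => /=; lra.
- by apply: osc; rewrite ?mdistxx//; lra.
move=> z; rewrite lt_min => /andP[xz xz1].
have [|p [p0 p1 pr]] := e1P y z.
  by have := metric_triangle y x z; rewrite (metric_sym y x); lra.
rewrite -p0 -p1 -jumpE; last by move=> s; rewrite p0; apply: lt_le_trans (pr s) _.
apply: (@path_integral_in _ _ w p U (form_fun w U)).
  by move=> V wV; exact: form_compat.
move=> _ [s _ <-]; apply: sub => /=.
by have := metric_triangle x y (p s); have := pr s; lra.
Qed.

Lemma jump_add : exists2 e : R, 0 < e & forall x y z : X,
  mdist x y < e -> mdist x z < e -> jump y z = jump x z - jump x y.
Proof.
have [e e0 eP] := jump_local ltr01; exists e => // x y z xy xz.
have [U wU UP] := eP x; have xx : mdist x x < e by rewrite mdistxx.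
have [_ _ ->//] := UP y xy; have [_ _ H] := UP x xx; rewrite !H//; lra.
Qed.

Lemma jump_small (m : R) : 0 < m -> exists2 e : R, 0 < e & forall x y : X,
  mdist x y < e -> `|jump x y| < m.
Proof.
move=> m0; have [e e0 eP] := jump_local m0; exists e => // x y xy.
have [U wU UP] := eP x; have xx : mdist x x < e by rewrite mdistxx.
by have [_ _ ->//] := UP x xx; have [] := UP y xy.
Qed.

(** A short path from [x] to [y] sweeps out a strip under the flow up to time [s]; lifting along
    this homotopy compares its four sides. *)
Lemma jump_flow (s : R) : exists2 e : R, 0 < e & forall x y : X, mdist x y < e ->
  flow_integral w Phi y s - flow_integral w Phi x s =
  jump (Phi (x, s)) (Phi (y, s)) - jump x y.
Proof.
have e0 : 0 < 2 * eps by rewrite mulr_gt0// eps_gt0.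
have [e1 e10 e1P] := uniform_continuous_map compactX (@continuous_time _ _ Phi s) e0.
have r0 : 0 < Num.min e1 (2 * eps) by rewrite lt_min e10.
have [e2 e20 e2P] := uniform_path compactX lpcX r0.
exists e2 => // x y /e2P[p [p0 p1 pr]].
have pr1 t : mdist x (p t) < e1 by have := pr t; rewrite lt_min => /andP[].
have pr2 t : mdist x (p t) < 2 * eps by have := pr t; rewrite lt_min => /andP[].
have cq : continuous (fun t => Phi (p t, s)).
  move=> t; apply: (@continuous_comp _ _ _ p (fun x => Phi (x, s))).
    exact: cts_fun.
  exact: continuous_time.
pose q : cpath R X := mkcts cq.
have [g gP] := exists_primitive_path w p.
have := jumpE (p := p); rewrite p0 p1 => <-; last exact: pr2.
have q0 : q I0 = Phi (x, s) by rewrite -p0.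
have q1 : q I1 = Phi (y, s) by rewrite -p1.
have := jumpE (p := q); rewrite q0 q1 => <-; last by move=> t; apply: e1P; exact: pr1.
rewrite (path_integralE gP).
rewrite (path_integralE (g := fun t => g t + flow_integral w Phi (p t) s)).
  by rewrite p0 p1; lra.
by move=> t; apply: flow_integral_lift_time => //; exact: cts_fun.
Qed.

Definition chain_value (N : nat) (x : nat -> X) (t : nat -> R) : R :=
  \sum_(i < N) (flow_integral w Phi (x i) (t i) + jump (Phi (x i, t i)) (x i.+1)).

Lemma pairing_associated N x t z : associated Phi eps N x t z ->
  pairing xi z = chain_value N x t.
Proof.
move=> [sigma [sigmaP [c [cz cE]]]].
rewrite (pairingE wxi cz) chain_integralE cE raddf_sum.
apply: eq_bigr => i _; rewrite raddfD /= !freeg_sumU.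
have [s0 s1 sb] := sigmaP i (ltn_ord i).
by rewrite /flow_integral (jump_in_ball sb) s0 s1.
Qed.

(** A condition on all associated classes would be vacuous if there were none; gaps below [delta0]
    can be closed by paths, and the resulting chain is a cycle. *)
Lemma associated_exists N x t : (forall i, (i < N)%N ->
    mdist (Phi (x i, t i)) (x i.+1) < delta0) -> x 0%N = x N ->
  exists z, associated Phi eps N x t z.
Proof.
move=> xt x0N; have [_ _ _ sc] := scale_xi.
have /choice[sigma sigmaP] : forall i : nat, exists p : cpath R X, (i < N)%N ->
    [/\ p I0 = Phi (x i, t i), p I1 = x i.+1 & exists q : X, range p `<=` ball q eps].
  move=> i; have [iN|] := boolP (i < N)%N.
    by have [p [p0 p1 pq]] := sc _ _ (xt i iN); exists p.
  by move=> _; exists (trajectory Phi (x i) (t i)).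
pose c : chain1 R X := \sum_(i < N) (<< trajectory Phi (x i) (t i) >> + << sigma i >>).
have bc : boundary1 c == 0.
  pose f : {additive {freeg (cpath R X) / int} -> {freeg X / int}} :=
    HB.pack_for {additive {freeg (cpath R X) / int} -> {freeg X / int}} (@boundary1 R X)
    (GRing.isZmodMorphism.Build {freeg (cpath R X) / int} {freeg X / int} (@boundary1 R X)
       (lift_is_additive _)).
  rewrite -[boundary1 c]/(f c) /c raddf_sum.
  rewrite (eq_bigr (fun i : 'I_N => << x i.+1 >> - << x i >>)).
    rewrite -(big_mkord xpredT (fun i => << x i.+1 >> - << x i >> : {freeg X / int})).
    by rewrite telescope_sumr// x0N subrr.
  move=> i _; rewrite raddfD /= /boundary1 !liftU !scale1r.
  have [-> -> _] := sigmaP i (ltn_ord i).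
  rewrite trajectory0 trajectory1 addrC addrA.
  by rewrite subrK.
exists (\pi_(singular_H1 R X) (exist (fun c => boundary1 c == 0) c bc)), sigma; split => //.
by exists (exist (fun c => boundary1 c == 0) c bc).
Qed.

End Jump.

(** * Chains with values and the closed invariant set [R_xi] *)

Section ValuedChains.
Context {R : realType} {X : metricType R}.
Hypothesis compactX : compact [set: X].
Hypothesis lpcX : locally_path_connected R X.
Variables (Phi : flow R X) (xi : cech_H1 X R) (eps delta0 : R).
Hypothesis scale_xi : is_scale xi eps delta0.
Variable w : closed_one_form R X.
Hypothesis wxi : form_class w = xi.

Local Notation tau := (flow_integral w Phi).
Local Notation jmp := (jump eps w).

(* [vchain dl T x y v]: there is a (dl, T)-chain from [x] to [y] along which
   the integral of [w], gaps included, is [v]. *)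
Inductive vchain (dl T : R) : X -> X -> R -> Prop :=
| vchain1 x t y : T <= t -> mdist (Phi (x, t)) y < dl ->
    vchain dl T x y (tau x t + jmp (Phi (x, t)) y)
| vchainS x t y z v : T <= t -> mdist (Phi (x, t)) y < dl -> vchain dl T y z v ->
    vchain dl T x z (tau x t + jmp (Phi (x, t)) y + v).

Lemma vchainP dl T x y v : vchain dl T x y v <->
  exists N xs ts, [/\ is_chain Phi dl T N xs ts, xs 0%N = x, xs N = y &
    v = chain_value Phi eps w N xs ts].
Proof.
split.
- elim=> {x y v} [x t y Tt xy|x t y z v Tt xy _ [N [xs [ts [[N0 H] x0 xN ->]]]]].
    exists 1%N, (fun i => if i is 0%N then x else y), (fun=> t); split => //.
      by split => // -[].
    by rewrite /chain_value big_ord1.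
  exists N.+1, (fun i => if i is j.+1 then xs j else x), (fun i => if i is j.+1 then ts j else t).
  split => //.
    by split => // -[_|i]; [rewrite x0|rewrite ltnS => /H].
  by rewrite /chain_value big_ord_recl /= x0.
- move=> [N [xs [ts [[N0 H] <- <- ->]]]] {x y v}.
  elim: N N0 xs ts H => // -[_ _|N IH _] xs ts H.
    have [? ?] := H 0%N isT.
    by rewrite /chain_value big_ord1; exact: vchain1.
  rewrite /chain_value big_ord_recl; have [? ?] := H 0%N isT.
  apply: vchainS => //.
  by apply: (IH isT (fun i => xs i.+1) (fun i => ts i.+1)) => i iN; exact: H.
Qed.

Lemma vchain_weaken dl dl' T T' x y v : dl <= dl' -> T' <= T ->
  vchain dl T x y v -> vchain dl' T' x y v.
Proof.
move=> dd TT; elim=> {x y v} [x t y Tt xy|x t y z v Tt xy _ IH].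
  by apply: vchain1; [exact: le_trans Tt|exact: lt_le_trans dd].
by apply: vchainS => //; [exact: le_trans Tt|exact: lt_le_trans dd].
Qed.

Lemma vchain_start_shift dl T s x y v : vchain dl (T + `|s|) x y v ->
  vchain dl T (Phi (x, s)) y (v - tau x s).
Proof.
have ss := ler_norm s.
have P x' t : Phi (x', t) = Phi (Phi (x', s), t - s) by rewrite flowD addrC subrK.
have I x' t : tau x' t - tau x' s = tau (Phi (x', s)) (t - s).
  by have := flow_integralD w Phi x' s (t - s); rewrite addrC subrK; lra.
have n0 := normr_ge0 s.
case=> {x y v} [x t y Tt xy|x t y z v Tt xy C].
  rewrite addrAC I (P x t); apply: vchain1; first lra.
  by rewrite -P.
rewrite addrAC [X in X + v]addrAC I (P x t); apply: (vchainS (y := y)); first lra.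
  by rewrite -P.
by apply: vchain_weaken C => //; lra.
Qed.

Lemma vchain_end_move dl : 0 < dl -> exists2 e : R, 0 < e & forall T x y y' v,
  vchain e T x y v -> mdist y y' < e -> vchain dl T x y' (v + jmp y y').
Proof.
move=> dl0; have [e e0 eP] := jump_add compactX lpcX scale_xi wxi.
pose e' := Num.min (e / 2) (dl / 2).
have e'e : e' <= e / 2 by rewrite ge_min lexx.
have e'd : e' <= dl / 2 by rewrite ge_min lexx orbT.
exists e'; first by rewrite lt_min; apply/andP; split; lra.
move=> T x y y' v; elim=> {x y v} [x t y Tt xy|x t y z v Tt xy _ IH] yy'.
  have xy' := metric_triangle (Phi (x, t)) y y'.
  have -> : tau x t + jmp (Phi (x, t)) y + jmp y y' = tau x t + jmp (Phi (x, t)) y'.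
    by rewrite (eP (Phi (x, t)) y y'); lra.
  by apply: vchain1 => //; lra.
by rewrite -addrA; apply: (vchainS (y := y)); [|lra|exact: IH].
Qed.

Lemma vchain_end_shift dl s : 0 < dl -> exists2 e : R, 0 < e & forall T x y v,
  vchain e (T + `|s|) x y v -> vchain dl T x (Phi (y, s)) (v + tau y s).
Proof.
move=> dl0; have [e1 e10 e1P] := jump_flow compactX lpcX Phi scale_xi wxi s.
have [e2 e20 e2P] := uniform_continuous_map compactX (@continuous_time _ _ Phi s) dl0.
pose e := Num.min e1 (Num.min e2 dl).
have ee1 : e <= e1 by rewrite ge_min lexx.
have ee2 : e <= e2 by rewrite ge_min ge_min lexx orbT.
have edl : e <= dl by rewrite ge_min ge_min lexx !orbT.
exists e; first by rewrite !lt_min e10 e20.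
have n0 := normr_ge0 s; have n1 := lerNnormlW (lexx `|s|).
move=> T x y v; elim=> {x y v} [x t y Tt xy|x t y z v Tt xy _ IH].
  have E := e1P _ _ (lt_le_trans xy ee1).
  have -> : tau x t + jmp (Phi (x, t)) y + tau y s =
      tau x (t + s) + jmp (Phi (x, t + s)) (Phi (y, s)).
    by rewrite flow_integralD -flowD; lra.
  apply: vchain1; first lra.
  by rewrite -flowD; apply: e2P; exact: lt_le_trans ee2.
by rewrite -addrA; apply: (vchainS (y := y)) => //; [lra|exact: lt_le_trans edl].
Qed.

(** The first step may last arbitrarily long, so moving its start is not controlled directly. The
    new start flows for time [T], jumps to the trajectory of [x] and follows the rest of the first
    step, which still lasts at least [T]. *)
Lemma vchain_start_move dl T : 0 < dl -> 0 <= T -> exists2 e : R, 0 < e & forall x x' y v,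
  vchain e (T + T) x y v -> mdist x' x < e -> vchain dl T x' y (v + jmp x' x).
Proof.
move=> dl0 T0; have [e1 e10 e1P] := jump_flow compactX lpcX Phi scale_xi wxi T.
have [e2 e20 e2P] := uniform_continuous_map compactX (@continuous_time _ _ Phi T) dl0.
pose e := Num.min e1 (Num.min e2 dl).
have ee1 : e <= e1 by rewrite ge_min lexx.
have ee2 : e <= e2 by rewrite ge_min ge_min lexx orbT.
have edl : e <= dl by rewrite ge_min ge_min lexx !orbT.
exists e; first by rewrite !lt_min e10 e20.
move=> x x' y v C xx'.
have E := e1P _ _ (lt_le_trans xx' ee1).
have -> : v + jmp x' x = tau x' T + jmp (Phi (x', T)) (Phi (x, T)) + (v - tau x T) by lra.
apply: vchainS => //; first by apply: e2P; exact: lt_le_trans ee2.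
by apply: vchain_weaken edl (lexx _) _; apply: vchain_start_shift; rewrite ger0_norm.
Qed.

Lemma jumpC : exists2 e : R, 0 < e & forall x y, mdist x y < e -> jmp y x = - jmp x y.
Proof.
have [e e0 eP] := jump_add compactX lpcX scale_xi wxi; exists e => // x y xy.
have xx : mdist x x < e by rewrite mdistxx.
by have := eP x x x xx xx; have := eP x y x xy xx; lra.
Qed.

(** The corrections [jmp y x] and [jmp x y] at the two ends cancel, so the value is kept exactly.
    This makes [R_xi] closed. *)
Lemma vchain_closed_move dl T : 0 < dl -> 0 <= T -> exists2 e : R, 0 < e & forall x y v,
  vchain e (T + T) x x v -> mdist x y < e -> vchain dl T y y v.
Proof.
move=> dl0 T0; have [e1 e10 e1P] := vchain_end_move dl0.
have [e2 e20 e2P] := vchain_start_move e10 T0; have [e3 e30 e3P] := jumpC.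
pose e := Num.min e1 (Num.min e2 e3).
have ee1 : e <= e1 by rewrite ge_min lexx.
have ee2 : e <= e2 by rewrite ge_min ge_min lexx orbT.
have ee3 : e <= e3 by rewrite ge_min ge_min lexx !orbT.
exists e; first by rewrite !lt_min e10 e20.
move=> x y v C xy.
have -> : v = v + jmp y x + jmp x y by rewrite (e3P x y); [lra|exact: lt_le_trans ee3].
apply: e1P; last exact: lt_le_trans ee1.
apply: e2P; last by rewrite metric_sym; exact: lt_le_trans ee2.
by apply: vchain_weaken C.
Qed.

Lemma vchain_closed_shift dl s : 0 < dl -> exists2 e : R, 0 < e & forall T x v,
  vchain e (T + `|s| + `|s|) x x v -> vchain dl T (Phi (x, s)) (Phi (x, s)) v.
Proof.
move=> dl0; have [e e0 eP] := vchain_end_shift s dl0; exists e => // T x v C.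
have -> : v = v - tau x s + tau x s by rewrite subrK.
by apply: eP; exact: vchain_start_shift.
Qed.

Local Notation CR := (chain_recurrent Phi).
Local Notation Rxi := (R_xi Phi xi eps delta0).

Lemma chain_recurrentP p : CR p <->
  forall dl T, 0 < dl -> 1 <= T -> exists v, vchain dl T p p v.
Proof.
split=> H dl T dl0 T1; have := H dl T dl0 T1.
  move=> [N [x [t [xt x0 xN]]]]; exists (chain_value Phi eps w N x t).
  by apply/vchainP; exists N, x, t.
by move=> [v /vchainP[N [x [t [xt x0 xN _]]]]]; exists N, x, t.
Qed.

(** With pairings replaced by chain values, [delta0] no longer limits the gaps and membership can be
    tested by perturbing chains. *)
Lemma R_xiP p : Rxi p <-> forall dl T, 0 < dl -> 1 <= T -> vchain dl T p p 0.
Proof.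
have d0 : 0 < delta0 by case: scale_xi.
split=> [H dl T dl0 T1|H dl T /andP[dl0 dld] T1].
  (* [delta0 / 2] keeps the gap bound strictly below [delta0], and [T + 1] turns [1 <= T] into the
     required strict bound. *)
  pose dl' := Num.min dl (delta0 / 2).
  have dl'd : dl' <= delta0 / 2 by rewrite ge_min lexx orbT.
  have dl'dl : dl' <= dl by rewrite ge_min lexx.
  have [||N [x [t [xt x0 xN xiP]]]] := H dl' (T + 1).
  - by rewrite lt_min dl0 /=; apply/andP; split; lra.
  - lra.
  apply: (@vchain_weaken dl' _ (T + 1)) => //; first lra.
  apply/vchainP; exists N, x, t; split => //.
  have [|z zP] := @associated_exists _ _ Phi _ _ _ scale_xi N x t _ (etrans x0 (esym xN)).
    by move=> i iN; have [_] := xt.2 i iN; lra.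
  by rewrite -(pairing_associated scale_xi wxi zP) xiP.
have /vchainP[N [x [t [xt x0 xN v0]]]] := H dl T dl0 (ltW T1).
exists N, x, t; split => // z zP.
by rewrite (pairing_associated scale_xi wxi zP) -v0.
Qed.

Lemma R_xi_sub : Rxi `<=` CR.
Proof.
move=> p /R_xiP H; apply/chain_recurrentP => dl T dl0 T1.
by exists 0; exact: H.
Qed.

Lemma R_xi_flow p s : Rxi p -> Rxi (Phi (p, s)).
Proof.
move=> /R_xiP H; apply/R_xiP => dl T dl0 T1.
have [e e0 eP] := vchain_closed_shift s dl0; apply: eP; apply: H => //.
by have := normr_ge0 s; lra.
Qed.

Lemma chain_recurrent_flow p s : CR p -> CR (Phi (p, s)).
Proof.
move=> /chain_recurrentP H; apply/chain_recurrentP => dl T dl0 T1.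
have [e e0 eP] := vchain_closed_shift s dl0.
have [|v vP] := H e (T + `|s| + `|s|) e0; first by have := normr_ge0 s; lra.
by exists v; exact: eP.
Qed.

Lemma flowN p s : Phi (Phi (p, s), - s) = p.
Proof. by rewrite flowD subrr flow0. Qed.

Lemma C_xi_flow p s : C_xi Phi xi eps delta0 p -> C_xi Phi xi eps delta0 (Phi (p, s)).
Proof.
move=> [Rp nRp]; split; first exact: chain_recurrent_flow.
by move=> /(R_xi_flow (- s)); rewrite flowN.
Qed.

Lemma closure_mdist (A : set X) p e : 0 < e -> closure A p -> exists2 q, A q & mdist p q < e.
Proof. by move=> e0 /(_ _ (nbhs_mdist p e0))[q [Aq pq]]; exists q. Qed.

Lemma chain_recurrent_closed : closed CR.
Proof.
move=> p clp; apply/chain_recurrentP => dl T dl0 T1.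
have [|e e0 eP] := @vchain_closed_move dl T dl0; first lra.
have [q /chain_recurrentP Rq pq] := closure_mdist e0 clp.
have [|v vP] := Rq e (T + T) e0; first lra.
by exists v; apply: eP vP _; rewrite metric_sym.
Qed.

Lemma R_xi_closed : closed Rxi.
Proof.
move=> p clp; apply/R_xiP => dl T dl0 T1.
have [|e e0 eP] := @vchain_closed_move dl T dl0; first lra.
have [q /R_xiP Rq pq] := closure_mdist e0 clp.
by apply: (eP q); [apply: Rq => //; lra|rewrite metric_sym].
Qed.

End ValuedChains.

(** * Conley functions *)

Section DyadicSum.
Context {R : realType} {X : topologicalType}.
Variable u : nat -> X -> R.
Hypothesis u01 : forall n x, 0 <= u n x <= 1.

Let part n x := \sum_(i < n) u i x / 2 ^+ i.+1.

(** The terms are nonnegative, so the series is the supremum of its partial sums. *)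
Definition dyadic_sum (x : X) : R := sup (range (part ^~ x)).

Let partS n x : part n.+1 x = part n x + u n x / 2 ^+ n.+1.
Proof. by rewrite /part big_ord_recr. Qed.

Let term_ge0 n x : 0 <= u n x / 2 ^+ n.+1.
Proof. by have /andP[u0 _] := u01 n x; rewrite divr_ge0// exprn_ge0. Qed.

Let part_mono m n x : (m <= n)%N -> part m x <= part n x.
Proof.
move=> /subnK <-; elim: (n - m)%N => // k IH.
by rewrite addSn partS; apply: (le_trans IH); rewrite lerDl; exact: term_ge0.
Qed.

Let part_tail m n x : part n x <= part m x + (2 ^+ m)^-1.
Proof.
have pow0 k : 0 < (2 ^+ k)^-1 :> R by rewrite invr_gt0 exprn_gt0.
have [nm|mn] := leqP n m.
  by apply: (le_trans (part_mono x nm)); rewrite lerDl; exact: ltW.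
(* Adding the bound [2 ^- n] of the remainder makes the partial sums nonincreasing in [n]. *)
suff : part n x + (2 ^+ n)^-1 <= part m x + (2 ^+ m)^-1 by have := pow0 n; lra.
rewrite -(subnK (ltnW mn)); elim: (n - m)%N => // k IH.
rewrite addSn partS; apply: le_trans IH.
have /andP[_ u1] := u01 (k + m) x; have p0 := pow0 (k + m).+1.
have -> : (2 ^+ (k + m))^-1 = (2 ^+ (k + m).+1)^-1 + (2 ^+ (k + m).+1)^-1 :> R.
  by rewrite exprS invfM; lra.
have : u (k + m) x / 2 ^+ (k + m).+1 <= (2 ^+ (k + m).+1)^-1.
  by rewrite ler_piMl// ltW.
lra.
Qed.

Let has_sup_part x : has_sup (range (part ^~ x)).
Proof.
split; first by exists (part 0 x); exists 0%N.
by exists (part 0 x + (2 ^+ 0)^-1) => _ [n _ <-]; exact: part_tail.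
Qed.

Let part_le n x : part n x <= dyadic_sum x.
Proof. by apply: ub_le_sup; [case: (has_sup_part x)|exists n]. Qed.

Let sum_le x M : (forall n, part n x <= M) -> dyadic_sum x <= M.
Proof.
move=> H; apply: ge_sup; first by case: (has_sup_part x).
by move=> _ [n _ <-].
Qed.

Lemma le_dyadic_sum x y : (forall n, u n x <= u n y) -> dyadic_sum x <= dyadic_sum y.
Proof.
move=> uxy; apply: sum_le => n; apply: le_trans (part_le n y).
by apply: ler_sum => i _; rewrite ler_pM2r ?invr_gt0 ?exprn_gt0.
Qed.

Lemma lt_dyadic_sum x y : (forall n, u n x <= u n y) -> (exists n, u n x < u n y) ->
  dyadic_sum x < dyadic_sum y.
Proof.
move=> uxy [k uk].
have mono n : part n x <= part n y.
  by apply: ler_sum => i _; rewrite ler_pM2r ?invr_gt0 ?exprn_gt0.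
pose c := (u k y - u k x) / 2 ^+ k.+1.
have c0 : 0 < c by rewrite divr_gt0 ?subr_gt0 ?exprn_gt0.
(* A strict inequality can be lost in a supremum; the gap [c] of the term [k] stays in all later
   partial sums. *)
have gap d : part (d + k.+1) x + c <= part (d + k.+1) y.
  elim: d => [|d IH]; first by rewrite add0n !partS /c mulrBl; have := mono k; lra.
  rewrite addSn !partS; have : u (d + k.+1) x / 2 ^+ (d + k.+1).+1 <=
    u (d + k.+1) y / 2 ^+ (d + k.+1).+1 by rewrite ler_pM2r ?invr_gt0 ?exprn_gt0.
  lra.
suff : dyadic_sum x <= dyadic_sum y - c by lra.
apply: sum_le => n.
have := part_mono x (leq_addr k.+1 n); have := gap n; have := part_le (n + k.+1) y; lra.
Qed.

Lemma dyadic_sum_continuous : (forall n, continuous (u n)) -> continuous dyadic_sum.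
Proof.
move=> cu x; apply/(@cvgrPdist_lt R R^o) => e e0.
have [m me] : exists m, (2 ^+ m)^-1 < e / 2 :> R.
  exists (Num.truncn (e / 2)^-1).+1.
  rewrite -[ltRHS]invrK ltf_pV2 ?posrE ?invr_gt0 ?exprn_gt0//; last by rewrite divr_gt0.
  apply: lt_le_trans (truncnS_gt _) _.
  by rewrite -natrX ler_nat ltnW// ltn_expl.
have cp : {for x, continuous (part m)}.
  apply: continuous_at_sum => i; apply: (@cvgM R); [exact: cu|exact: cvg_cst].
have e20 : 0 < e / 2 by rewrite divr_gt0.
move: cp => /(@cvgrPdist_lt R R^o) /(_ _ e20); apply: filterS => y.
rewrite !ltr_distlC => /andP[y1 y2].
have tl z : part m z <= dyadic_sum z <= part m z + (2 ^+ m)^-1.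
  by rewrite part_le /=; apply: sum_le => n; exact: part_tail.
by have /andP[? ?] := tl x; have /andP[? ?] := tl y; apply/andP; split; lra.
Qed.

End DyadicSum.

Section ChainCost.
Context {R : realType} {X : metricType R}.
Hypothesis compactX : compact [set: X].
Variable Phi : flow R X.
Local Notation CR := (chain_recurrent Phi).

Inductive dchain (dl T : R) : X -> X -> Prop :=
| dchain1 x t y : T <= t -> mdist (Phi (x, t)) y < dl -> dchain dl T x y
| dchainS x t y z : T <= t -> mdist (Phi (x, t)) y < dl -> dchain dl T y z ->
    dchain dl T x z.

Lemma dchainP dl T x y : dchain dl T x y <->
  exists N xs ts, [/\ is_chain Phi dl T N xs ts, xs 0%N = x & xs N = y].
Proof.
split.
- elim=> {x y} [x t y Tt xy|x t y z Tt xy _ [N [xs [ts [[N0 H] x0 xN]]]]].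
    by exists 1%N, (fun i => if i is 0%N then x else y), (fun=> t); split => //; split => // -[].
  exists N.+1, (fun i => if i is j.+1 then xs j else x), (fun i => if i is j.+1 then ts j else t).
  split => //.
  by split => // -[_|i]; [rewrite x0|rewrite ltnS => /H].
- move=> [N [xs [ts [[N0 H] <- <-]]]] {x y}.
  elim: N N0 xs ts H => // -[_ _|N IH _] xs ts H; have [? ?] := H 0%N isT.
    exact: (dchain1 (t := ts 0%N)).
  apply: (dchainS (t := ts 0%N) (y := xs 1%N)) => //.
  by apply: (IH isT (fun i => xs i.+1) (fun i => ts i.+1)) => i iN; exact: H.
Qed.

Lemma dchain_weaken dl dl' T T' x y : dl <= dl' -> T' <= T ->
  dchain dl T x y -> dchain dl' T' x y.
Proof.
move=> dd TT; elim=> {x y} [x t y Tt xy|x t y z Tt xy _ IH].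
  by apply: (dchain1 (t := t)); [exact: le_trans Tt|exact: lt_le_trans dd].
by apply: (dchainS (t := t) (y := y)) => //; [exact: le_trans Tt|exact: lt_le_trans dd].
Qed.

Lemma dchain_trans dl T x y z : dchain dl T x y -> dchain dl T y z -> dchain dl T x z.
Proof.
move=> C D; elim: C D => {x y} [x t y Tt xy|x t y y' Tt xy _ IH] D.
  exact: dchainS xy D.
by apply: dchainS xy _ => //; exact: IH.
Qed.

Lemma dchain_end dl T x y y' : dchain dl T x y -> dchain (dl + mdist y y') T x y'.
Proof.
elim=> {x y} [x t y Tt xy|x t y z Tt xy _ IH].
  apply: (dchain1 (t := t)) => //.
  by have := metric_triangle (Phi (x, t)) y y'; lra.
apply: (dchainS (t := t) (y := y)) => //.
by have := mdist_ge0 z y'; lra.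
Qed.

Lemma diameter_bound : exists2 D : R, 0 < D & forall x y : X, mdist x y < D.
Proof.
have [[x0 _]|ne] := pselect (exists x : X, True); last first.
  by exists 1 => // x; case: ne; exists x.
have [M MP] := compact_bounded_above compactX (mdist_continuous (y := x0)).
have M0 := le_trans (mdist_ge0 x0 x0) (MP x0).
exists (M + M + 1); first lra.
move=> x y; have := metric_triangle x x0 y; rewrite (metric_sym x x0).
by have := MP x; have := MP y; lra.
Qed.

(* The smallest possible size of the largest gap of a chain from [x] to [y]. *)
Definition chain_cost (T : R) (x y : X) : R :=
  inf [set dl | 0 < dl /\ dchain dl T x y].

Lemma chain_cost_has_inf T x y : has_inf [set dl : R | 0 < dl /\ dchain dl T x y].
Proof.
split; last by exists 0 => e [/ltW].
have [D D0 DP] := diameter_bound; exists D; split => //.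
exact: (dchain1 (t := T)).
Qed.

Lemma chain_cost_ge0 T x y : 0 <= chain_cost T x y.
Proof.
by apply: lb_le_inf; [case: (chain_cost_has_inf T x y)|move=> e [/ltW]].
Qed.

Lemma chain_cost_le dl T x y : 0 < dl -> dchain dl T x y -> chain_cost T x y <= dl.
Proof. by move=> dl0 C; apply: ge_inf => //; case: (chain_cost_has_inf T x y). Qed.

Lemma chain_cost_lt dl T x y : chain_cost T x y < dl -> dchain dl T x y.
Proof.
move=> H; have e0 : 0 < dl - chain_cost T x y by rewrite subr_gt0.
have [e [e0' C] elt] := inf_adherent e0 (chain_cost_has_inf T x y).
by apply: dchain_weaken C => //; move: elt; rewrite -/(chain_cost T x y); lra.
Qed.

Lemma chain_cost_lip T x y y' : chain_cost T x y' <= chain_cost T x y + mdist y y'.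
Proof.
apply/ler_addgt0Pr => e e0.
have d0 := mdist_ge0 y y'; have c0 := chain_cost_ge0 T x y.
have -> : chain_cost T x y + mdist y y' + e = chain_cost T x y + e + mdist y y' by lra.
apply: chain_cost_le; first lra.
by apply: dchain_end; apply: chain_cost_lt; lra.
Qed.

(** Concatenating chains gives an ultrametric inequality. *)
Lemma chain_cost_max T x y z :
  chain_cost T x z <= Num.max (chain_cost T x y) (chain_cost T y z).
Proof.
set m := Num.max _ _; apply/ler_addgt0Pr => e e0.
have xm : chain_cost T x y <= m by rewrite le_max lexx.
have ym : chain_cost T y z <= m by rewrite le_max lexx orbT.
apply: chain_cost_le; first by have := chain_cost_ge0 T x y; lra.
by apply: (dchain_trans (y := y)); apply: chain_cost_lt; lra.
Qed.

Lemma chain_cost_one T x y : chain_cost T x y <= mdist (Phi (x, T)) y.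
Proof.
apply/ler_addgt0Pr => e e0; have d0 := mdist_ge0 (Phi (x, T)) y.
by apply: chain_cost_le; [lra|apply: (dchain1 (t := T)) => //; lra].
Qed.

(** Following the flow for time [T] is a step without gap. *)
Lemma chain_cost_flow T x y : chain_cost T x (Phi (y, T)) <= chain_cost T x y.
Proof.
apply: (le_trans (chain_cost_max T x y (Phi (y, T)))).
rewrite ge_max lexx /=; apply: (le_trans (chain_cost_one _ _ _)).
by rewrite mdistxx chain_cost_ge0.
Qed.

Lemma chain_cost_continuous T x : continuous (chain_cost T x).
Proof.
move=> y; apply/(@cvgrPdist_lt R R^o) => e e0.
apply: filterS (nbhs_mdist y e0) => z yz.
have := chain_cost_lip T x y z; have := chain_cost_lip T x z y.
by rewrite (metric_sym z y) ltr_distlC => ? ?; apply/andP; split; lra.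
Qed.

Lemma chain_cost_recurrent T x : 1 <= T -> CR x -> chain_cost T x x = 0.
Proof.
move=> T1 Rx; apply/eqP; rewrite eq_le chain_cost_ge0 andbT.
apply/ler_addgt0Pr => e e0; rewrite add0r; apply: chain_cost_le => //.
exact/dchainP/Rx.
Qed.

(** The points of [A] of cost below [e] are open and closed in [A]: passing from a recurrent point
    [z] to a point within [e] costs less than [e], and costs combine by maximum. *)
Lemma chain_cost_connected T (A : set X) x y : 1 <= T -> connected A -> A `<=` CR ->
  A x -> A y -> chain_cost T x y = 0.
Proof.
move=> T1 cA AR Ax Ay; apply/eqP; rewrite eq_le chain_cost_ge0 andbT.
apply/ler_addgt0Pr => e e0; rewrite add0r; apply: ltW.
have step z z' : A z -> mdist z z' < e -> chain_cost T x z < e -> chain_cost T x z' < e.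
  move=> Az zz' xz; apply: le_lt_trans (chain_cost_max T x z z') _.
  rewrite gt_max xz /=; apply: le_lt_trans (chain_cost_lip T z z z') _.
  by rewrite chain_cost_recurrent ?add0r//; exact: AR.
have := @connected_locally_constant X Prop A (fun z => chain_cost T x z < e : Prop) cA _ x y Ax Ay.
move=> <-; first by rewrite chain_cost_recurrent//; exact: AR.
move=> z Az; apply: filterS (nbhs_mdist z e0) => z' zz' Az'.
by apply/propext; split; apply: step => //; rewrite metric_sym.
Qed.

Lemma dchain_start_shift dl T T' x y : 0 <= T -> dchain dl (T' + T) x y ->
  dchain dl T' (Phi (x, T)) y.
Proof.
have P z t : Phi (Phi (z, T), t - T) = Phi (z, t) by rewrite flowD addrC subrK.
move=> T0; case=> {x y} [x t y Tt xy|x t y z Tt xy C].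
  by apply: (dchain1 (t := t - T)); [lra|rewrite P].
apply: (dchainS (t := t - T) (y := y)); [lra|by rewrite P|].
by apply: dchain_weaken C => //; lra.
Qed.

Lemma dchain_start_move dl T x x' y : 0 <= T -> mdist (Phi (x', T)) (Phi (x, T)) < dl ->
  dchain dl (T + T) x y -> dchain dl T x' y.
Proof.
move=> T0 xx' C; apply: (dchainS (t := T) (y := Phi (x, T))) => //.
exact: dchain_start_shift.
Qed.

End ChainCost.

Section Conley.
Context {R : realType} {X : metricType R}.
Hypothesis compactX : compact [set: X].
Variable Phi : flow R X.
Local Notation CR := (chain_recurrent Phi).
Hypothesis CR_flow : forall p s, CR p -> CR (Phi (p, s)).
Local Notation cost := (chain_cost Phi).
Variable T0 : R.
Hypothesis T01 : 1 <= T0.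

(* Summing over [m] consecutive steps turns the decrease of the cost along
   steps of length [m * T0] into a decrease along steps of length [T0]. *)
Definition step_cost (m : nat) (a x : X) : R :=
  \sum_(j < m) cost (m%:R * T0) a (Phi (x, j%:R * T0)).

Lemma step_cost_step m a x : step_cost m a (Phi (x, T0)) - step_cost m a x =
  cost (m%:R * T0) a (Phi (x, m%:R * T0)) - cost (m%:R * T0) a x.
Proof.
rewrite /step_cost -sumrB.
rewrite (eq_bigr (fun j : 'I_m => cost (m%:R * T0) a (Phi (x, j.+1%:R * T0)) -
  cost (m%:R * T0) a (Phi (x, j%:R * T0)))).
  rewrite -(big_mkord xpredT (fun j => cost (m%:R * T0) a (Phi (x, j.+1%:R * T0)) -
    cost (m%:R * T0) a (Phi (x, j%:R * T0)))).
  by rewrite (telescope_sumr (fun j => cost (m%:R * T0) a (Phi (x, j%:R * T0))))// mul0r flow0.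
move=> j _; rewrite flowD; suff -> : j.+1%:R * T0 = T0 + j%:R * T0 by [].
by rewrite -natr1 mulrDl mul1r addrC.
Qed.

Lemma step_cost_le m a x : step_cost m a (Phi (x, T0)) <= step_cost m a x.
Proof.
by rewrite -subr_le0 step_cost_step subr_le0; exact: chain_cost_flow.
Qed.

Lemma step_cost_continuous m a : continuous (step_cost m a).
Proof.
move=> x; apply: continuous_at_sum => j.
apply: (@continuous_comp _ _ _ (fun x => Phi (x, j%:R * T0))).
  exact: continuous_time.
exact: chain_cost_continuous.
Qed.

Lemma step_cost_connected m a (A : set X) x y : connected A -> A `<=` CR ->
  A x -> A y -> step_cost m a x = step_cost m a y.
Proof.
move=> cA AR Ax Ay; rewrite /step_cost; apply: eq_bigr => j _.
have m1 : 1 <= m%:R * T0.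
  have : 1 <= m%:R :> R by rewrite ler1n; apply: leq_ltn_trans (ltn_ord j).
  by move: T01 (m%:R : R) => T01' M M1; nra.
set B := (fun x => Phi (x, j%:R * T0)) @` A.
have cB : connected B.
  apply: connected_continuous_connected cA _.
  by apply: continuous_subspaceT; exact: continuous_time.
have BR : B `<=` CR by move=> _ [z Az <-]; apply: CR_flow; exact: AR.
have half u v : B u -> B v -> cost (m%:R * T0) a u <= cost (m%:R * T0) a v.
  move=> Bu Bv; apply: (le_trans (chain_cost_max _ _ _ _ v _)) => //.
  by rewrite (chain_cost_connected compactX m1 cB BR Bv Bu) ge_max lexx chain_cost_ge0.
have Bx : B (Phi (x, j%:R * T0)) by exists x.
have By : B (Phi (y, j%:R * T0)) by exists y.
by apply/eqP; rewrite eq_le !half.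
Qed.

(** For [a] near [x], one long step from [a] ends close to the image of [x], so this image has cost
    below [dl]. If [x] itself had cost below [dl], moving the start from [a] to [x] would give a
    chain from [x] to [x] that does not exist. *)
Lemma step_cost_strict x : ~ CR x -> exists m, exists2 e : R, 0 < e & forall a, mdist x a < e ->
  step_cost m.+1 a (Phi (x, T0)) < step_cost m.+1 a x.
Proof.
move=> nR; have [dl [T [dl0 T1 nC]]] : exists dl T, [/\ 0 < dl, 1 <= T & ~ dchain Phi dl T x x].
  apply: contrapT => H; apply: nR => dl T dl0 T1.
  by apply/dchainP; apply: contrapT => nC; apply: H; exists dl, T.
(* Moving the start uses up time [T] of the first step, so steps must last at least [T + T]. *)
pose m := Num.truncn (T + T).
have mT : T + T <= m.+1%:R * T0.
  apply: le_trans (_ : m.+1%:R * 1 <= _); last by rewrite ler_pM2l ?ltr0n.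
  by rewrite mulr1; apply: ltW; exact: truncnS_gt.
set T' := m.+1%:R * T0 in mT *.
exists m.
have dl20 : 0 < dl / 2 by rewrite divr_gt0.
have cT := @continuous_time _ _ Phi.
have [e1 e10 e1P] := uniform_continuous_map compactX (@cT T) dl0.
have [e2 e20 e2P] := uniform_continuous_map compactX (@cT T') dl20.
exists (Num.min e1 e2); first by rewrite lt_min e10.
move=> a; rewrite lt_min => /andP[xa1 xa2].
rewrite -subr_lt0 step_cost_step -/T' subr_lt0.
apply: (@lt_le_trans _ _ dl).
  apply: le_lt_trans (chain_cost_one compactX _ _ _ _) _.
  by rewrite metric_sym; have := e2P _ _ xa2; lra.
rewrite leNgt; apply/negP => /(chain_cost_lt compactX) C.
apply: nC; apply: (dchain_start_move (x := a)) => //; first lra.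
  exact: e1P.
exact: dchain_weaken C.
Qed.

(** Decrease is claimed only over steps of the prescribed length [T0]; averaging later turns this
    into decrease at all positive times. *)
Theorem conley_function : exists L : X -> R, [/\ continuous L,
  forall x, L (Phi (x, T0)) <= L x,
  forall x, ~ CR x -> L (Phi (x, T0)) < L x &
  forall A x y, connected A -> A `<=` CR -> A x -> A y -> L x = L y].
Proof.
have [[x0 _]|ne] := pselect (exists x : X, True); last first.
  exists (cst 0); split => //.
  - by move=> x; exact: cvg_cst.
  - by move=> x; case: ne; exists x.
have [D D0 DP] := diameter_bound compactX.
(* Nets of every mesh [1 / (k + 1)] supply base points arbitrarily close to any point, as
   [step_cost_strict] requires. *)
have /choice[net netP] : forall k : nat, exists s : seq X,
    forall x, exists2 y, y \in s & mdist y x < k.+1%:R^-1 :> R.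
  by move=> k; apply: (finite_net compactX); rewrite invr_gt0.
(* Indices encode the number of steps, the mesh and the position in the net; the default triple
   merely repeats a term. *)
pose dec (n : nat) : nat * nat * nat := odflt (0, 0, 0)%N (unpickle n).
have decK q : dec (pickle q) = q by rewrite /dec pickleK.
pose u (n : nat) (x : X) : R := let: (m, k, i) := dec n in
  step_cost m.+1 (nth x0 (net k) i) x / (m.+1%:R * D).
have mD m : 0 < (m.+1%:R * D)^-1 by rewrite invr_gt0 mulr_gt0.
have u01 n x : 0 <= u n x <= 1.
  rewrite /u; case: (dec n) => -[m k] i; apply/andP; split.
    rewrite divr_ge0 ?sumr_ge0//; last by rewrite ltW// mulr_gt0.
    by move=> j _; exact: chain_cost_ge0.
  rewrite ler_pdivrMr ?mulr_gt0// mul1r.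
  rewrite (_ : m.+1%:R * D = \sum_(j < m.+1) D); last by rewrite sumr_const card_ord mulr_natl.
  apply: ler_sum => j _; apply: ltW.
  by apply: le_lt_trans (chain_cost_one compactX _ _ _ _) _; exact: DP.
have ule n x : u n (Phi (x, T0)) <= u n x.
  by rewrite /u; case: (dec n) => -[m k] i; rewrite ler_pM2r//; exact: step_cost_le.
exists (dyadic_sum u); split.
- apply: (dyadic_sum_continuous u01) => n x; rewrite /u; case: (dec n) => -[m k] i.
  apply: (@cvgM R); last exact: cvg_cst.
  exact: step_cost_continuous.
- by move=> x; apply: (le_dyadic_sum u01) => n.
- move=> x nR; apply: (lt_dyadic_sum u01) => //.
  have [m [e e0 eP]] := step_cost_strict nR.
  pose k := Num.truncn e^-1.
  have ke : k.+1%:R^-1 < e.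
    rewrite -[ltRHS]invrK ltf_pV2 ?posrE ?invr_gt0//; exact: truncnS_gt.
  have [y ys yx] := netP k x.
  exists (pickle (m, k, index y (net k))); rewrite /u decK ltr_pM2r//.
  rewrite nth_index//; apply: eP; rewrite metric_sym; exact: lt_trans ke.
- move=> A x y cA AR Ax Ay.
  have E n : u n x = u n y.
    by rewrite /u; case: (dec n) => -[m k] i; congr (_ / _); exact: step_cost_connected cA AR _ _.
  by apply/eqP; rewrite eq_le; apply/andP; split; apply: (le_dyadic_sum u01) => n; rewrite E.
Qed.

End Conley.

(** * Decrease of the form on the set C_xi *)

Section SequenceDecay.
Context {R : realType} (m : nat) (M : R) (S : nat -> R) (l : nat -> 'I_m).
Hypothesis M0 : 0 <= M.
Hypothesis SM : forall k, S k.+1 <= S k + M.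
Hypothesis Sl : forall i j, (i < j)%N -> l i = l j -> S j <= S i - 1 / 2.

(** Skip to the last visit of the label of [i]: [S] has not grown by then, and this label never
    returns, so induction applies with one label fewer after a single step of growth at most [M]. *)
Lemma sequence_growth_in (A : {set 'I_m}) i k : (i <= k)%N ->
  (forall j, (i <= j <= k)%N -> l j \in A) -> S k <= S i + #|A|%:R * M.
Proof.
move: {2}#|A| (erefl #|A|) => n; elim: n A i => [|n IH] A i nA ik lA.
  by have := lA i; rewrite leqnn ik (cards0_eq nA) inE => /(_ isT).
pose P j := (i <= j <= k)%N && (l j == l i).
have exP : exists j, P j by exists i; rewrite /P leqnn ik eqxx.
have ubP j : P j -> (j <= k)%N by move=> /andP[/andP[]].
case: (ex_maxnP exP ubP) => j /andP[/andP[ij jk] /eqP lj] jmax.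
have Sji : S j <= S i.
  move: ij; rewrite leq_eqVlt => /orP[/eqP -> //|ij].
  by have := Sl ij (esym lj); lra.
have M0' := M0.
have [a [a0 aE]] : exists a : R, 0 <= a /\ n%:R * M = a.
  by exists (n%:R * M); rewrite mulr_ge0.
have ES : n.+1%:R * M = a + M by rewrite -natr1 mulrDl mul1r aE.
move: jk; rewrite nA ES leq_eqVlt => /orP[/eqP jk|jk].
  by rewrite -jk; lra.
have liA : l i \in A by apply: lA; rewrite leqnn ik.
have := IH (A :\ l i) j.+1 _ jk; rewrite (_ : #|A :\ l i| = n); last first.
  by have := cardsD1 (l i) A; rewrite liA nA add1n => -[].
rewrite aE => /(_ erefl); have Sj := SM j.
suff lA' : forall j0, (j < j0 <= k)%N -> l j0 \in A :\ l i by move=> /(_ lA'); lra.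
move=> j' /andP[jj' j'k]; rewrite !inE lA ?andbT; last first.
  by rewrite j'k andbT; apply: leq_trans (ltnW jj').
apply/negP => lj'; have := jmax j'; rewrite /P lj' j'k !andbT => /(_ (leq_trans ij (ltnW jj'))).
by rewrite leqNgt jj'.
Qed.

Lemma sequence_growth i k : (i <= k)%N -> S k <= S i + m%:R * M.
Proof.
move=> ik; have := @sequence_growth_in [set: 'I_m] i k ik.
by rewrite cardsT card_ord; apply => j _; rewrite inE.
Qed.

(** At the first visit of [c], [S] is at most [S 0 + m%:R * M], and each further visit lowers it by
    1/2; the summand 1/2 accounts for the first visit. *)
Lemma sequence_visits (c : 'I_m) k : (0 < \sum_(i < k) (l i == c))%N ->
  exists i, [/\ (i < k)%N, l i = c &
    S i + (\sum_(i < k) (l i == c))%:R / 2 <= S 0 + m%:R * M + 1 / 2].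
Proof.
elim: k => [|k IH]; first by rewrite big_ord0.
rewrite big_ord_recr /=; case: eqP => [lk _|_]; last first.
  by rewrite addn0 => /IH[i [ik li Si]]; exists i; split => //; exact: ltnW.
exists k; split => //; have [n0|n0] := posnP (\sum_(i < k) (l i == c))%N.
  by rewrite n0 add0n /=; have := sequence_growth (leq0n k); lra.
have [i [ik li Si]] := IH n0.
by have := Sl ik (etrans li (esym lk)); rewrite natrD /=; lra.
Qed.

(** Some label is visited more than [q] times. Then [q / 2] pays for the growth before the first and
    after the last of these visits, at most [m%:R * M] each, and for the final 1. *)
Lemma sequence_decay q : (m%:R * M + m%:R * M + 1) * 2 <= q%:R :> R ->
  S (m * q).+1 <= S 0 - 1.
Proof.
move=> qM; have [c cq] : exists c, (q < \sum_(i < (m * q).+1) (l i == c))%N.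
  apply: contrapT => H.
  suff : ((m * q).+1 <= m * q)%N by rewrite ltnn.
  have -> : (m * q).+1 = (\sum_(c < m) \sum_(i < (m * q).+1) (l i == c))%N.
    rewrite exchange_big /= -[LHS]card_ord -sum1_card; apply: eq_bigr => i _.
    rewrite (bigD1 (l i))//= eqxx big1 ?addn0// => c /negPf.
    by rewrite eq_sym => ->.
  rewrite -[X in (_ <= X * _)%N]card_ord -sum_nat_const; apply: leq_sum => c _.
  by rewrite leqNgt; apply/negP => cq; apply: H; exists c.
have [|i [ik li Si]] := @sequence_visits c (m * q).+1; first exact: leq_ltn_trans cq.
have : q.+1%:R <= (\sum_(i < (m * q).+1) (l i == c))%:R :> R by rewrite ler_nat.
rewrite -natr1; have := sequence_growth (ltnW ik); lra.
Qed.

End SequenceDecay.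

Section Decay.
Context {R : realType} {X : metricType R}.
Hypothesis compactX : compact [set: X].
Hypothesis lpcX : locally_path_connected R X.
Variables (Phi : flow R X) (xi : cech_H1 X R) (eps delta0 : R).
Hypothesis scale_xi : is_scale xi eps delta0.
Variable w : closed_one_form R X.
Hypothesis wxi : form_class w = xi.

Local Notation tau := (flow_integral w Phi).
Local Notation jmp := (jump eps w).
Local Notation CR := (chain_recurrent Phi).
Local Notation Rxi := (R_xi Phi xi eps delta0).
Local Notation Cxi := (C_xi Phi xi eps delta0).

Definition cycles_decrease := exists delta T : R, [/\ 0 < delta, 1 < T &
  forall (x : X) (t : R), Cxi x -> is_cycle Phi delta T x t ->
  forall z, cycle_associated Phi eps x t z -> pairing xi z <= -1].

Lemma cycle_associatedE x t z : cycle_associated Phi eps x t z ->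
  pairing xi z = tau x t + jmp (Phi (x, t)) x.
Proof.
by move=> /(pairing_associated scale_xi wxi) ->; rewrite /chain_value big_ord1.
Qed.

Lemma C_xi_decay : cycles_decrease ->
  exists2 T : R, 1 <= T & forall x, Cxi x -> tau x T <= -1.
Proof.
move=> [dl [T [dl0 T1 B]]].
(* Closing the gap contributes less than 1/2, so a pairing of at most -1 leaves at most -1/2 for the
   trajectory piece. *)
have [e e0 eP] := jump_small compactX lpcX scale_xi wxi (divr_gt0 ltr01 (ltr0Sn R 1)).
have d0 : 0 < delta0 by case: scale_xi.
pose d := Num.min dl (Num.min delta0 e).
have ddl : d <= dl by rewrite ge_min lexx.
have dd0 : d <= delta0 by rewrite ge_min ge_min lexx orbT.
have de : d <= e by rewrite ge_min ge_min lexx !orbT.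
have dpos : 0 < d by rewrite !lt_min dl0 d0.
have cyc x t : Cxi x -> T <= t -> mdist (Phi (x, t)) x < d -> tau x t <= - (1 / 2).
  move=> Cx Tt xt.
  have [|z zP] := @associated_exists _ _ Phi _ _ _ scale_xi 1 (fun=> x) (fun=> t) _ erefl.
    by move=> i _; exact: lt_le_trans dd0.
  have := B x t Cx _ z zP; rewrite (cycle_associatedE zP).
  have := eP _ _ (lt_le_trans xt de); rewrite ltr_norml => /andP[j1 j2] H.
  have : is_cycle Phi dl T x t by split => //; rewrite metric_sym; exact: lt_le_trans ddl.
  by move=> /H; lra.
have d20 : 0 < d / 2 by rewrite divr_gt0.
(* With mesh [d / 2], two samples with the same label are less than [d] apart. *)
have [s sP] := finite_net compactX d20.
have [M0 MP] := compact_bounded_above compactX (@flow_integral_continuous_time _ _ w Phi T).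
pose M := Num.max 0 M0.
have Mge0 : 0 <= M by rewrite le_max lexx.
have MM0 : M0 <= M by rewrite le_max lexx orbT.
pose m := size s; pose Q := (m%:R * M + m%:R * M + 1) * 2.
pose q := (Num.truncn Q).+1.
have qQ : Q <= q%:R by apply: ltW; exact: truncnS_gt.
exists ((m * q).+1%:R * T).
  have : 1 <= (m * q).+1%:R :> R by rewrite ler1n.
  by move: (_ %:R) => r r1; nra.
move=> x Cx.
have lP k : {l : 'I_m | mdist (nth x s l) (Phi (x, k%:R * T)) < d / 2}.
  apply: cid; have [y ys yk] := sP (Phi (x, k%:R * T)).
  have ym : (index y s < m)%N by rewrite index_mem.
  by exists (Ordinal ym); rewrite /= nth_index.
pose l k := sval (lP k); pose S (k : nat) := tau x (k%:R * T).
have -> : tau x ((m * q).+1%:R * T) = S (m * q).+1 by [].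
have S0 : S 0%N = 0 by rewrite /S mul0r flow_integral0.
have SD i j : (i <= j)%N -> S j = S i + tau (Phi (x, i%:R * T)) ((j - i)%:R * T).
  by move=> ij; rewrite -flow_integralD -mulrDl -natrD subnKC.
rewrite (_ : -1 = S 0%N - 1); last by rewrite S0 sub0r.
apply: (sequence_decay (M := M) (l := l)) => //.
  move=> k; rewrite (SD k k.+1)// subSnn mul1r lerD2l.
  exact: le_trans (MP _) MM0.
move=> i j ij lij; rewrite (SD i j (ltnW ij)) lerD2l.
apply: cyc; first exact: (C_xi_flow compactX lpcX scale_xi wxi).
  have : 1 <= (j - i)%:R :> R by rewrite ler1n subn_gt0.
  by move: (_ %:R) => r r1; nra.
rewrite flowD -mulrDl -natrD subnKC ?(ltnW ij)//.
have := svalP (lP i); have := svalP (lP j); rewrite -/(l i) -/(l j) -lij.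
have := metric_triangle (Phi (x, j%:R * T)) (nth x s (l i)) (Phi (x, i%:R * T)).
rewrite (metric_sym (Phi (x, j%:R * T)) (nth x s (l i))); lra.
Qed.

Lemma flow_integral_exact_on (Y : set X) (f : X -> R) x t :
  (forall U, form_cover w U -> locally_constant (U `&` Y) (fun x => form_fun w U x - f x)) ->
  (forall s, Y (Phi (x, s))) -> tau x t = f (Phi (x, t)) - f x.
Proof.
move=> fP Yx; rewrite /flow_integral (path_integral_in (V := Y) fP).
  by rewrite trajectory0 trajectory1.
by move=> _ [s _ <-]; exact: Yx.
Qed.

(** On [Y], [f] differs locally from the continuous [form_fun] by a constant, so it is locally
    bounded; compactness does the rest. *)
Lemma primitive_bounded_on (Y : set X) (f : X -> R) : closed Y ->
  (forall U, form_cover w U -> locally_constant (U `&` Y) (fun x => form_fun w U x - f x)) ->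
  exists M, forall x, Y x -> - M <= f x.
Proof.
move=> clY fP; have cY : compact Y.
  by apply: subclosed_compact compactX _.
have /compact_near_coveringP/near_covering_withinP cov := cY.
have H : \forall M \near +oo, Y `<=` (fun x => - M <= f x).
  apply: cov => x Yx; have [U wU Ux] := form_cover_mem w x.
  have lc := fP U wU x (conj Ux Yx).
  have bd : \forall y \near x, `|form_fun w U x - form_fun w U y| < 1.
    by have := form_fun_cvg wU Ux; move/(@cvgrPdist_lt R R^o); apply.
  exists ([set y | [/\ (U `&` Y) y -> form_fun w U y - f y = form_fun w U x - f x, U y &
      `|form_fun w U x - form_fun w U y| < 1]], [set M | 1 - f x < M]).
    split => /=; last by apply: nbhs_pinfty_gt; rewrite num_real.
    near=> y; split; near: y => //.
    exact: form_cover_nbhs wU Ux.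
  move=> [y M] /= [[yE Uy y1] My] Yy; have {}yE := yE (conj Uy Yy).
  by move: y1; rewrite ltr_norml => /andP[? ?]; lra.
near (+oo : set_system R) => M; exists M => x Yx.
have : Y `<=` (fun x => - M <= f x) by near: M.
exact.
Unshelve. all: by end_near. Qed.

Lemma C_xi_closed : cech_restrict Rxi xi = cech_zero -> cycles_decrease -> closed Cxi.
Proof.
move=> A B; have [T T1 TP] := C_xi_decay B.
have [f fP] := (cech_restrict_form Rxi w).1 (etrans (congr1 (cech_restrict Rxi) wxi) A).
have [M MP] := primitive_bounded_on (R_xi_closed compactX lpcX (Phi := Phi) scale_xi wxi) fP.
move=> x clx; split.
  apply: (chain_recurrent_closed compactX lpcX (Phi := Phi) scale_xi wxi).
  by apply: closure_subset clx => y [].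
move=> Rx; have Rxs s : Rxi (Phi (x, s)) by exact: (R_xi_flow compactX lpcX scale_xi wxi).
have TPc y : closure Cxi y -> tau y T <= -1.
  move=> cly; apply/ler_addgt0Pr => e e0.
  have := @flow_integral_continuous_time _ _ w Phi T y.
  move/(@cvgrPdist_lt R R^o) => /(_ e e0) /cly[z [Cz]].
  by have := TP z Cz; rewrite /= ltr_norml => ? /andP[? ?]; lra.
have clxs s : closure Cxi (Phi (x, s)).
  move=> N NP; have [y [Cy Ny]] := clx _ (@continuous_time _ _ Phi s x N NP).
  exists (Phi (y, s)); split => //; exact: (C_xi_flow compactX lpcX scale_xi wxi).
(* At a limit point of [C_xi] lying in [R_xi] the decrease recurs with every step of length [T],
   against the lower bound for [f] on [R_xi]. *)
have dec k : tau x (k%:R * T) <= - k%:R.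
  elim: k => [|k IH]; first by rewrite mul0r flow_integral0 oppr0.
  rewrite -natr1 mulrDl mul1r flow_integralD.
  by have := TPc _ (clxs (k%:R * T)); lra.
pose k := (Num.truncn (M + f x)).+1.
have := truncnS_gt (M + f x); rewrite -/k.
have := dec k; rewrite (flow_integral_exact_on _ fP)//.
by have := MP _ (Rxs (k%:R * T)); lra.
Qed.

End Decay.

(** * Construction of Lyapunov one-forms *)

Section Antiderivative.
Context {R : realType}.

Lemma exists_antiderivative (h : R -> R) : continuous h ->
  (* The margin to the left of 0, from integrating from -1, makes the derivative at 0 two-sided. *)
  exists A : R -> R, forall u : R, -1 < u -> is_derive u 1 A (h u).
Proof.
move=> ch; pose A (x : R) := (\int[lebesgue_measure]_(t in `[-1, x]) h t)%R.
exists A => u u1.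
have int : lebesgue_measure.-integrable `[-1, u + 1]%classic (EFin \o h).
  apply: continuous_compact_integrable; first exact: segment_compact.
  exact: continuous_subspaceT.
have uu1 : u < u + 1 by rewrite ltrDl.
have [dA EA] := @continuous_FTC1_closed R h (-1) u (u + 1) uu1 int u1 (ch u).
by apply: DeriveDef => //; rewrite -derive1E.
Qed.

Lemma antiderivative_mvt (A h : R -> R) (a b : R) : 0 <= a -> a < b ->
  (forall u : R, -1 < u -> is_derive u 1 A (h u)) ->
  exists2 c, a <= c <= b & A b - A a = h c * (b - a).
Proof.
move=> a0 ab dA; have H (u : R) : a <= u -> is_derive u 1 A (h u).
  by move=> au; apply: dA; lra.
have [||c] := @MVT R A h a b ab.
- by move=> x; rewrite in_itv/= => /andP[ax _]; apply: H; exact: ltW.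
- apply: continuous_in_subspaceT => x; rewrite inE/= in_itv/= => /andP[ax _].
  apply: differentiable_continuous; apply/derivable1_diffP.
  by have [] := H x ax.
- by rewrite in_itv/= => /andP[ac cb] E; exists c => //; rewrite !ltW.
Qed.

End Antiderivative.

(** * Averaging over time *)

Section Averaging.
Context {R : realType} {X : metricType R} (w : closed_one_form R X) (Phi : flow R X).
Local Notation tau := (flow_integral w Phi).
Variables (T : R) (Y : set X).
Hypothesis T0 : 0 < T.
Hypothesis Yflow : forall x t, ~ Y x -> ~ Y (Phi (x, t)).
Hypothesis tau_lt0 : forall x, ~ Y x -> tau x T < 0.

(* With [G] the average of [tau x] over [[0, T]], the integral of [w + dG] along
   the trajectory of [x] has time derivative [tau (x . t) T / T]. *)
Lemma exists_average : exists G : X -> R, [/\ continuous G,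
  forall x, (forall s, tau x s = 0) -> G x = 0 &
  forall x t, ~ Y x -> 0 < t -> tau x t + (G (Phi (x, t)) - G x) < 0].
Proof.
have T0' := T0.
have /choice[A dA] x : exists A : R -> R, forall u : R, -1 < u -> is_derive u 1 A (tau x u).
  by apply: exists_antiderivative; exact: flow_integral_continuous_orbit.
exists (fun x => (A x T - A x 0) / T); split.
- move=> x; apply: (@cvgM R); last exact: cvg_cst.
  apply/(@cvgrPdist_lt R R^o) => e e0.
  have /compact_near_coveringP cov := @segment_compact R 0 T.
  pose e' := e / (2 * T).
  have e'0 : 0 < e' by rewrite divr_gt0// mulr_gt0.
  have e'20 : 0 < e' / 2 by rewrite divr_gt0.
  (* Compactness of the time interval makes the continuity of [tau] uniform in time. *)
  have : \forall y \near x, `[0, T]%classic `<=` (fun s => `|tau x s - tau y s| < e').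
    apply: cov => s _.
    have := @flow_integral_continuous _ _ w Phi (x, s).
    move/(@cvgrPdist_lt R R^o) => /(_ _ e'20) [[N J] /= [xN sJ] NJ].
    exists (J, N) => //= -[s' y] /= [Js' Ny].
    have := NJ (x, s') (conj (nbhs_singleton xN) Js').
    have := NJ (y, s') (conj Ny Js').
    rewrite /= => H1 H2; have := ler_distD (tau x s) (tau x s') (tau y s').
    by rewrite (distrC (tau x s') (tau x s)); lra.
  apply: filterS => y yT.
  pose B (u : R) : R := A x u - A y u.
  have dB (u : R) : -1 < u -> is_derive u 1 B (tau x u - tau y u).
    by move=> u1; apply: is_deriveB; exact: dA.
  have [c /andP[c0 cT] E] := antiderivative_mvt (lexx 0) T0 dB.
  have -> : A x T - A x 0 - (A y T - A y 0) = B T - B 0 by rewrite /B; lra.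
  rewrite E subr0 normrM (gtr0_norm T0).
  have cin : `[0, T]%classic c by rewrite /= in_itv/= c0.
  have := yT c cin.
  have <- : e' * (2 * T) = e by rewrite /e' divfK// gt_eqF// mulr_gt0.
  by move: `|_| => z ze; nra.
- move=> x t0; have [c _ ->] := antiderivative_mvt (lexx 0) T0 (dA x).
  by rewrite t0 !mul0r.
- move=> x t nY t0; have t0' := t0; set y := Phi (x, t).
  have tauE u : tau y u = tau x (t + u) - tau x t.
    by have := flow_integralD w Phi x t u; rewrite -/y; lra.
  have dAshift k (u : R) : 0 <= k -> -1 < u ->
      is_derive u 1 (A x \o shift k) (tau x (u + k)).
    move=> k0 u1; rewrite -[tau x _]mulr1; apply: is_derive1_comp.
      by apply: dA => /=; lra.
    exact: is_derive_shift.
  (* The integral of [tau x] over a window of length [T] starting at [u]; its derivative is the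
     integral of the form over time [T] from [Phi (x, u)]. *)
  pose D (u : R) : R := (A x \o shift T) u - A x u.
  have dD (v : R) : -1 < v -> is_derive v 1 D (tau (Phi (x, v)) T).
    move=> v1; have -> : tau (Phi (x, v)) T = tau x (v + T) - tau x v.
      by have := flow_integralD w Phi x v T; lra.
    by apply: is_deriveB; [apply: dAshift => //; exact: ltW|exact: dA].
  (* [E] has zero derivative by additivity of [tau]; its constancy replaces a change of variable in
     the integral of [tau y]. *)
  pose E (u : R) : R := A y u - (A x \o shift t) u + u * tau x t.
  have dE (u : R) : -1 < u -> is_derive u 1 E (cst 0 u).
    move=> u1; have -> : cst 0 u = tau y u - tau x (u + t) + (u *: 0 + tau x t *: 1).
      by rewrite tauE (addrC t) scaler0 add0r /cst /GRing.scale /=; lra.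
    apply: is_deriveD; last by apply: is_deriveM.
    by apply: is_deriveB; [exact: dA|apply: dAshift => //; exact: ltW].
  have [c _] := antiderivative_mvt (lexx 0) T0 dE.
  have [c' _] := antiderivative_mvt (lexx 0) t0 dD.
  have := tau_lt0 (@Yflow x c' nY).
  rewrite /E /D /= !subr0 !mul0r !addr0 !add0r (addrC T t) => H1 H2 H3.
  have H4 : tau (Phi (x, c')) T * t < 0 by rewrite pmulr_llt0.
  suff : (tau x t + ((A y T - A y 0) / T - (A x T - A x 0) / T)) * T < 0.
    by rewrite pmulr_llt0.
  rewrite mulrDl mulrBl !divfK ?gt_eqF//; lra.
Unshelve. all: by end_near. Qed.

End Averaging.

(** * Making a one-form vanish near a closed set *)

Section NearClosedSet.
Context {R : realType} {X : metricType R}.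
Hypothesis compactX : compact [set: X].
Hypothesis lpcX : locally_path_connected R X.
Variable w : closed_one_form R X.
Variable Y : set X.
Hypothesis closedY : closed Y.

Definition thickening (r : R) : set X := [set x | exists2 y, Y y & mdist x y < r].

Lemma thickening_near r x : thickening r x -> \forall x' \near x, thickening r x'.
Proof.
move=> [y Yy xy]; have e0 : 0 < r - mdist x y by rewrite subr_gt0.
apply: filterS (nbhs_mdist x e0) => x' xx'; exists y => //.
by have := metric_triangle x' x y; rewrite (metric_sym x' x); lra.
Qed.

Lemma thickening_open r : open (thickening r).
Proof. by rewrite openE => x /thickening_near. Qed.

(** A class that vanishes on a closed set vanishes near it. The values of [f0] are continued from
    nearby points of [Y] by local primitives; short paths show that the result does not depend on
    the point chosen. *)
Lemma exists_extension (f0 : X -> R) :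
  (forall U, form_cover w U -> locally_constant (U `&` Y) (fun x => form_fun w U x - f0 x)) ->
  exists2 e : R, 0 < e & exists f : X -> R, forall U, form_cover w U ->
    locally_constant (U `&` thickening e) (fun x => form_fun w U x - f x).
Proof.
move=> f0P.
have [r r0 rP] : exists2 r : R, 0 < r & forall x, exists2 U, form_cover w U &
    [set y | mdist x y < r] `<=` U /\ forall y z, mdist x y < r -> mdist x z < r ->
      Y y -> Y z -> form_fun w U y - f0 y = form_fun w U z - f0 z.
  pose P (A : set X) := exists2 U, form_cover w U & A `<=` U /\
    forall y z, A y -> A z -> Y y -> Y z -> form_fun w U y - f0 y = form_fun w U z - f0 z.
  apply: (lebesgue_number compactX (P := P)).
    move=> A B AB [U wU [BU HU]]; exists U => //; split; first by move=> x /AB/BU.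
    by move=> y z /AB By /AB Bz; exact: HU.
  move=> x; have [U wU Ux] := form_cover_mem w x.
  have [Yx|nYx] := pselect (Y x); last first.
    exists (U `&` ~` Y).
      apply: filterI; first exact: form_cover_nbhs wU Ux.
      by apply: open_nbhs_nbhs; split => //; exact: closed_openC.
    exists U => //; split; first by move=> y [].
    by move=> y z [_ nYy] _ Yy; case: nYy.
  exists (U `&` [set y | (U `&` Y) y -> form_fun w U y - f0 y = form_fun w U x - f0 x]).
    apply: filterI; first exact: form_cover_nbhs wU Ux.
    exact: f0P.
  exists U => //; split; first by move=> y [].
  by move=> y z [Uy yE] [Uz zE] Yy Yz; rewrite yE// zE.
have /choice[u uP] y : exists U, [/\ form_cover w U, [set z | mdist y z < r] `<=` U &
    forall z z', mdist y z < r -> mdist y z' < r ->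
      Y z -> Y z' -> form_fun w U z - f0 z = form_fun w U z' - f0 z'].
  by have [U ? [? ?]] := rP y; exists U.
have r20 : 0 < r / 2 by rewrite divr_gt0.
have [e1 e10 e1P] := uniform_path compactX lpcX r20.
pose e := Num.min e1 (r / 2).
have ee1 : e <= e1 by rewrite ge_min lexx.
have er : e <= r / 2 by rewrite ge_min lexx orbT.
have e0 : 0 < e by rewrite lt_min e10.
exists e => //.
(* The value at [x] continued from [y]: the local primitive on [u y], normalized to be [f0 y] at
   [y]. *)
pose k y x := form_fun w (u y) x - form_fun w (u y) y + f0 y.
have kE x y y' : Y y -> Y y' -> mdist x y < e -> mdist x y' < e -> k y x = k y' x.
  move=> Yy Yy' xy xy'; have [wu uS uC] := uP y; have [wu' uS' uC'] := uP y'.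
  have [p [p0 p1 pr]] := e1P _ _ (lt_le_trans xy ee1).
  have yx : mdist y x < e by rewrite metric_sym.
  have y'x : mdist y' x < e by rewrite metric_sym.
  have int V : form_cover w V -> (forall s, V (p s)) ->
      path_integral w p = form_fun w V y - form_fun w V x.
    move=> wV pV; rewrite -p0 -p1.
    apply: (@path_integral_in _ _ w p V (form_fun w V)).
      by move=> V' wV'; exact: form_compat.
    by move=> _ [s _ <-].
  have Eu : path_integral w p = form_fun w (u y) y - form_fun w (u y) x.
    apply: int => // s; apply: uS => /=.
    by have := metric_triangle y x (p s); have := pr s; lra.
  have Eu' : path_integral w p = form_fun w (u y') y - form_fun w (u y') x.
    apply: int => // s; apply: uS' => /=.
    by have := metric_triangle y' x (p s); have := pr s; lra.
  have y'y : mdist y' y < r by have := metric_triangle y' x y; lra.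
  have := uC' y y' y'y _ Yy Yy'; rewrite mdistxx => /(_ r0) E'.
  by rewrite /k; lra.
have /choice[v vP] x : exists y, thickening e x -> Y y /\ mdist x y < e.
  have [[y Yy xy]|nx] := pselect (thickening e x); first by exists y.
  by exists x.
exists (fun x => k (v x) x) => V wV x [Vx ex].
have [Yv xv] := vP x ex; have [wu uS _] := uP (v x).
have ux : u (v x) x by apply: uS => /=; rewrite metric_sym; lra.
have nv : \forall x' \near x, mdist x' (v x) < e.
  have d0 : 0 < e - mdist x (v x) by rewrite subr_gt0.
  apply: filterS (nbhs_mdist x d0) => x' xx'.
  by have := metric_triangle x' x (v x); rewrite (metric_sym x' x); lra.
have nc := form_compat_near wV wu Vx ux.
near=> x' => -[Vx' ex'].
have [Yv' xv'] := vP x' ex'.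
have x'v : mdist x' (v x) < e by near: x'.
rewrite (kE x' (v x') (v x))// /k.
have : form_fun w V x' - form_fun w (u (v x)) x' =
  form_fun w V x - form_fun w (u (v x)) x by near: x'.
lra.
Unshelve. all: by end_near. Qed.

(** The new form is [w - d(chi f)], with [f] the extended primitive and [chi] a cutoff function, so
    the class is kept. *)
Lemma exists_form_vanishing_near (f0 : X -> R) :
  (forall U, form_cover w U -> locally_constant (U `&` Y) (fun x => form_fun w U x - f0 x)) ->
  exists (w' : closed_one_form R X) (e : R), [/\ 0 < e, form_class w' = form_class w &
    forall U, form_cover w' U -> locally_constant (U `&` thickening e) (form_fun w' U)].
Proof.
(* The empty set is treated apart because the distance to [Y] is an infimum over [Y]. *)
move=> f0P; have [[y0 Yy0]|nY] := pselect (exists y, Y y); last first.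
  exists w, 1; split => // U wU x [_ [y Yy _]].
  by case: nY; exists y.
have [e e0 [f fP]] := exists_extension f0P.
pose dY (x : X) : R := inf [set mdist x y | y in Y].
have hinf x : has_inf [set mdist x y | y in Y].
  split; first by exists (mdist x y0); exists y0.
  by exists 0 => _ [y _ <-]; exact: mdist_ge0.
have dY_lt r x : dY x < r <-> thickening r x.
  split=> [dr|[y Yy xy]].
    have r0 : 0 < r - dY x by rewrite subr_gt0.
    have [_ [y Yy <-] yr] := inf_adherent r0 (hinf x).
    by exists y => //; move: yr; rewrite -/(dY x); lra.
  apply: le_lt_trans xy; apply: ge_inf; first by case: (hinf x).
  by exists y.
have dY_lip x x' : dY x' <= dY x + mdist x x'.
  apply/ler_addgt0Pr => r r0.
  have /dY_lt[y Yy xy] : dY x < dY x + r by rewrite ltrDl.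
  apply: (@le_trans _ _ (mdist x' y)).
    by apply: ge_inf; [case: (hinf x')|exists y].
  by have := metric_triangle x' x y; rewrite (metric_sym x' x); lra.
have cdY : continuous dY.
  move=> x; apply/(@cvgrPdist_lt R R^o) => r r0.
  apply: filterS (nbhs_mdist x r0) => z xz.
  have := dY_lip x z; have := dY_lip z x.
  by rewrite (metric_sym z x) ltr_distlC => ? ?; apply/andP; split; lra.
(* As a function of the distance to [Y], [chi] drops linearly from 1 at [e / 3] to 0 at
   [2 * e / 3]. *)
pose chi (x : X) : R := Num.max 0 (Num.min 1 (2 - 3 / e * dY x)).
have cchi : continuous chi.
  move=> x; apply: (@continuous_max R X (cst 0)); first exact: cvg_cst.
  apply: (@continuous_min R X (cst 1)); first exact: cvg_cst.
  apply: (@cvgB R R^o); first exact: cvg_cst.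
  by apply: (@cvgM R); [exact: cvg_cst|exact: cdY].
have chi1 x : dY x < e / 3 -> chi x = 1.
  move=> de; have : 3 / e * dY x < 1.
    have E : 3 / e * (e / 3) = 1 by field; rewrite gt_eqF.
    by have := ltr_pM2l (divr_gt0 (ltr0Sn R 2) e0) (dY x) (e / 3); rewrite E de.
  move=> H; rewrite /chi (min_idPl _); last lra.
  by rewrite (max_idPr _).
have chi0 x : 2 * e / 3 < dY x -> chi x = 0.
  move=> de; have : 2 < 3 / e * dY x.
    have E : 3 / e * (2 * e / 3) = 2 by field; rewrite gt_eqF.
    by have := ltr_pM2l (divr_gt0 (ltr0Sn R 2) e0) (2 * e / 3) (dY x); rewrite E de.
  by move=> H; rewrite /chi (max_idPl _)// ge_min; apply/orP; right; lra.
pose G x := - (chi x * f x).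
have cG : continuous G.
  move=> x; have [xe|xe] := ltP (dY x) e.
    have [U wU Ux] := form_cover_mem w x.
    have ex : thickening e x by apply/dY_lt.
    have cf : f z @[z --> x] --> f x.
      have lc := fP U wU x (conj Ux ex).
      have c1 := form_fun_cvg wU Ux.
      rewrite -[X in _ --> X](subKr (form_fun w U x)).
      apply: (@cvg_trans _ ((form_fun w U z - (form_fun w U x - f x)) @[z --> x])); last first.
        by apply: (@cvgB R R^o) => //; exact: cvg_cst.
      apply: near_eq_cvg; near=> z.
      have : (U `&` thickening e) z -> form_fun w U z - f z = form_fun w U x - f x by near: z.
      move=> <-; first by lra.
      split; near: z; first exact: form_cover_nbhs wU Ux.
      exact: thickening_near.
    apply: (@cvgN R R^o); apply: (@cvgM R) => //; exact: cchi.
  (* At distance at least [e] from [Y], where [f] is arbitrary, [chi] vanishes on the ball of radius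
     [e / 3]. *)
  apply: (@cvg_trans _ (cst 0 z @[z --> x])); last first.
    by rewrite /G chi0 ?mul0r ?oppr0; [exact: cvg_cst|lra].
  apply: near_eq_cvg.
  have e30 : 0 < e / 3 by rewrite divr_gt0.
  apply: filterS (nbhs_mdist x e30) => z xz; rewrite /G chi0 ?mul0r ?oppr0//.
  by have := dY_lip z x; rewrite (metric_sym z x); lra.
exists (add_exact w cG), (e / 3); split.
- by rewrite divr_gt0.
- exact: form_class_add_exact.
- move=> U wU; have sub : U `&` thickening (e / 3) `<=` U `&` thickening e.
    by move=> x [Ux [y Yy xy]]; split => //; exists y => //; lra.
  apply: eq_locally_constant (locally_constantS sub (fP U wU)).
  by move=> x; rewrite inE => -[Ux /dY_lt xe] /=; rewrite /G chi1// mul1r.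
Unshelve. all: by end_near. Qed.

End NearClosedSet.

(** * The two implications *)

Section Construction.
Context {R : realType} {X : metricType R}.
Hypothesis compactX : compact [set: X].
Hypothesis lpcX : locally_path_connected R X.
Variables (Phi : flow R X) (xi : cech_H1 X R) (eps delta0 : R).
Hypothesis scale_xi : is_scale xi eps delta0.

Local Notation CR := (chain_recurrent Phi).
Local Notation Rxi := (R_xi Phi xi eps delta0).
Local Notation Cxi := (C_xi Phi xi eps delta0).

Lemma add_exact_integral (w : closed_one_form R X) (G : X -> R) (cG : continuous G) x t :
  flow_integral (add_exact w cG) Phi x t = flow_integral w Phi x t + (G (Phi (x, t)) - G x).
Proof.
rewrite /flow_integral (@path_integral_exact _ _ w (add_exact w cG) G).
  by rewrite trajectory0 trajectory1.
move=> U V wU wV; rewrite setIC; apply: eq_locally_constant (form_compat wV wU) => y _ /=.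
lra.
Qed.

Lemma exists_lyapunov_form : cech_restrict Rxi xi = cech_zero ->
  cycles_decrease Phi xi eps delta0 ->
  exists w : closed_one_form R X, lyapunov_form Phi Rxi w /\ form_class w = xi.
Proof.
move=> A B; have [w0 w0xi] := exists_form compactX xi.
have closedY := R_xi_closed compactX lpcX (Phi := Phi) scale_xi w0xi.
have Yflow x s : Rxi x -> Rxi (Phi (x, s)) by exact: (R_xi_flow compactX lpcX scale_xi w0xi).
have nYflow x s : ~ Rxi x -> ~ Rxi (Phi (x, s)).
  by move=> nY /(Yflow _ (- s)); rewrite flowN.
have YCR : Rxi `<=` CR by exact: (R_xi_sub scale_xi w0xi).
have CRflow p s : CR p -> CR (Phi (p, s)).
  exact: (chain_recurrent_flow compactX lpcX scale_xi w0xi).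
have [f0 f0P] := (cech_restrict_form Rxi w0).1 (etrans (congr1 (cech_restrict Rxi) w0xi) A).
have [w1 [e [e0 w1w0 w1P]]] := exists_form_vanishing_near compactX lpcX closedY f0P.
have w1xi : form_class w1 = xi by rewrite w1w0.
have [T T1 TP] := C_xi_decay compactX lpcX scale_xi w1xi B.
have T0 : 0 < T by lra.
have Ye : Rxi `<=` thickening Rxi e by move=> x Yx; exists x => //; rewrite mdistxx.
have tau1Y x t : Rxi x -> flow_integral w1 Phi x t = 0.
  move=> Yx; rewrite (@flow_integral_exact_on _ _ Phi w1 Rxi (cst 0)).
  - by rewrite subrr.
  - move=> U wU; have sub : U `&` Rxi `<=` U `&` thickening Rxi e.
      by move=> y [Uy /Ye].
    apply: eq_locally_constant (locally_constantS sub (w1P U wU)) => y _.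
    by rewrite subr0.
  - by move=> s; exact: Yflow.
(* Near [x] the integral changes only through local primitives at the two ends, and these are
   locally constant close to [R_xi]. *)
have tau1near x : Rxi x -> \forall x' \near x, flow_integral w1 Phi x' T = 0.
  move=> Yx; have [U wU Ux] := form_cover_mem w1 x.
  have [V wV Vx] := form_cover_mem w1 (Phi (x, T)).
  have n1 := flow_integral_near (Phi := Phi) wU wV Ux Vx.
  have YxT := Yflow x T Yx.
  have n2 := w1P _ wU x (conj Ux (Ye _ Yx)).
  have n3 := @continuous_time _ _ Phi T x _ (w1P _ wV _ (conj Vx (Ye _ YxT))).
  have n4 := form_cover_nbhs wU Ux.
  have n5 := @continuous_time _ _ Phi T x _ (form_cover_nbhs wV Vx).
  have n6 := thickening_near (Ye _ Yx).
  have n7 := @continuous_time _ _ Phi T x _ (thickening_near (Ye _ YxT)).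
  near=> x'.
  have : flow_integral w1 Phi x' T - flow_integral w1 Phi x T =
    form_fun w1 V (Phi (x', T)) - form_fun w1 V (Phi (x, T))
    - (form_fun w1 U x' - form_fun w1 U x) by near: x'.
  have -> : form_fun w1 U x' = form_fun w1 U x.
    have : (U `&` thickening Rxi e) x' -> form_fun w1 U x' = form_fun w1 U x by near: x'.
    by apply; split; near: x'.
  have -> : form_fun w1 V (Phi (x', T)) = form_fun w1 V (Phi (x, T)).
    have : (V `&` thickening Rxi e) (Phi (x', T)) ->
      form_fun w1 V (Phi (x', T)) = form_fun w1 V (Phi (x, T)) by near: x'.
    by apply; split; near: x'.
  by rewrite (tau1Y x)// !subrr !subr0.
have [L [cL Lle Llt Lconn]] := conley_function compactX CRflow T1.
pose b x := flow_integral w1 Phi x T.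
have cb : continuous b by exact: flow_integral_continuous_time.
pose D x := L x - L (Phi (x, T)).
have D0 x : 0 <= D x by rewrite subr_ge0.
have Dgt0 x : ~ CR x -> 0 < D x by move=> nR; rewrite subr_gt0; exact: Llt.
have cD : continuous D.
  move=> x; apply: (@cvgB R R^o); first exact: cL.
  apply: (@continuous_comp _ _ _ (fun x => Phi (x, T)) L); last exact: cL.
  exact: continuous_time.
have Cb x : ~ Rxi x -> CR x -> b x < 0.
  by move=> nY Rx; have := TP x (conj Rx nY); rewrite -/(b x); lra.
have /compact_near_coveringP cov := compactX.
(* Where [b] is negative, every [k > 0] works near [x]. Near [R_xi], [b] is 0, so points off [R_xi]
   are not in [CR] and [D] is positive there. Elsewhere [b x >= 0] rules out recurrence of [x], so
   [D] is bounded below near [x] and a large [k] wins. *)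
have : \forall k \near +oo, [set: X] `<=` (fun x => ~ Rxi x -> b x < k * D x).
  apply: cov => x _; have [bx|bx] := ltP (b x) 0.
    exists ([set y | b y < 0], [set k | 0 < k]).
      split => /=; last by apply: nbhs_pinfty_gt; rewrite num_real.
      exact: (cvgr_lt _ (cb x)).
    move=> [y k] /= [by0 k0] _; apply: (lt_le_trans by0).
    by rewrite mulr_ge0// ltW.
  have [Yx|nYx] := pselect (Rxi x).
    exists ([set y | b y = 0], [set k | 0 < k]).
      split => /=; first exact: tau1near.
      by apply: nbhs_pinfty_gt; rewrite num_real.
    move=> [y k] /= [by0 k0] nY; rewrite by0 mulr_gt0//.
    by apply: Dgt0 => Ry; have := Cb y nY Ry; rewrite by0 ltxx.
  have Dx : 0 < D x by apply: Dgt0 => Rx; have := Cb x nYx Rx; lra.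
  have Dx2 : D x / 2 < D x by lra.
  exists ([set y | b y < b x + 1 /\ D x / 2 < D y], [set k | (b x + 1) / (D x / 2) < k]).
    split => /=; last by apply: nbhs_pinfty_gt; rewrite num_real.
    apply: filterI.
      by apply: (cvgr_lt _ (cb x)); rewrite ltrDl.
    exact: (cvgr_gt _ (cD x)).
  move=> [y k] /= [[by1 Dy] kk] _; apply: (lt_trans by1).
  have D20 : 0 < D x / 2 by rewrite divr_gt0.
  move: kk; rewrite ltr_pdivrMr// => kk; apply: (lt_trans kk).
  rewrite ltr_pM2l//; apply: lt_trans (_ : (b x + 1) / (D x / 2) < k); last by rewrite ltr_pdivrMr.
  by rewrite divr_gt0//; lra.
move=> Hk; near (+oo : set_system R) => k.
have kP x : ~ Rxi x -> b x < k * D x.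
  by have : [set: X] `<=` (fun x => ~ Rxi x -> b x < k * D x); [near: k|apply].
have ckL : continuous (fun x => k * L x).
  by move=> x; apply: (@cvgM R); [exact: cvg_cst|exact: cL].
pose w3 := add_exact w1 ckL.
have tau3 x t : flow_integral w3 Phi x t =
    flow_integral w1 Phi x t + (k * L (Phi (x, t)) - k * L x).
  exact: add_exact_integral.
(* The choice of [k] gives decrease over time exactly [T]; averaging extends it to all positive
   times. *)
have [|G [cG GY Glt]] := @exists_average _ _ w3 Phi T Rxi T0 nYflow.
  by move=> x nY; rewrite tau3; have := kP x nY; rewrite /b /D; lra.
have LY x y : Rxi x -> connected_component Rxi x y -> L x = L y.
  move=> Yx xy; apply: (Lconn (connected_component Rxi x)) => //.
  - exact: component_connected.
  - by move=> z /connected_component_sub/YCR.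
  - exact: connected_component_refl.
(* An orbit in [R_xi] is a connected subset of [CR], so [L] is constant on it and the form
   integrates to 0 along it for every time. *)
have G0 x : Rxi x -> G x = 0.
  move=> Yx; apply: GY => s; rewrite tau3 tau1Y// add0r; apply/eqP; rewrite subr_eq0; apply/eqP.
  congr (k * _); apply: (Lconn (range (fun t : R => Phi (x, t)))).
  - apply: connected_continuous_connected; first exact/connected_intervalP.
    by apply: continuous_subspaceT; exact: continuous_orbit.
  - by move=> _ [t _ <-]; apply: YCR; exact: Yflow.
  - by exists s.
  - by exists 0 => //; rewrite flow0.
exists (add_exact w3 cG); split; last by rewrite !form_class_add_exact.
split.
  move=> x t nY t0; have := Glt x t nY t0.
  by rewrite -add_exact_integral.
(* On the thickening [w1] is the zero one-form, so the functions added to it form a primitive. *)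
exists (thickening Rxi e), (fun x => k * L x + G x); split.
- exact: thickening_open.
- exact: Ye.
- apply: continuous_subspaceT => x; apply: (@cvgD R R^o); [exact: ckL|exact: cG].
- move=> V wV; apply: eq_locally_constant (w1P V wV) => x _ /=; lra.
- move=> x y Yx xy; have Yy := connected_component_sub xy.
  by rewrite (LY x y Yx xy) !G0.
Unshelve. all: by end_near. Qed.

Lemma lyapunov_form_exact_on (w : closed_one_form R X) : form_class w = xi ->
  lyapunov_form Phi Rxi w -> cech_restrict Rxi xi = cech_zero.
Proof.
move=> <- [_ [U [f [_ YU _ fP _]]]]; apply/cech_restrict_form.
exists f => V wV; apply: locally_constantS (fP V wV) => x [Vx Yx].
by split => //; exact: YU.
Qed.

Lemma lyapunov_form_cycles (w : closed_one_form R X) : form_class w = xi ->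
  lyapunov_form Phi Rxi w -> closed Cxi -> cycles_decrease Phi xi eps delta0.
Proof.
move=> wxi [Llt _] clC.
have Cflow x s : Cxi x -> Cxi (Phi (x, s)) by exact: (C_xi_flow compactX lpcX scale_xi wxi).
have tau_lt x t : Cxi x -> 0 < t -> flow_integral w Phi x t < 0.
  by move=> [_ nY]; exact: Llt.
have cC : compact Cxi by apply: subclosed_compact compactX _.
have /compact_near_coveringP/near_covering_withinP cov := cC.
(* Compactness of [C_xi] turns strict decrease over unit time into decrease by a uniform amount
   [c]. *)
have H : \forall c \near 0^'+, Cxi `<=` (fun x => flow_integral w Phi x 1 < - c).
  apply: cov => x Cx; have x0 := tau_lt x 1 Cx ltr01.
  have c2 : flow_integral w Phi x 1 < flow_integral w Phi x 1 / 2 by lra.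
  exists ([set y | flow_integral w Phi y 1 < flow_integral w Phi x 1 / 2],
          [set c | c < - (flow_integral w Phi x 1 / 2)]).
    split => /=; last by apply: nbhs_right_lt; lra.
    exact: (cvgr_lt _ (@flow_integral_continuous_time _ _ w Phi 1 x)).
  by move=> [y c] /= [yx cx] _; lra.
near (0 : R)^'+ => c.
have c0 : 0 < c by near: c; exact: nbhs_right_gt.
have cP x : Cxi x -> flow_integral w Phi x 1 < - c.
  by have : Cxi `<=` (fun x => flow_integral w Phi x 1 < - c); [near: c|apply].
have cn n x : Cxi x -> flow_integral w Phi x n%:R <= - (n%:R * c).
  move=> Cx; elim: n => [|n IH]; first by rewrite flow_integral0 mul0r oppr0.
  rewrite -natr1 flow_integralD mulrDl mul1r.
  by have := cP _ (Cflow x n%:R Cx); lra.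
have [e e0 eP] := jump_small compactX lpcX scale_xi wxi ltr01.
(* A decrease by 2 leaves at most -1 after a jump of less than 1. *)
pose n := (Num.truncn (2 / c)).+1.
have nc : 2 <= n%:R * c by rewrite -ler_pdivrMr// ltW// truncnS_gt.
(* The extra 1 leaves a positive time beyond [n], over which the integral is still negative. *)
exists e, (n%:R + 1); split => //; first by rewrite ltrDr ltr0n.
move=> x t Cx [Tt xt] z zP; rewrite (cycle_associatedE scale_xi wxi zP).
have xt' : mdist (Phi (x, t)) x < e by rewrite metric_sym.
have := eP _ _ xt'; rewrite ltr_norml => /andP[_ j1].
have tn : 0 < t - n%:R by lra.
have := flow_integralD w Phi x n%:R (t - n%:R).
rewrite addrC subrK => E.
have := tau_lt _ _ (Cflow x n%:R Cx) tn; have := cn n x Cx; lra.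
Unshelve. all: by end_near. Qed.

End Construction.

Theorem theorem2 (R : realType) (X : metricType R)
    (compactX : compact [set: X])
    (lpcX : locally_path_connected R X)
    (Phi : flow R X) (xi : cech_H1 X R)
    (eps delta0 : R) (scale_xi : is_scale xi eps delta0) :
  let Rxi := R_xi Phi xi eps delta0 in
  let Cxi := C_xi Phi xi eps delta0 in
  let A := cech_restrict Rxi xi = cech_zero in
  let B := exists delta T : R, [/\ 0 < delta, 1 < T &
    forall (x : X) (t : R), Cxi x -> is_cycle Phi delta T x t ->
    forall z : singular_H1 R X, cycle_associated Phi eps x t z ->
      pairing xi z <= -1] in
  let L := exists w : closed_one_form R X,
    lyapunov_form Phi Rxi w /\ form_class w = xi in
  (A -> B -> L /\ closed Cxi) /\ (L -> closed Cxi -> A /\ B).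
Proof.
move=> Rxi Cxi A B L; split=> [hA hB|[w [wL wxi]] clC].
  split; first exact: exists_lyapunov_form.
  have [w wxi] := exists_form compactX xi.
  exact: (C_xi_closed compactX lpcX scale_xi wxi).
split; first exact: lyapunov_form_exact_on wxi wL.
exact: lyapunov_form_cycles wxi wL clC.
Qed.
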